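(* Let $\{G_n\}_{n\in\mathbb N}$ be a sequence of finite graphs with number of vertices tending to infinity, converging to a graphon $w$, i.e. $\delta_\Box(w_{G_n},w)\to0$. Then $w$ is Robinsonian if and only if $\widetilde{\Gamma}(G_n)\to0$.
   Context: A graphon is a symmetric measurable $w:[0,1]^2\to[0,1]$; it is Robinson if for all $0\le x\le y\le z\le1$, $w(x,z)\le\min\{w(x,y),w(y,z)\}$. Cut norm: $\|u\|_\Box=\sup_{S,T}|\int_{S\times T}u|$ over measurable $S,T\subseteq[0,1]$. Cut distance: $\delta_\Box(u,w)=\inf_\phi\|u^\phi-w\|_\Box$, the infimum over measure-preserving bijections $\phi$ of $[0,1]$, where $u^\phi(x,y)=u(\phi(x),\phi(y))$. A graphon $w$ is Robinsonian if there is a Robinson graphon $u$ with $\delta_\Box(u,w)=0$. For a graph $H$ on vertex set $\{1,\dots,n\}$ with adjacency matrix $(a_{ij})$, $w_H$ equals $a_{ij}$ on $I_i\times I_j$, where $I_1,\dots,I_n$ partition $[0,1]$ into consecutive intervals of length $1/n$ (for an unlabeled graph $G$, $w_G$ is this for any fixed labeling). For bounded symmetric measurable $u$ and measurable $A\subseteq[0,1]$, $\Gamma(u,A)=\int\int_{y<z}\big[\int_{x\in A\cap[0,y]}(u(x,z)-u(x,y))dx\big]_+dy\,dz+\int\int_{y<z}\big[\int_{x\in A\cap[z,1]}(u(x,y)-u(x,z))dx\big]_+dy\,dz$ with $[t]_+=\max\{t,0\}$, and $\Gamma(u)=\sup_A\Gamma(u,A)$. For a graph $G$, $\widetilde{\Gamma}(G)=\min\{\Gamma(w_H):H\text{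 a labeled graph isomorphic to }G\}$. *)

(* Defs.v *)
From HB Require Import structures.
From mathcomp Require Import all_boot all_order all_algebra.
From mathcomp Require Import all_classical all_reals all_analysis.
Set Implicit Arguments.
Unset Strict Implicit.
Unset Printing Implicit Defensive.
Import Order.TTheory GRing.Theory Num.Theory.
Import numFieldNormedType.Exports.
Local Open Scope classical_set_scope.
Local Open Scope ring_scope.

(* Functions of two variables on [0,1] are represented by total functions
   R -> R -> R whose values outside [0,1]^2 are irrelevant. Measurability refers
   to the Borel sigma-algebra. *)

Section Graphons.
Variable R : realType.
Local Notation RT := (measurableTypeR R).
Local Notation mu := (@lebesgue_measure R).
Local Notation mu2 := (@lebesgue_measure R \x @lebesgue_measure R)%E.

Definition I01 : set R := `[0, 1].

Definition graphon (w : R -> R -> R) : Prop :=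
  [/\ measurable_fun (I01 `*` I01 : set (RT * RT)) (fun p => w p.1 p.2),
      forall x y, I01 x -> I01 y -> w x y = w y x
    & forall x y, I01 x -> I01 y -> 0 <= w x y <= 1].

Definition Robinson (w : R -> R -> R) : Prop :=
  forall x y z, 0 <= x -> x <= y -> y <= z -> z <= 1 ->
    w x z <= Num.min (w x y) (w y z).

Definition cut_norm (u : R -> R -> R) : R :=
  sup [set r | exists S T : set RT,
    [/\ measurable S, measurable T, S `<=` I01, T `<=` I01
      & r = `| \int[mu2]_(p in S `*` T) u p.1 p.2 | ]].

(* The inverse of a Borel bijection is automatically Borel. *)
Definition mp_bijection (phi : R -> R) : Prop :=
  [/\ set_bij I01 I01 phi,
      measurable_fun (I01 : set RT) (phi : RT -> RT)
    & forall A : set RT, measurable A -> A `<=` I01 ->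
        mu (I01 `&` phi @^-1` A) = mu A].

Definition cut_dist (u w : R -> R -> R) : R :=
  inf [set cut_norm (fun x y => u (phi x) (phi y) - w x y)
      | phi in mp_bijection].

Definition Robinsonian (w : R -> R -> R) : Prop :=
  exists u : R -> R -> R, [/\ graphon u, Robinson u & cut_dist u w = 0].

Definition Gamma_at (u : R -> R -> R) (A : set R) : R :=
  \int[mu2]_(p in [set p : RT * RT | [/\ 0 <= p.1, p.1 < p.2 & p.2 <= 1]])
     Num.max (\int[mu]_(x in A `&` `[0, p.1]) (u x p.2 - u x p.1)) 0
  + \int[mu2]_(p in [set p : RT * RT | [/\ 0 <= p.1, p.1 < p.2 & p.2 <= 1]])
     Num.max (\int[mu]_(x in A `&` `[p.2, 1]) (u x p.1 - u x p.2)) 0.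

Definition Gamma (u : R -> R -> R) : R :=
  sup [set Gamma_at u A | A in [set A : set RT | measurable A /\ A `<=` I01]].

End Graphons.

Record sgraph := SGraph {
  vertex :> finType;
  adj : rel vertex;
  adj_sym : symmetric adj;
  adj_irr : irreflexive adj }.

(* Labeled graphs on n vertices are given by their adjacency matrices;
   [labeling H G] says that H is a labeled graph isomorphic to G. *)
Definition labeling (G : sgraph) (H : 'M[bool]_#|G|) : bool :=
  [exists s : {ffun 'I_#|G| -> G},
     injectiveb s && [forall i, forall j, H i j == adj (s i) (s j)]].

Definition std_adj (G : sgraph) : 'M[bool]_#|G| :=
  \matrix_(i, j) adj (enum_val i) (enum_val j).

Lemma std_adj_labeling (G : sgraph) : labeling (std_adj G).
Proof.
apply/existsP; exists [ffun i => enum_val i]; apply/andP; split.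
  by apply/injectiveP => i j; rewrite !ffunE; apply: enum_val_inj.
by apply/forallP => i; apply/forallP => j; rewrite mxE !ffunE.
Qed.

Section GraphGraphons.
Variable R : realType.

(* The i-th interval is [i/n, (i+1)/n[ for i + 1 < n, and [(n-1)/n, 1] for the
   last one. *)
Definition block (n : nat) (i : 'I_n) : set R :=
  [set` Interval (BLeft (i%:R / n%:R)) (BSide (i.+1 < n)%N (i.+1%:R / n%:R))].

Definition graphon_of_mx (n : nat) (H : 'M[bool]_n) (x y : R) : R :=
  \sum_(i < n) \sum_(j < n) (H i j)%:R * \1_(block i) x * \1_(block j) y.

Definition graphon_of (G : sgraph) : R -> R -> R := graphon_of_mx (std_adj G).

Definition Gamma_tilde (G : sgraph) : R :=
  Gamma (graphon_of_mx
    [arg min_(H < std_adj G | labeling H) Gamma (graphon_of_mx H)]%O).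

Lemma Gamma_tilde_le (G : sgraph) (H : 'M[bool]_#|G|) :
  labeling H -> Gamma_tilde G <= Gamma (graphon_of_mx H).
Proof.
rewrite /Gamma_tilde; case: arg_minP; first exact: std_adj_labeling.
by move=> H0 _ le_H0 /le_H0.
Qed.

Lemma Gamma_tilde_attained (G : sgraph) :
  exists2 H : 'M[bool]_#|G|, labeling H & Gamma_tilde G = Gamma (graphon_of_mx H).
Proof.
rewrite /Gamma_tilde; case: arg_minP; first exact: std_adj_labeling.
by move=> H0 lH0 _; exists H0.
Qed.

End GraphGraphons.

Arguments graphon_of R G x y : clear implicits.
Arguments Gamma_tilde R G : clear implicits.

(* Main.v *)
Require Import Defs.
From HB Require Import structures.
From mathcomp Require Import all_boot all_order all_algebra.
From mathcomp Require Import all_classical all_reals all_analysis.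
From mathcomp Require Import measurable_realfun.
From mathcomp Require Import ring lra zify.
Import Order.TTheory GRing.Theory Num.Theory.
Import numFieldNormedType.Exports.
Local Open Scope classical_set_scope.
Local Open Scope ring_scope.

(* Robinson graphons have Gamma = 0, and Gamma is continuous for the cut norm.

If w is Robinsonian with Robinson model u, then G_n, overlaid with u by measure
preserving maps, is close to u in the cut norm.  Cut [0,1] into k intervals; a
vertex meets interval a in some measure lambda, and sending every vertex
independently to an interval with probability proportional to lambda (small
lambda discarded) keeps the graph within a factor k^2 of the overlay error from a
step function of u, since each vertex keeps a fraction 1/(2(k+1)) of its mass.
Sorting the vertices by their interval turns this step function into a Robinson
graphon, hence gives a labeling with small Gamma.

Conversely, let W_n = w_{H_n} with Gamma(W_n) -> 0.  For A < B < C the definition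
of Gamma gives |B| W(A,C) <= |C| W(A,B) + Gamma(W) and
|B| W(A,C) <= |A| W(B,C) + Gamma(W), where W(A,B) is the integral over A x B.
Hence W(S,T) lies, cell by cell on the k-grid, between the step functions obtained
by shifting the cell averages of W one cell away from, or towards, the diagonal,
up to an error 2k Gamma(W); these two step functions are O(1/k) apart in L^1.  The
cell averages converge along an ultrafilter, their limits are monotone, and the
infimum over k of the upper step functions is a Robinson graphon u to which W_n
converges in the cut norm along the ultrafilter. *)

Set Implicit Arguments.
Unset Strict Implicit.
Unset Printing Implicit Defensive.

(** * Bounded measurable functions and Fubini on the unit square *)

Section BoundedMeasurable.
Context {R : realType} d (T : measurableType d).
Implicit Types (f g : T -> R) (D : set T).

(** No measure preserving bijection is ever inverted. The graph and u are both pulled back to the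
    coordinates of w; in the converse, u is carried to w through w_{H_n} and w_{G_n}. A cut norm
    bound passes through such a map by means of [0,1]-valued test functions instead of image sets.

    A graph and u can only be overlaid fractionally, one vertex being spread over many intervals,
    whereas a labeling puts each vertex in one place; random rounding closes this gap.

    The inner domains of integration in Gamma move with (y, z), so a cut norm bound does not apply
    to them directly: they are approximated from a finite net, whose fineness has to be fixed before
    k, the number of vertices and the closeness.

    The ultrafilter makes all the countably many cell averages converge at once, and for each error
    a single index n is enough. An infimum of upper step functions is Robinson at every point, with
    nothing to repair on null sets. It is not too small, because each lower step function lies below
    every upper one, even on an unrelated grid: this is what the shift by one cell buys. *)

Definition bmf f := measurable_fun setT f /\ exists M, forall x, `|f x| <= M.

Lemma bmf_cst c : bmf (cst c).
Proof. by split; [exact: measurable_cst|exists `|c| => x]. Qed.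

Lemma bmfD f g : bmf f -> bmf g -> bmf (fun x => f x + g x).
Proof.
move=> [mf [M fM]] [mg [N gN]]; split; first exact: measurable_funD.
by exists (M + N) => x; apply: le_trans (ler_normD _ _) _; exact: lerD.
Qed.

Lemma bmfM f g : bmf f -> bmf g -> bmf (fun x => f x * g x).
Proof.
move=> [mf [M fM]] [mg [N gN]]; split; first exact: measurable_funM.
by exists (M * N) => x; rewrite normrM; exact: ler_pM.
Qed.

Lemma bmfN f : bmf f -> bmf (fun x => - f x).
Proof.
move=> [mf [M fM]]; split; first exact: measurableT_comp.
by exists M => x; rewrite normrN.
Qed.

Lemma bmfB f g : bmf f -> bmf g -> bmf (fun x => f x - g x).
Proof. by move=> bf bg; apply: bmfD => //; exact: bmfN. Qed.

Lemma bmf_norm f : bmf f -> bmf (fun x => `|f x|).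
Proof.
move=> [mf [M fM]]; split; first exact: measurableT_comp.
by exists M => x; rewrite normr_id.
Qed.

Lemma bmf_max0 f : bmf f -> bmf (fun x => Num.max (f x) 0).
Proof.
move=> [mf [M fM]]; split; first exact: measurable_maxr.
exists M => x; apply: le_trans (fM x); case: (leP (f x) 0) => //.
by rewrite normr0.
Qed.

Lemma bmf_indic D : measurable D -> bmf (\1_D : T -> R).
Proof.
move=> mD; split; first exact: measurable_indic.
by exists 1 => x; rewrite indicE; case: (x \in D); rewrite ?normr1 ?normr0.
Qed.

Lemma bmf_sum (I : Type) (s : seq I) (P : pred I) (h : I -> T -> R) :
  (forall i, bmf (h i)) -> bmf (fun x => \sum_(i <- s | P i) h i x).
Proof.
move=> bh; elim: s => [|i s IH].
  rewrite (_ : (fun _ => _) = cst 0); first exact: bmf_cst.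
  by apply/funext => x; rewrite big_nil.
rewrite (_ : (fun _ => _) = fun x => (if P i then h i x else 0) +
  \sum_(j <- s | P j) h j x); last first.
  by apply/funext => x; rewrite big_cons; case: (P i); rewrite ?add0r.
by apply: bmfD => //; case: (P i) => //; exact: bmf_cst.
Qed.

Lemma bmf_patch D (f : T -> R) M : measurable D -> measurable_fun D f ->
  (forall x, D x -> `|f x| <= M) -> bmf (f \_ D).
Proof.
move=> mD mf fM; split; first exact/(measurable_restrictT _ _).1.
exists `|M| => x; rewrite patchE; case: ifPn; last by rewrite normr0.
by rewrite inE => /fM /le_trans; apply; exact: ler_norm.
Qed.

End BoundedMeasurable.

Lemma bmf_comp {R : realType} d1 d2 (T1 : measurableType d1)
  (T2 : measurableType d2) (f : T2 -> R) (h : T1 -> T2) :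
  measurable_fun setT h -> bmf f -> bmf (f \o h).
Proof.
move=> mh [mf [M fM]]; split; first exact: measurableT_comp.
by exists M => x; exact: fM.
Qed.

(** * Integration of bounded functions over sets of finite measure *)

Section RintegralFinite.
Context {R : realType} d (T : measurableType d).
Variables (m : {measure set T -> \bar R}) (D : set T).
Hypotheses (mD : measurable D) (fD : (m D < +oo)%E).
Implicit Types f g : T -> R.

(** On a set of finite measure boundedness gives integrability, and [bmf] is closed under the
    algebraic operations; so every integrability side condition reduces to a syntactic check. *)
Lemma bmf_integrable f : bmf f -> m.-integrable D (EFin \o f).
Proof.
move=> [mf [M fM]]; apply: measurable_bounded_integrable => //.
  exact: measurable_funTS.
exists `|M|; split; first exact: num_real.
by move=> x Mx y _ /=; apply: le_trans (fM y) (le_trans (ler_norm _) (ltW Mx)).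
Qed.

Lemma Rint_le f g : bmf f -> bmf g -> (forall x, D x -> f x <= g x) ->
  \int[m]_(x in D) f x <= \int[m]_(x in D) g x.
Proof. by move=> bf bg fg; apply: le_Rintegral => //; exact: bmf_integrable. Qed.

Lemma RintD f g : bmf f -> bmf g ->
  \int[m]_(x in D) (f x + g x) = \int[m]_(x in D) f x + \int[m]_(x in D) g x.
Proof. by move=> bf bg; apply: RintegralD => //; exact: bmf_integrable. Qed.

Lemma RintB f g : bmf f -> bmf g ->
  \int[m]_(x in D) (f x - g x) = \int[m]_(x in D) f x - \int[m]_(x in D) g x.
Proof. by move=> bf bg; apply: RintegralB => //; exact: bmf_integrable. Qed.

Lemma RintZl f c : bmf f ->
  \int[m]_(x in D) (c * f x) = c * \int[m]_(x in D) f x.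
Proof. by move=> bf; apply: RintegralZl => //; exact: bmf_integrable. Qed.

Lemma RintZr f c : bmf f ->
  \int[m]_(x in D) (f x * c) = (\int[m]_(x in D) f x) * c.
Proof. by move=> bf; apply: RintegralZr => //; exact: bmf_integrable. Qed.

Lemma Rint_norm f : bmf f ->
  `|\int[m]_(x in D) f x| <= \int[m]_(x in D) `|f x|.
Proof. by move=> bf; apply: le_normr_Rintegral => //; exact: bmf_integrable. Qed.

Lemma Rint_sum (I : Type) (s : seq I) (P : pred I) (h : I -> T -> R) :
  (forall i, bmf (h i)) ->
  \int[m]_(x in D) (\sum_(i <- s | P i) h i x) =
  \sum_(i <- s | P i) \int[m]_(x in D) h i x.
Proof.
move=> bh; elim: s => [|i s IH].
  rewrite big_nil; under eq_Rintegral do rewrite big_nil.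
  by rewrite Rintegral_cst// mul0r.
rewrite big_cons; under eq_Rintegral do rewrite big_cons.
by case: ifPn => // _; rewrite RintD ?IH//; exact: bmf_sum.
Qed.

Lemma Rint_indic A : measurable A -> A `<=` D ->
  \int[m]_(x in D) \1_A x = fine (m A).
Proof.
move=> mA AD; rewrite /Rintegral integral_indic//.
by congr (fine (m _)); exact/setIidPl.
Qed.

Lemma Rint_restr f E : E `<=` D ->
  \int[m]_(x in E) f x = \int[m]_(x in D) (f x * \1_E x).
Proof.
move=> ED; rewrite -{1}(setIidr ED) Rintegral_mkcondr.
apply: eq_Rintegral => x _; rewrite patchE indicE.
by case: ifPn; rewrite ?mulr1 ?mulr0.
Qed.

Lemma Rint_bound f c : bmf f -> (forall x, D x -> `|f x| <= c) ->
  `|\int[m]_(x in D) f x| <= c * fine (m D).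
Proof.
move=> bf fc; apply: le_trans (Rint_norm bf) _.
rewrite -Rintegral_cst//; apply: Rint_le => //; first exact: bmf_norm.
exact: (@bmf_cst R _ T c).
Qed.

End RintegralFinite.

(** * Integrals over [0,1] and the unit square *)

Section UnitInterval.
Variable R : realType.
Local Notation RT := (measurableTypeR R).
Local Notation mu := (@lebesgue_measure R).
Local Notation mu2 := (@lebesgue_measure R \x @lebesgue_measure R)%E.
Local Notation I01 := (@I01 R).
Local Notation Q := (I01 `*` I01).

Lemma mI01 : measurable (I01 : set RT).
Proof. exact: measurable_itv. Qed.

Lemma muI01 : mu I01 = 1%:E.
Proof. by rewrite lebesgue_measure_itv/= lte_fin ltr01 sube0. Qed.

Lemma muI01_fin : (mu I01 < +oo)%E.
Proof. by rewrite muI01 ltry. Qed.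

Lemma mQ : measurable (Q : set (RT * RT)).
Proof. by apply: measurableX; exact: mI01. Qed.

Lemma muQ : mu2 Q = 1%:E.
Proof.
transitivity (mu I01 * mu I01)%E; last by rewrite muI01 mule1.
exact: (@product_measure1E _ _ RT RT R mu mu _ _ mI01 mI01).
Qed.

Lemma muQ_fin : (mu2 Q < +oo)%E.
Proof. by rewrite muQ ltry. Qed.

Definition Iunit (f : RT -> R) : R := \int[mu]_(x in I01) f x.
Definition Isquare (F : RT * RT -> R) : R := \int[mu2]_(p in Q) F p.
Local Notation I1 := Iunit.
Local Notation I2 := Isquare.

Lemma I1_cst c : I1 (cst c) = c.
Proof.
rewrite /I1 (Rintegral_cst _ mI01).
by rewrite (_ : fine _ = 1) ?mulr1//; exact: (congr1 fine muI01).
Qed.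

(** Tonelli gives measurability of parametric integrals of nonnegative functions. Adding the bound
    [M] reaches that case and, since [0,1] has measure 1, shifts the integral by exactly [M]. *)
Lemma I1_param d (T : measurableType d) (F : T * RT -> R) :
  bmf F -> bmf (fun p : T => I1 (fun x => F (p, x))).
Proof.
move=> bF; have [mF [M FM]] := bF.
have bFp p : bmf (fun x : RT => F (p, x)).
  by split; [exact: measurableT_comp mF (pair1_measurable p)|exists M].
split; last first.
  exists M => p; rewrite -[leRHS]mulr1 -[1]/(fine 1%:E) -muI01.
  by apply: Rint_bound => //; [exact: mI01|exact: muI01_fin].
pose F' (q : T * RT) : \bar R := ((F q + M) * \1_I01 q.2)%:E.
have M0 x : 0 <= F x + M.
  by have := FM x; rewrite ler_norml => /andP[]; rewrite -subr_ge0 opprK.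
have mF' : measurable_fun setT F'.
  apply/measurable_EFinP/measurable_funM; first exact: measurable_funD.
  exact: measurableT_comp (measurable_indic mI01) measurable_snd.
have F'0 x : (0 <= F' x)%E.
  by rewrite lee_fin mulr_ge0.
have := @measurable_fun_fubini_tonelli_F _ _ T RT R mu F' mF' F'0.
move=> mf; rewrite (_ : (fun p => _) =
    (fun p => fine (fubini_F mu F' p) - M)); last first.
  apply/funext => p; rewrite /fubini_F /F'/=.
  apply/eqP; rewrite -subr_eq opprK eq_sym; apply/eqP.
  transitivity (I1 (fun x => F (p, x) + M)).
    rewrite /I1 Rintegral_mkcond; congr fine.
    apply: eq_integral => x _; rewrite /= patchE indicE.
    by case: ifPn => _; rewrite ?mulr1 ?mulr0.
  rewrite /I1 RintD//; [|exact: mI01|exact: muI01_fin|exact: bmf_cst].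
  by congr (_ + _); exact: I1_cst.
apply: measurable_funD => //.
by apply: measurableT_comp => //; exact: measurable_fine.
Qed.

Lemma bmf_swap (F : RT * RT -> R) : bmf F -> bmf (fun p => F (p.2, p.1)).
Proof.
move=> bF; apply: (@bmf_comp R _ _ _ _ F (fun p : RT * RT => (p.2, p.1))) => //.
exact: measurable_fun_pair.
Qed.

Lemma bmf_sec (F : RT * RT -> R) x : bmf F -> bmf (fun y : RT => F (x, y)).
Proof.
by move=> [mF [M FM]]; split; [exact: measurableT_comp mF (pair1_measurable x)|exists M].
Qed.

(** Fubini is applied on the whole plane. The extension by zero is a product of two indicators, so
    that the cutoff in each variable can be removed separately. *)
Let restrQ (F : RT * RT -> R) : bmf F ->
  mu2.-integrable setT (fun p => (F p * (\1_I01 p.1 * \1_I01 p.2))%:E).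
Proof.
move=> bF.
have := @bmf_integrable R _ _ _ _ mQ muQ_fin F bF.
move/(integrable_mkcond _ mQ); congr (integrable _ _ _).
apply/funext => -[x y]/=; rewrite patchE !indicE.
rewrite in_setX/=.
by case: (x \in I01); case: (y \in I01); rewrite ?mulr1 ?mul1r ?mulr0 ?mul0r.
Qed.

Let I2E (F : RT * RT -> R) :
  I2 F = fine (\int[mu2]_p (F p * (\1_I01 p.1 * \1_I01 p.2))%:E).
Proof.
rewrite /I2 Rintegral_mkcond; congr fine; apply: eq_integral => -[x y] _/=.
rewrite patchE !indicE in_setX/=.
by case: (x \in I01); case: (y \in I01); rewrite ?mulr1 ?mul1r ?mulr0 ?mul0r.
Qed.

Lemma I2_fubini1 F : bmf F -> I2 F = I1 (fun x => I1 (fun y => F (x, y))).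
Proof.
move=> bF; rewrite I2E -(integral12_prod_meas1 (restrQ bF)).
rewrite /I1 [RHS]Rintegral_mkcond; congr fine; apply: eq_integral => x _ /=.
rewrite /fubini_F/= patchE indicE; case: (x \in I01); last first.
  by rewrite integral0_eq// => y _; rewrite mul0r mulr0.
rewrite Rintegral_mkcond.
have E : (fun y => (F (x, y) * (1%:R * \1_I01 y))%:E) =
    EFin \o ((fun y : RT => F (x, y)) \_ I01).
  by apply/funext => y/=; rewrite patchE indicE; case: (y \in I01);
    rewrite ?mulr1 ?mulr0.
rewrite E fineK//; apply: integrable_fin_num => //.
have := @bmf_integrable R _ _ _ _ mI01 muI01_fin _ (bmf_sec x bF).
by move/(integrable_mkcond _ mI01); rewrite restrict_EFin.
Qed.

Lemma I2_fubini2 F : bmf F -> I2 F = I1 (fun y => I1 (fun x => F (x, y))).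
Proof.
move=> bF; rewrite I2E -(integral21_prod_meas1 (restrQ bF)).
rewrite /I1 [RHS]Rintegral_mkcond; congr fine; apply: eq_integral => y _ /=.
rewrite /fubini_G/= patchE [\1_I01 y]indicE; case: (y \in I01); last first.
  by rewrite integral0_eq// => x _; rewrite !mulr0.
rewrite Rintegral_mkcond.
have E : (fun x => (F (x, y) * (\1_I01 x * 1%:R))%:E) =
    EFin \o ((fun x : RT => F (x, y)) \_ I01).
  by apply/funext => x/=; rewrite patchE indicE; case: (x \in I01);
    rewrite ?mulr1 ?mulr0.
rewrite E fineK//; apply: integrable_fin_num => //.
have := @bmf_integrable R _ _ _ _ mI01 muI01_fin _ (bmf_sec y (bmf_swap bF)).
by move/(integrable_mkcond _ mI01); rewrite restrict_EFin.
Qed.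

End UnitInterval.

(** * The cut norm against test functions *)

Section Kernels.
Variable R : realType.
Local Notation RT := (measurableTypeR R).
Local Notation mu := (@lebesgue_measure R).
Local Notation mu2 := (@lebesgue_measure R \x @lebesgue_measure R)%E.
Local Notation I01 := (@I01 R).
Local Notation Q := (I01 `*` I01).
Local Notation I1 := (@Iunit R).
Local Notation I2 := (@Isquare R).
Implicit Types (u v w : R -> R -> R) (S T : set RT).

Lemma I1_le (f g : RT -> R) : bmf f -> bmf g ->
  (forall x, I01 x -> f x <= g x) -> I1 f <= I1 g.
Proof. exact: (@Rint_le R _ RT mu I01 (@mI01 R) (@muI01_fin R)). Qed.

Lemma I1_eq (f g : RT -> R) : (forall x, I01 x -> f x = g x) -> I1 f = I1 g.
Proof. by move=> fg; apply: eq_Rintegral => x; rewrite inE => /fg. Qed.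

Lemma I1Zl (f : RT -> R) c : bmf f -> I1 (fun x => c * f x) = c * I1 f.
Proof. by move=> bf; exact: (@RintZl R _ RT mu I01 (@mI01 R) (@muI01_fin R)). Qed.

Lemma I1Zr (f : RT -> R) c : bmf f -> I1 (fun x => f x * c) = I1 f * c.
Proof. by move=> bf; exact: (@RintZr R _ RT mu I01 (@mI01 R) (@muI01_fin R)). Qed.

Lemma I2_le (f g : RT * RT -> R) : bmf f -> bmf g ->
  (forall p, Q p -> f p <= g p) -> I2 f <= I2 g.
Proof. exact: (@Rint_le R _ (RT * RT)%type mu2 Q (@mQ R) (@muQ_fin R)). Qed.

Lemma I2_eq (f g : RT * RT -> R) : (forall p, Q p -> f p = g p) -> I2 f = I2 g.
Proof. by move=> fg; apply: eq_Rintegral => x; rewrite inE => /fg. Qed.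

Lemma I2D (f g : RT * RT -> R) : bmf f -> bmf g ->
  I2 (fun p => f p + g p) = I2 f + I2 g.
Proof. by move=> bf bg; exact: (@RintD R _ (RT * RT)%type mu2 Q (@mQ R) (@muQ_fin R)). Qed.

Lemma I2B (f g : RT * RT -> R) : bmf f -> bmf g ->
  I2 (fun p => f p - g p) = I2 f - I2 g.
Proof. by move=> bf bg; exact: (@RintB R _ (RT * RT)%type mu2 Q (@mQ R) (@muQ_fin R)). Qed.

Lemma I2Zl (f : RT * RT -> R) c : bmf f -> I2 (fun p => c * f p) = c * I2 f.
Proof. by move=> bf; exact: (@RintZl R _ (RT * RT)%type mu2 Q (@mQ R) (@muQ_fin R)). Qed.

Lemma I2_sum (I : Type) (s : seq I) (P : pred I) (h : I -> RT * RT -> R) :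
  (forall i, bmf (h i)) ->
  I2 (fun p => \sum_(i <- s | P i) h i p) = \sum_(i <- s | P i) I2 (h i).
Proof. by move=> bh; exact: (@Rint_sum R _ (RT * RT)%type mu2 Q (@mQ R) (@muQ_fin R)). Qed.

Lemma bmf_fst (f : RT -> R) : bmf f -> bmf (fun p : RT * RT => f p.1).
Proof. exact: (bmf_comp (@measurable_fst _ _ RT RT)). Qed.

Lemma bmf_snd (f : RT -> R) : bmf f -> bmf (fun p : RT * RT => f p.2).
Proof. exact: (bmf_comp (@measurable_snd _ _ RT RT)). Qed.

Lemma I2_prod (f g : RT -> R) : bmf f -> bmf g ->
  I2 (fun p => f p.1 * g p.2) = I1 f * I1 g.
Proof.
move=> bf bg; rewrite I2_fubini1; last first.
  by apply: bmfM; [exact: bmf_fst|exact: bmf_snd].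
rewrite -(I1Zr _ bf); apply: I1_eq => x _ /=.
by rewrite I1Zl.
Qed.

Definition len S : R := fine (mu S).

Lemma mu_fin_num S : measurable S -> S `<=` I01 -> mu S \is a fin_num.
Proof.
move=> mS SI; rewrite ge0_fin_numE//.
apply: (@le_lt_trans _ _ (mu I01)); last by rewrite muI01 ltry.
by apply: le_measure => //; rewrite inE//; exact: mI01.
Qed.

Lemma I1_indic S : measurable S -> S `<=` I01 -> I1 \1_S = len S.
Proof. by move=> mS SI; rewrite /Iunit Rint_indic//; exact: mI01. Qed.

Lemma len_ge0 S : 0 <= len S.
Proof. exact: fine_ge0. Qed.

Lemma len_le S T : measurable S -> measurable T -> S `<=` T -> T `<=` I01 ->
  len S <= len T.
Proof.
move=> mS mT ST TI; apply: fine_le; rewrite ?mu_fin_num//.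
  exact: subset_trans TI.
by apply: le_measure => //; rewrite inE.
Qed.

Lemma len_I01 : len I01 = 1.
Proof. by rewrite /len muI01. Qed.

Lemma len_le1 S : measurable S -> S `<=` I01 -> len S <= 1.
Proof. by move=> mS SI; rewrite -len_I01; apply: len_le => //; exact: mI01. Qed.

(** Values in [-1,1], so that both graphons and differences of two graphons qualify. *)
Definition kern u := measurable_fun (Q : set (RT * RT)) (fun p => u p.1 p.2) /\
  forall x y, I01 x -> I01 y -> `|u x y| <= 1.

(** Values outside the square are arbitrary; setting them to 0 gives a bounded measurable function
    on the whole plane. *)
Definition ext u : RT * RT -> R := (fun p => u p.1 p.2) \_ Q.

Lemma extE u x y : I01 x -> I01 y -> ext u (x, y) = u x y.
Proof. by move=> Ix Iy; rewrite /ext patchE mem_set. Qed.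

Lemma bmf_ext u : kern u -> bmf (ext u).
Proof.
move=> [mu1 u1]; apply: (@bmf_patch _ _ _ _ _ 1) => //; first exact: mQ.
by move=> -[x y] [/= ? ?]; exact: u1.
Qed.

Lemma ext_le1 u p : kern u -> `|ext u p| <= 1.
Proof.
move=> [_ u1]; rewrite /ext patchE; case: ifPn; last by rewrite normr0.
by rewrite inE => -[? ?]; exact: u1.
Qed.

Lemma graphon_kern w : graphon w -> kern w.
Proof.
move=> [mw _ w01]; split=> // x y Ix Iy.
by have /andP[? ?] := w01 x y Ix Iy; rewrite ger0_norm.
Qed.

Lemma graphonB_kern u w : graphon u -> graphon w ->
  kern (fun x y => u x y - w x y).
Proof.
move=> [mu1 _ u01] [mw _ w01]; split; first exact: measurable_funB.
move=> x y Ix Iy; have := u01 x y Ix Iy; have := w01 x y Ix Iy.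
by rewrite ler_norml; lra.
Qed.

Definition box u S T : R := \int[mu2]_(p in S `*` T) u p.1 p.2.

Lemma boxE u S T : S `<=` I01 -> T `<=` I01 ->
  box u S T = I2 (fun p => ext u p * (\1_S p.1 * \1_T p.2)).
Proof.
move=> SI TI; rewrite /box (@Rint_restr _ _ _ mu2 Q).
  apply: I2_eq => -[x y] /= [/= Ix Iy]; rewrite extE//.
  congr (_ * _); rewrite !indicE in_setX /=.
  by case: (x \in S); case: (y \in T); rewrite ?mulr1 ?mulr0 ?mul0r.
by move=> [x y] [/= ? ?]; split; [exact: SI|exact: TI].
Qed.

Lemma bmf_rect S T : measurable S -> measurable T ->
  bmf (fun p : RT * RT => \1_S p.1 * \1_T p.2 : R).
Proof.
by move=> mS mT; apply: bmfM; [apply: bmf_fst|apply: bmf_snd]; exact: bmf_indic.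
Qed.

Lemma I2_rect S T : measurable S -> measurable T -> S `<=` I01 -> T `<=` I01 ->
  I2 (fun p => \1_S p.1 * \1_T p.2) = len S * len T.
Proof.
by move=> mS mT SI TI; rewrite I2_prod ?I1_indic//; exact: bmf_indic.
Qed.

Lemma box_between u S T l h : kern u -> measurable S -> measurable T ->
  S `<=` I01 -> T `<=` I01 ->
  (forall x y, S x -> T y -> l <= u x y <= h) ->
  l * (len S * len T) <= box u S T <= h * (len S * len T).
Proof.
move=> ku mS mT SI TI lh; rewrite boxE// -!(I2_rect mS mT SI TI).
have bST := bmf_rect mS mT.
have bc c : bmf (fun p : RT * RT => c * (\1_S p.1 * \1_T p.2) : R).
  by apply: bmfM => //; exact: bmf_cst.
rewrite -!I2Zl//.
have P x y : I01 x -> I01 y -> l * (\1_S x * \1_T y) <=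
    ext u (x, y) * (\1_S x * \1_T y) <= h * (\1_S x * \1_T y).
  move=> Ix Iy; rewrite extE// !indicE.
  have [xS|_] := boolP (x \in S); last by rewrite !mul0r !mulr0 lexx.
  have [yT|_] := boolP (y \in T); last by rewrite !mulr0 lexx.
  by rewrite !mulr1; apply: lh; exact: set_mem.
apply/andP; split; apply: I2_le => //.
- by apply: bmfM => //; exact: bmf_ext.
- by move=> -[x y] [/= Ix Iy]; have /andP[] := P x y Ix Iy.
- by apply: bmfM => //; exact: bmf_ext.
- by move=> -[x y] [/= Ix Iy]; have /andP[] := P x y Ix Iy.
Qed.

Lemma box_norm u S T : kern u -> measurable S -> measurable T ->
  S `<=` I01 -> T `<=` I01 -> `|box u S T| <= len S * len T.
Proof.
move=> ku mS mT SI TI; rewrite ler_norml.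
have := @box_between u S T (-1) 1 ku mS mT SI TI.
rewrite mulN1r mul1r; apply => x y Sx Ty; rewrite -ler_norml.
by apply: ku.2; [exact: SI|exact: TI].
Qed.

Lemma boxB u v S T : kern u -> kern v -> measurable S -> measurable T ->
  S `<=` I01 -> T `<=` I01 ->
  box (fun x y => u x y - v x y) S T = box u S T - box v S T.
Proof.
move=> ku kv mS mT SI TI; rewrite !boxE// -I2B; first last.
- by apply: bmfM; [exact: bmf_ext|exact: bmf_rect].
- by apply: bmfM; [exact: bmf_ext|exact: bmf_rect].
by apply: I2_eq => -[x y] [/= Ix Iy]; rewrite !extE// mulrBl.
Qed.

Lemma box_sym w S T : graphon w -> measurable S -> measurable T ->
  S `<=` I01 -> T `<=` I01 -> box w S T = box w T S.
Proof.
move=> gw mS mT SI TI; have kw := graphon_kern gw; rewrite !boxE//.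
have b S' T' : measurable S' -> measurable T' -> 
    bmf (fun p => ext w p * (\1_S' p.1 * \1_T' p.2)).
  by move=> ? ?; apply: bmfM; [exact: bmf_ext|exact: bmf_rect].
rewrite I2_fubini1; last exact: b.
rewrite I2_fubini2; last exact: b.
apply: I1_eq => x Ix; apply: I1_eq => y Iy /=; rewrite !extE//.
by case: gw => _ -> // _; rewrite [\1_S _ * _]mulrC.
Qed.

Lemma box_sum (I : finType) u S T (J : I -> set RT) : kern u ->
  measurable S -> measurable T -> S `<=` I01 -> T `<=` I01 ->
  (forall i, measurable (J i)) ->
  (forall x, I01 x -> \sum_i \1_(J i) x = 1 :> R) ->
  box u S T = \sum_i \sum_j box u (S `&` J i) (T `&` J j).
Proof.
move=> ku mS mT SI TI mJ J1.
have mSJ A i : measurable A -> measurable (A `&` J i).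
  by move=> mA; exact: measurableI.
have bu := bmf_ext ku.
transitivity (I2 (fun p => \sum_i \sum_j
  ext u p * (\1_(S `&` J i) p.1 * \1_(T `&` J j) p.2))).
  rewrite boxE//; apply: I2_eq => -[x y] [/= Ix Iy].
  under eq_bigr do rewrite -mulr_sumr; rewrite -mulr_sumr; congr (_ * _).
  under eq_bigr do rewrite -mulr_sumr; rewrite -mulr_suml.
  have E A z : I01 z -> \sum_i \1_(A `&` J i) z = \1_A z :> R.
    move=> Iz; under eq_bigr do rewrite indicI/=.
    by rewrite -mulr_sumr J1// mulr1.
  by rewrite !E.
rewrite I2_sum; last first.
  by move=> i; apply: bmf_sum => j; apply: bmfM => //; apply: bmf_rect; exact: mSJ.
apply: eq_bigr => i _; rewrite I2_sum; last first.
  by move=> j; apply: bmfM => //; apply: bmf_rect; exact: mSJ.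
by apply: eq_bigr => j _; rewrite boxE//; exact: subset_trans (@subIsetl _ _ _) _.
Qed.

Lemma box_set0 u : box u set0 set0 = 0.
Proof. by rewrite /box set0X Rintegral_set0. Qed.

Lemma cut_norm_ub u S T : kern u -> measurable S -> measurable T ->
  S `<=` I01 -> T `<=` I01 -> `|box u S T| <= cut_norm u.
Proof.
move=> ku mS mT SI TI; apply: ub_le_sup; last by exists S, T.
exists 1 => _ [A [B [mA mB AI BI ->]]]; apply: le_trans (box_norm _ _ _ _ _) _ => //.
by rewrite mulr_ile1 ?len_ge0 ?len_le1.
Qed.

Lemma cut_norm_le u c :
  (forall S T, measurable S -> measurable T -> S `<=` I01 -> T `<=` I01 ->
   `|box u S T| <= c) -> cut_norm u <= c.
Proof.
move=> uc; apply: ge_sup.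
  by exists `|box u set0 set0|, set0, set0; split => //; exact: sub0set.
by move=> _ [A [B [mA mB AI BI ->]]]; exact: uc.
Qed.

Lemma cut_norm_ge0 u : kern u -> 0 <= cut_norm u.
Proof.
move=> ku; rewrite -(normr0 R) -(box_set0 u).
by apply: cut_norm_ub => //; exact: sub0set.
Qed.

(** Measure preservation in integral form, ready to be applied to the positive part of a test
    function; injectivity is not part of it. *)
Definition mpi (rho : RT -> RT) := measurable_fun setT rho /\
  forall h : RT -> R, bmf h -> I1 (fun x => h (rho x)) = I1 h.

Lemma mpi_id : mpi id.
Proof. by []. Qed.

(* The positive part of [k] bounds [k * f] and its integral is invariant under
   [rho], so the test function [f] may be traded for a set without inverting
   [rho]. *)
Lemma mpi_trade (rho : RT -> RT) (k f : RT -> R) : mpi rho -> bmf k -> bmf f ->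
  (forall x, 0 <= f x <= 1) ->
  I1 (fun x => k (rho x) * f x) <= I1 (fun x => k x * \1_(I01 `&` [set x | 0 < k x]) x).
Proof.
move=> [mrho rhoI] bk bf f01.
apply: (@le_trans _ _ (I1 (fun x => Num.max (k x) 0))); last first.
  rewrite le_eqVlt; apply/orP; left; apply/eqP; apply: I1_eq => x Ix.
  rewrite indicE in_setI mem_set//=.
  case: (ltP 0 (k x)) => kx; first by rewrite mem_set ?mulr1.
  by rewrite memNset ?mulr0//= ltNge kx.
rewrite -(rhoI _ (bmf_max0 bk)).
have bkr : bmf (fun x => k (rho x)) by exact: (bmf_comp mrho bk).
apply: I1_le; [exact: bmfM|exact: bmf_max0|] => x Ix.
have /andP[f0 f1] := f01 x; case: (leP (k (rho x)) 0) => kx.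
  by apply: mulr_le0_ge0.
by rewrite -[leRHS]mulr1 ler_wpM2l// ltW.
Qed.

Lemma measurable_pos (k : RT -> R) : bmf k ->
  measurable (I01 `&` [set x | 0 < k x] : set RT).
Proof.
move=> [mk _]; apply: measurableI; first exact: mI01.
rewrite -[X in measurable X]setTI -preimage_itvoy.
by apply: mk => //; exact: measurable_itv.
Qed.

(** One variable is traded at a time. Integrating out the second variable against [g] gives [k], and
    the pair [rho], [f] is replaced by the set [P] where [k] is positive. After exchanging the
    integrals, integrating the first variable over [P] gives [k'], and the pair [sg], [g] is
    replaced by [P']. *)
Lemma cut_trade_le u c (rho sg : RT -> RT) (f g : RT -> R) : kern u ->
  mpi rho -> mpi sg -> bmf f -> bmf g ->
  (forall x, 0 <= f x <= 1) -> (forall x, 0 <= g x <= 1) ->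
  (forall S T, measurable S -> measurable T -> S `<=` I01 -> T `<=` I01 ->
    I2 (fun p => ext u p * (\1_S p.1 * \1_T p.2)) <= c) ->
  I2 (fun p => ext u (rho p.1, sg p.2) * (f p.1 * g p.2)) <= c.
Proof.
move=> ku mrho msg bf bg f01 g01 uc; have bu := bmf_ext ku.
have bpair (a b : RT -> RT) : measurable_fun setT a -> measurable_fun setT b ->
    bmf (fun p : RT * RT => ext u (a p.1, b p.2)).
  move=> ma mb; apply: (@bmf_comp _ _ _ _ _ (ext u)
    (fun p : RT * RT => (a p.1, b p.2))) => //.
  by apply: measurable_fun_pair; apply: measurableT_comp.
have bF : bmf (fun p : RT * RT => ext u (p.1, sg p.2) * g p.2).
  by apply: bmfM; [exact: (bpair id sg (@measurable_id _ RT setT) msg.1)|exact: bmf_snd].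
pose k x := I1 (fun y => ext u (x, sg y) * g y).
have bk : bmf k by exact: (I1_param bF).
pose P := I01 `&` [set x | 0 < k x].
have mP : measurable P by exact: measurable_pos.
have bE : bmf (fun p : RT * RT => ext u p * \1_P p.1).
  by apply: bmfM => //; apply: bmf_fst; exact: bmf_indic.
pose k' y := I1 (fun x => ext u (x, y) * \1_P x).
have bk' : bmf k' by exact: (I1_param (bmf_swap bE)).
pose P' := I01 `&` [set x | 0 < k' x].
have mP' : measurable P' by exact: measurable_pos.
have b1 : bmf (fun p : RT * RT => ext u (rho p.1, sg p.2) * (f p.1 * g p.2)).
  apply: bmfM; first exact: (bpair _ _ mrho.1 msg.1).
  by apply: bmfM; [exact: bmf_fst|exact: bmf_snd].
have b2 : bmf (fun p : RT * RT => ext u (p.1, sg p.2) * g p.2 * \1_P p.1).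
  by apply: bmfM => //; apply: bmf_fst; exact: bmf_indic.
have b3 : bmf (fun p : RT * RT => ext u p * (\1_P p.1 * \1_P' p.2)).
  by apply: bmfM => //; exact: bmf_rect.
apply: le_trans (uc P P' mP mP' (@subIsetl _ _ _) (@subIsetl _ _ _)).
rewrite I2_fubini1//.
apply: (@le_trans _ _ (I1 (fun x => k x * \1_P x))).
  rewrite (_ : I1 _ = I1 (fun x => k (rho x) * f x)); first exact: mpi_trade.
  apply: I1_eq => x _; rewrite -I1Zr; first last.
    exact: (bmf_sec (rho x) bF).
  by apply: I1_eq => y _ /=; rewrite mulrA mulrAC.
rewrite (_ : I1 _ = I1 (fun y => k' (sg y) * g y)); last first.
  transitivity (I2 (fun p => ext u (p.1, sg p.2) * g p.2 * \1_P p.1)).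
    rewrite I2_fubini1//; apply: I1_eq => x _.
    by rewrite -I1Zr//; exact: (bmf_sec x bF).
  rewrite I2_fubini2//; apply: I1_eq => y _.
  rewrite -I1Zr; last exact: (bmf_sec (sg y) (bmf_swap bE)).
  by apply: I1_eq => x _ /=; rewrite mulrAC.
apply: le_trans (mpi_trade msg bk' bg g01) _.
rewrite I2_fubini2// le_eqVlt; apply/orP; left; apply/eqP; apply: I1_eq => y _.
rewrite -I1Zr; last exact: (bmf_sec y (bmf_swap bE)).
by apply: I1_eq => x _ /=; rewrite mulrA.
Qed.

Lemma kernN u : kern u -> kern (fun x y => - u x y).
Proof.
move=> [mu1 u1]; split; first exact: measurableT_comp.
by move=> x y Ix Iy; rewrite normrN u1.
Qed.

Lemma extN u p : ext (fun x y => - u x y) p = - ext u p.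
Proof. by rewrite /ext !patchE; case: ifPn; rewrite ?oppr0. Qed.

(** The lower bound is the upper bound for [- u]. With identity maps this extends a cut norm bound
    to weighted test functions; with indicators it transports the bound through pullbacks. *)
Lemma cut_trade u c (rho sg : RT -> RT) (f g : RT -> R) : kern u ->
  mpi rho -> mpi sg -> bmf f -> bmf g ->
  (forall x, 0 <= f x <= 1) -> (forall x, 0 <= g x <= 1) ->
  (forall S T, measurable S -> measurable T -> S `<=` I01 -> T `<=` I01 ->
    `|box u S T| <= c) ->
  `|I2 (fun p => ext u (rho p.1, sg p.2) * (f p.1 * g p.2))| <= c.
Proof.
move=> ku mrho msg bf bg f01 g01 uc; rewrite ler_norml lerNl; apply/andP; split.
  have bu := bmf_ext ku.
  rewrite -mulN1r -I2Zl; last first.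
    apply: bmfM; last by apply: bmfM; [exact: bmf_fst|exact: bmf_snd].
    apply: (@bmf_comp _ _ _ _ _ (ext u) (fun p : RT * RT => (rho p.1, sg p.2))) => //.
    apply: measurable_fun_pair; apply: measurableT_comp => //.
    - exact: mrho.1.
    - exact: msg.1.
  have := @cut_trade_le _ c rho sg f g (kernN ku) mrho msg bf bg f01 g01.
  rewrite (_ : I2 (fun p => ext (fun x y => - u x y) _ * _) =
    I2 (fun p => -1 * (ext u (rho p.1, sg p.2) * (f p.1 * g p.2)))); last first.
    by apply: I2_eq => p _; rewrite extN mulN1r mulNr.
  apply => S T mS mT SI TI; have := uc S T mS mT SI TI.
  rewrite ler_norml lerNl => /andP[+ _]; rewrite boxE// -mulN1r -I2Zl; last first.
    by apply: bmfM => //; exact: bmf_rect.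
  apply: le_trans; rewrite le_eqVlt; apply/orP; left; apply/eqP; apply: I2_eq => p _.
  by rewrite extN mulN1r mulNr.
apply: cut_trade_le => // S T mS mT SI TI; rewrite -boxE//.
by have := uc S T mS mT SI TI; rewrite ler_norml => /andP[].
Qed.

(* Extending by a point outside [0,1] keeps the preimage of [0,1] equal to
   [0,1]. *)
Definition pf (phi : R -> R) : RT -> RT := fun x => if x \in I01 then phi x else 2.

Lemma pfE phi x : I01 x -> pf phi x = phi x.
Proof. by move=> Ix; rewrite /pf mem_set. Qed.

Lemma measurable_pf phi : measurable_fun (I01 : set RT) (phi : RT -> RT) ->
  measurable_fun setT (pf phi).
Proof.
move=> mphi; rewrite (_ : pf phi = (phi \_ I01) \+ (fun x => 2 * \1_(~` I01) x)).
  apply: measurable_funD; first by apply: (measurable_restrictT _ (@mI01 R)).1.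
  apply: measurable_funM => //; apply: measurable_indic.
  by apply: measurableC; exact: mI01.
apply/funext => x; rewrite /pf /= /patch indicE in_setC/=.
by case: ifPn; rewrite ?mulr0 ?addr0 ?mulr1 ?add0r.
Qed.

Lemma mp_mpi phi : mp_bijection phi -> mpi (pf phi).
Proof.
move=> [bphi mphi phimu]; have mpf := measurable_pf mphi; split => // h bh.
have pre A : A `<=` I01 -> pf phi @^-1` A = I01 `&` phi @^-1` A.
  move=> AI; apply/seteqP; split => x /=.
    rewrite /pf; case: ifPn => [/set_mem Ix ?|_ /AI]; first by split.
    by rewrite /Defs.I01/= in_itv/= => /andP[_]; lra.
  by move=> [Ix Ax]; rewrite pfE.
have preI : pf phi @^-1` I01 = I01.
  rewrite pre//; apply/setIidPl => x Ix /=.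
  by case: bphi => phiI _ _; exact: phiI.
have := @integral_pushforward _ _ RT RT R _ mpf mu I01 (EFin \o h).
rewrite preI /Iunit /Rintegral => <- //; first last.
- exact: mI01.
- apply: (@bmf_integrable R _ RT mu I01 (@mI01 R) (@muI01_fin R)).
  exact: (bmf_comp mpf bh).
- by apply/measurable_EFinP; case: bh.
congr fine; apply: eq_measure_integral => A mA AI.
by transitivity (mu (pf phi @^-1` A)) => //; rewrite pre// phimu.
Qed.

End Kernels.

(** * The parameter Gamma *)

Section GammaParameter.
Variable R : realType.
Local Notation RT := (measurableTypeR R).
Local Notation mu := (@lebesgue_measure R).
Local Notation mu2 := (@lebesgue_measure R \x @lebesgue_measure R)%E.
Local Notation I01 := (@I01 R).
Local Notation Q := (I01 `*` I01).
Local Notation I1 := (@Iunit R).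
Local Notation I2 := (@Isquare R).
Implicit Types (u v w : R -> R -> R) (A S T : set RT).

Definition triangle : set (RT * RT) :=
  [set p : RT * RT | [/\ 0 <= p.1, p.1 < p.2 & p.2 <= 1]].

Lemma triangle_sub : triangle `<=` Q.
Proof.
move=> [y z] [/= y0 yz z1]; rewrite /Defs.I01 /= !in_itv /=.
by split; rewrite /= ?in_itv/=; lra.
Qed.

Lemma measurable_le_set d (T : measurableType d) (f g : T -> R) :
  measurable_fun setT f -> measurable_fun setT g ->
  measurable [set t | f t <= g t].
Proof.
move=> mf mg; have := measurable_fun_ler mf mg.
move=> /(_ measurableT [set true]); rewrite setTI; apply => //.
Qed.

Lemma measurable_triangle : measurable triangle.
Proof.
rewrite (_ : triangle = Q `&` ~` [set p : RT * RT | p.2 <= p.1]).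
  apply: measurableI; first exact: mQ.
  by apply: measurableC; exact: (@measurable_le_set _ (RT * RT)%type).
apply/seteqP; split => [[y z] yz|[y z]].
  split; first exact: triangle_sub.
  by case: yz => /= _ yz _; apply/negP; rewrite -ltNge.
rewrite /triangle/= /Defs.I01/= !in_itv/= => -[[/andP[y0 y1] /andP[z0 z1]]].
by move/negP; rewrite -ltNge.
Qed.

(** The inner domain of integration depends on (y, z). As a measurable set of triples ((y, z), x) it
    turns the inner integral into a parametric one, to which [I1_param] applies. *)
Definition lower_set : set ((RT * RT) * RT) := [set q | q.2 <= q.1.1].
Definition upper_set : set ((RT * RT) * RT) := [set q | q.1.2 <= q.2].

Lemma measurable_lower_set : measurable lower_set.
Proof.
apply: (@measurable_le_set _ ((RT * RT) * RT)%type) => //.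
exact: measurableT_comp measurable_fst measurable_fst.
Qed.

Lemma measurable_upper_set : measurable upper_set.
Proof.
apply: (@measurable_le_set _ ((RT * RT) * RT)%type) => //.
exact: measurableT_comp measurable_snd measurable_fst.
Qed.

Definition gam1 u A (p : RT * RT) : R :=
  I1 (fun x => (ext u (x, p.2) - ext u (x, p.1)) * (\1_A x * \1_lower_set (p, x))).
Definition gam2 u A (p : RT * RT) : R :=
  I1 (fun x => (ext u (x, p.1) - ext u (x, p.2)) * (\1_A x * \1_upper_set (p, x))).

Lemma bmf_ext1 u : kern u -> bmf (fun q : (RT * RT) * RT => ext u (q.2, q.1.1)).
Proof.
move=> /bmf_ext bu.
apply: (@bmf_comp _ _ _ _ _ (ext u) (fun q : (RT * RT) * RT => (q.2, q.1.1))) => //.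
apply: measurable_fun_pair; first exact: measurable_snd.
exact: measurableT_comp measurable_fst measurable_fst.
Qed.

Lemma bmf_ext2 u : kern u -> bmf (fun q : (RT * RT) * RT => ext u (q.2, q.1.2)).
Proof.
move=> /bmf_ext bu.
apply: (@bmf_comp _ _ _ _ _ (ext u) (fun q : (RT * RT) * RT => (q.2, q.1.2))) => //.
apply: measurable_fun_pair; first exact: measurable_snd.
exact: measurableT_comp measurable_snd measurable_fst.
Qed.

Lemma bmf_indic_snd A : measurable A -> bmf (fun q : (RT * RT) * RT => \1_A q.2 : R).
Proof.
move=> mA; apply: (bmf_comp (@measurable_snd _ _ (RT * RT)%type RT)).
exact: bmf_indic.
Qed.

Lemma bmf_gam1 u A : kern u -> measurable A -> bmf (gam1 u A).
Proof.
move=> ku mA; apply: (@I1_param _ _ _ (fun q : (RT * RT) * RT =>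
  (ext u (q.2, q.1.2) - ext u (q.2, q.1.1)) * (\1_A q.2 * \1_lower_set q))).
apply: bmfM; first by apply: bmfB; [exact: bmf_ext2|exact: bmf_ext1].
apply: bmfM; first exact: bmf_indic_snd.
by apply: bmf_indic; exact: measurable_lower_set.
Qed.

Lemma bmf_gam2 u A : kern u -> measurable A -> bmf (gam2 u A).
Proof.
move=> ku mA; apply: (@I1_param _ _ _ (fun q : (RT * RT) * RT =>
  (ext u (q.2, q.1.1) - ext u (q.2, q.1.2)) * (\1_A q.2 * \1_upper_set q))).
apply: bmfM; first by apply: bmfB; [exact: bmf_ext1|exact: bmf_ext2].
apply: bmfM; first exact: bmf_indic_snd.
by apply: bmf_indic; exact: measurable_upper_set.
Qed.

Definition gamint (g : RT * RT -> R) : R :=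
  I2 (fun p => Num.max (g p) 0 * \1_triangle p).

Lemma Gamma_atE u A : A `<=` I01 ->
  Gamma_at u A = gamint (gam1 u A) + gamint (gam2 u A).
Proof.
move=> AI; rewrite /Gamma_at; congr (_ + _).
  rewrite (@Rint_restr _ _ _ mu2 Q _ _ triangle_sub).
  apply: I2_eq => -[y z] _; rewrite /= indicE.
  have [yz|_] := boolP ((y, z) \in triangle); last by rewrite !mulr0.
  rewrite !mulr1; congr (Num.max _ _); move: yz => /set_mem yz.
  have [/= Iy Iz] := triangle_sub yz; case: yz => /= y0 yz z1.
  rewrite (@Rint_restr _ _ _ mu I01); last by move=> x [/AI].
  apply: I1_eq => x Ix; rewrite !extE// indicI/=; congr (_ * (_ * _)).
  rewrite !indicE; congr (nat_of_bool _)%:R; apply/idP/idP.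
    by move/set_mem; rewrite /= in_itv/= => /andP[_ xy]; exact/mem_set.
  move/set_mem; rewrite /lower_set/= => xy; apply/mem_set.
  by move: Ix; rewrite /Defs.I01/= !in_itv/= => /andP[-> _].
rewrite (@Rint_restr _ _ _ mu2 Q _ _ triangle_sub).
apply: I2_eq => -[y z] _; rewrite /= indicE.
have [yz|_] := boolP ((y, z) \in triangle); last by rewrite !mulr0.
rewrite !mulr1; congr (Num.max _ _); move: yz => /set_mem yz.
have [/= Iy Iz] := triangle_sub yz; case: yz => /= y0 yz z1.
rewrite (@Rint_restr _ _ _ mu I01); last by move=> x [/AI].
apply: I1_eq => x Ix; rewrite !extE// indicI/=; congr (_ * (_ * _)).
rewrite !indicE; congr (nat_of_bool _)%:R; apply/idP/idP.
  by move/set_mem; rewrite /= in_itv/= => /andP[xy _]; exact/mem_set.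
move/set_mem; rewrite /upper_set/= => xy; apply/mem_set.
by move: Ix; rewrite /Defs.I01/= !in_itv/= => /andP[_ ->]; rewrite xy.
Qed.

Lemma bmf_gamint (g : RT * RT -> R) : bmf g ->
  bmf (fun p => Num.max (g p) 0 * \1_triangle p).
Proof.
move=> bg; apply: bmfM; first exact: bmf_max0.
by apply: bmf_indic; exact: measurable_triangle.
Qed.

Lemma gamint_ge0 g : 0 <= gamint g.
Proof.
by apply: Rintegral_ge0 => p _; rewrite mulr_ge0// le_max lexx orbT.
Qed.

Lemma gamint_le g h : bmf g -> bmf h ->
  (forall p, Q p -> 0 <= h p) -> (forall p, triangle p -> g p <= h p) ->
  gamint g <= I2 h.
Proof.
move=> bg bh h0 gh; apply: I2_le => //; first exact: bmf_gamint.
move=> p Qp; rewrite indicE; have [/set_mem Tp|_] := boolP (p \in triangle).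
  by rewrite mulr1 ge_max gh// h0.
by rewrite mulr0 h0.
Qed.

Lemma gamint_ge g h : bmf g -> bmf h ->
  (forall p, Q p -> ~ triangle p -> h p <= 0) -> (forall p, triangle p -> h p <= g p \/ h p <= 0) ->
  I2 h <= gamint g.
Proof.
move=> bg bh h0 gh; apply: I2_le => //; first exact: bmf_gamint.
move=> p Qp; rewrite indicE; have [/set_mem Tp|/negP Tp] := boolP (p \in triangle).
  by rewrite mulr1 le_max; apply/orP; exact: gh.
by rewrite mulr0 h0// => /mem_set.
Qed.

Lemma I2_cst c : I2 (cst c) = c.
Proof.
rewrite (_ : I2 _ = I2 (fun p => cst c p.1 * cst 1 p.2)).
  by rewrite I2_prod ?I1_cst ?mulr1//; exact: bmf_cst.
by apply: I2_eq => p _; rewrite /= mulr1.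
Qed.

Lemma gam_le2 (f g : RT -> R) c : bmf f -> bmf g -> (forall x, `|f x| <= c) ->
  (forall x, `|g x| <= 1) -> `|I1 (fun x => f x * g x)| <= c.
Proof.
move=> bf bg fc g1; rewrite -[leRHS]mulr1 -(len_I01 R).
apply: (@Rint_bound R _ RT mu I01 (@mI01 R) (@muI01_fin R)); first exact: bmfM.
move=> x _; rewrite normrM -[leRHS]mulr1.
by apply: ler_pM.
Qed.

Lemma indic_norm_le1 d (T : measurableType d) (A : set T) x : `|\1_A x : R| <= 1.
Proof. by rewrite indicE; case: (x \in A); rewrite ?normr1 ?normr0. Qed.

(** The constant is crude: what matters is that the supremum defining [Gamma] is taken over a
    bounded set. *)
Lemma Gamma_at_le4 u A : kern u -> measurable A -> A `<=` I01 -> Gamma_at u A <= 4.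
Proof.
move=> ku mA AI; rewrite Gamma_atE// (_ : 4 = 2 + 2); last by ring.
have bu := bmf_ext ku.
have bs z : bmf (fun x : RT => ext u (x, z)) by exact: (bmf_sec z (bmf_swap bu)).
have e2 a b : `|ext u a - ext u b| <= 2.
  apply: le_trans (ler_normB _ _) _.
  by rewrite (_ : 2 = 1 + 1)//; apply: lerD; exact: ext_le1.
have i1 (L : set ((RT * RT) * RT)) p x : `|\1_A x * \1_L (p, x) : R| <= 1.
  by rewrite normrM mulr_ile1 ?indic_norm_le1.
apply: lerD; rewrite -[leRHS]I2_cst; apply: gamint_le => //.
- exact: bmf_gam1.
- exact: bmf_cst.
- move=> p _; apply: le_trans (ler_norm _) _; apply: gam_le2 => //.
  + exact: bmfB.
  + apply: bmfM; first exact: bmf_indic.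
    by apply: (@bmf_comp _ _ _ _ _ _ (pair p) (pair1_measurable p));
      apply: bmf_indic; exact: measurable_lower_set.
- exact: bmf_gam2.
- exact: bmf_cst.
- move=> p _; apply: le_trans (ler_norm _) _; apply: gam_le2 => //.
  + exact: bmfB.
  + apply: bmfM; first exact: bmf_indic.
    by apply: (@bmf_comp _ _ _ _ _ _ (pair p) (pair1_measurable p));
      apply: bmf_indic; exact: measurable_upper_set.
Qed.

Lemma Gamma_ub u A : kern u -> measurable A -> A `<=` I01 -> Gamma_at u A <= Gamma u.
Proof.
move=> ku mA AI; apply: ub_le_sup; last by exists A.
by exists 4 => _ [B [mB BI] <-]; exact: Gamma_at_le4.
Qed.

Lemma Gamma_le u c : (forall A, measurable A -> A `<=` I01 -> Gamma_at u A <= c) ->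
  Gamma u <= c.
Proof.
move=> uc; apply: ge_sup.
  by exists (Gamma_at u set0), set0 => //; split => //; exact: sub0set.
by move=> _ [B [mB BI] <-]; exact: uc.
Qed.

Lemma Gamma_ge0 u : kern u -> 0 <= Gamma u.
Proof.
move=> ku; apply: le_trans (Gamma_ub ku measurable0 (@sub0set _ _)).
by rewrite Gamma_atE; [rewrite addr_ge0// gamint_ge0|exact: sub0set].
Qed.

Definition before S T := forall x y, S x -> T y -> x < y.

Lemma box_section u S T : kern u -> measurable S -> measurable T ->
  S `<=` I01 -> T `<=` I01 ->
  box u S T = I1 (fun z => I1 (fun x => ext u (x, z) * \1_S x) * \1_T z).
Proof.
move=> ku mS mT SI TI; have bu := bmf_ext ku; rewrite boxE// I2_fubini2; last first.
  by apply: bmfM => //; exact: bmf_rect.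
apply: I1_eq => z _; rewrite -I1Zr; last first.
  by apply: bmfM; [exact: (bmf_sec z (bmf_swap bu))|exact: bmf_indic].
by apply: I1_eq => x _ /=; rewrite mulrA.
Qed.

Lemma bmf_section u S : kern u -> measurable S ->
  bmf (fun z => I1 (fun x => ext u (x, z) * \1_S x)).
Proof.
move=> ku mS; have bu := bmf_ext ku.
apply: (@I1_param _ _ _ (fun q : RT * RT => ext u (q.2, q.1) * \1_S q.2)).
by apply: bmfM; [exact: bmf_swap|apply: bmf_snd; exact: bmf_indic].
Qed.

(** Take A as the test set and restrict the first integral to (y, z) in B x C. There y < z and all
    of A lies below y, so the inner integral is [h z - h y], where [h] integrates the kernel over A.
    Integrating this over B x C gives the two boxes; the rest of the integrand is nonnegative. *)
Lemma Gamma_shift_right u A B C : kern u ->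
  measurable A -> measurable B -> measurable C ->
  A `<=` I01 -> B `<=` I01 -> C `<=` I01 -> before A B -> before B C ->
  len B * box u A C <= len C * box u A B + Gamma u.
Proof.
move=> ku mA mB mC AI BI CI AB BC; have bu := bmf_ext ku.
rewrite -lerBlDl; apply: le_trans (Gamma_ub ku mA AI).
rewrite Gamma_atE// -[leLHS]addr0; apply: lerD; last exact: gamint_ge0.
pose h z := I1 (fun x => ext u (x, z) * \1_A x).
have bh : bmf h by exact: bmf_section.
have bB : bmf (\1_B : RT -> R) by exact: bmf_indic.
have bC : bmf (\1_C : RT -> R) by exact: bmf_indic.
have bhB : bmf (fun y => h y * \1_B y) by exact: bmfM.
have bhC : bmf (fun y => h y * \1_C y) by exact: bmfM.
have E D : measurable D -> D `<=` I01 -> box u A D = I1 (fun y => h y * \1_D y).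
  by move=> mD DI; rewrite box_section.
rewrite !E// -!I1_indic// [X in _ - X]mulrC -(I2_prod bB bhC) -(I2_prod bhB bC).
have b1 := bmfM (bmf_fst bB) (bmf_snd bhC).
have b2 := bmfM (bmf_fst bhB) (bmf_snd bC).
rewrite -(I2B b1 b2); apply: gamint_ge.
- exact: bmf_gam1.
- exact: bmfB.
- move=> [y z] [/= Iy Iz] nT; rewrite !indicE.
  have [/set_mem By|_] := boolP (y \in B); last by rewrite mul0r mulr0 mul0r subr0.
  have [/set_mem Cz|_] := boolP (z \in C); last by rewrite !mulr0 subr0.
  case: nT; split => /=; last 1 first.
  + by move: Iz; rewrite /Defs.I01/= in_itv/= => /andP[].
  + by move: Iy; rewrite /Defs.I01/= in_itv/= => /andP[].
  + exact: BC.
- move=> [y z] _; rewrite !indicE/=.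
  have [/set_mem By|_] := boolP (y \in B); last first.
    by right; rewrite mul0r mulr0 mul0r subr0.
  have [/set_mem Cz|_] := boolP (z \in C); last by right; rewrite !mulr0 subr0.
  left; rewrite mul1r !mulr1 /h/gam1.
  rewrite le_eqVlt; apply/orP; left; apply/eqP.
  have bs t : bmf (fun x : RT => ext u (x, t) * \1_A x).
    by apply: bmfM; [exact: (bmf_sec t (bmf_swap bu))|exact: bmf_indic].
  rewrite -(@RintB R _ RT mu I01 (@mI01 R) (@muI01_fin R))//.
  apply: I1_eq => x Ix /=; rewrite -mulrBl; congr (_ * _).
  rewrite [\1_A x]indicE; have [/set_mem Ax|_] := boolP (x \in A); last by rewrite mul0r.
  by rewrite mul1r indicE mem_set// /lower_set/= ltW// AB.
Qed.

(** Mirror image of the right shift: the test set is C, the pair (y, z) runs over A x B, and the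
    second integral is used. Symmetry of the graphon puts C in the first argument of the boxes. *)
Lemma Gamma_shift_left u A B C : graphon u ->
  measurable A -> measurable B -> measurable C ->
  A `<=` I01 -> B `<=` I01 -> C `<=` I01 -> before A B -> before B C ->
  len B * box u A C <= len A * box u B C + Gamma u.
Proof.
move=> gu mA mB mC AI BI CI AB BC; have ku := graphon_kern gu.
have bu := bmf_ext ku.
rewrite (box_sym gu mA mC)// (box_sym gu mB mC)//.
rewrite -lerBlDl; apply: le_trans (Gamma_ub ku mC CI).
rewrite Gamma_atE// -[leLHS]add0r; apply: lerD; first exact: gamint_ge0.
pose h z := I1 (fun x => ext u (x, z) * \1_C x).
have bh : bmf h by exact: bmf_section.
have bB : bmf (\1_B : RT -> R) by exact: bmf_indic.
have bA : bmf (\1_A : RT -> R) by exact: bmf_indic.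
have bhB : bmf (fun y => h y * \1_B y) by exact: bmfM.
have bhA : bmf (fun y => h y * \1_A y) by exact: bmfM.
have E D : measurable D -> D `<=` I01 -> box u C D = I1 (fun y => h y * \1_D y).
  by move=> mD DI; rewrite box_section.
rewrite !E// -!I1_indic// [X in X - _]mulrC -(I2_prod bhA bB) -(I2_prod bA bhB).
have b1 := bmfM (bmf_fst bhA) (bmf_snd bB).
have b2 := bmfM (bmf_fst bA) (bmf_snd bhB).
rewrite -(I2B b1 b2); apply: gamint_ge.
- exact: bmf_gam2.
- exact: bmfB.
- move=> [y z] [/= Iy Iz] nT; rewrite !indicE.
  have [/set_mem Ay|_] := boolP (y \in A); last by rewrite !mul0r mulr0 mul0r subr0.
  have [/set_mem Bz|_] := boolP (z \in B); last by rewrite !mulr0 subr0.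
  case: nT; split => /=; last 1 first.
  + by move: Iz; rewrite /Defs.I01/= in_itv/= => /andP[].
  + by move: Iy; rewrite /Defs.I01/= in_itv/= => /andP[].
  + exact: AB.
- move=> [y z] _; rewrite !indicE/=.
  have [/set_mem Ay|_] := boolP (y \in A); last first.
    by right; rewrite !mul0r mulr0 mul0r subr0.
  have [/set_mem Bz|_] := boolP (z \in B); last by right; rewrite !mulr0 subr0.
  left; rewrite mul1r !mulr1 /h/gam2.
  rewrite le_eqVlt; apply/orP; left; apply/eqP.
  have bs t : bmf (fun x : RT => ext u (x, t) * \1_C x).
    by apply: bmfM; [exact: (bmf_sec t (bmf_swap bu))|exact: bmf_indic].
  rewrite -(@RintB R _ RT mu I01 (@mI01 R) (@muI01_fin R))//.
  apply: I1_eq => x Ix /=; rewrite -mulrBl; congr (_ * _).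
  rewrite [\1_C x]indicE; have [/set_mem Cx|_] := boolP (x \in C); last by rewrite mul0r.
  by rewrite mul1r indicE mem_set// /upper_set/= ltW// BC.
Qed.

End GammaParameter.

(** * Gamma of a graphon close to a Robinson graphon *)

Section GammaPerturbation.
Variable R : realType.
Local Notation RT := (measurableTypeR R).
Local Notation mu := (@lebesgue_measure R).
Local Notation I01 := (@I01 R).
Local Notation Q := (I01 `*` I01).
Local Notation I1 := (@Iunit R).
Local Notation I2 := (@Isquare R).
Implicit Types (u v w r : R -> R -> R) (A B S T : set RT).

Lemma I1B (f g : RT -> R) : bmf f -> bmf g ->
  I1 (fun x => f x - g x) = I1 f - I1 g.
Proof. by move=> bf bg; exact: (@RintB R _ RT mu I01 (@mI01 R) (@muI01_fin R)). Qed.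

Lemma I1_sum (I : Type) (s : seq I) (P : pred I) (h : I -> RT -> R) :
  (forall i, bmf (h i)) ->
  I1 (fun p => \sum_(i <- s | P i) h i p) = \sum_(i <- s | P i) I1 (h i).
Proof. by move=> bh; exact: (@Rint_sum R _ RT mu I01 (@mI01 R) (@muI01_fin R)). Qed.

Lemma I1_normr (f : RT -> R) : bmf f -> `|I1 f| <= I1 (fun x => `|f x|).
Proof. exact: (@Rint_norm R _ RT mu I01 (@mI01 R) (@muI01_fin R)). Qed.

Lemma bmf_secS u S z : kern u -> measurable S ->
  bmf (fun x : RT => ext u (x, z) * \1_S x).
Proof.
move=> /bmf_ext bu mS.
by apply: bmfM; [exact: (bmf_sec z (bmf_swap bu))|exact: bmf_indic].
Qed.

(** Split [0,1] by the sign of the section integral [h]: the integral of its absolute value is the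
    box over A x [P] minus the box over A x [N], hence the factor 2. *)
Lemma section_L1 u A c : kern u -> measurable A -> A `<=` I01 ->
  (forall S T, measurable S -> measurable T -> S `<=` I01 -> T `<=` I01 ->
    `|box u S T| <= c) ->
  I1 (fun z => `|I1 (fun x => ext u (x, z) * \1_A x)|) <= 2 * c.
Proof.
move=> ku mA AI uc; pose h z := I1 (fun x => ext u (x, z) * \1_A x).
have bh : bmf h by exact: bmf_section.
pose P := I01 `&` [set z | 0 < h z]; pose N := I01 `\` [set z | 0 < h z].
have mP : measurable P by exact: measurable_pos.
have mN : measurable N.
  rewrite (_ : N = I01 `\` P); first by apply: measurableD => //; exact: mI01.
  apply/seteqP; split => z [Iz] nz; split => //; first by move=> [].
  by move=> hz; apply: nz.
have bhS S : measurable S -> bmf (fun z => h z * \1_S z).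
  by move=> mS; apply: bmfM => //; exact: bmf_indic.
have E S : measurable S -> S `<=` I01 -> box u A S = I1 (fun y => h y * \1_S y).
  by move=> mS SI; rewrite box_section.
rewrite (_ : I1 _ = I1 (fun z => h z * \1_P z - h z * \1_N z)).
  rewrite I1B; [|exact: bhS..]; rewrite -E//; last exact: subIsetl.
  rewrite -E//; last exact: subDsetl.
  have := uc A P mA mP AI (@subIsetl _ _ _).
  have := uc A N mA mN AI (@subDsetl _ _ _).
  rewrite !ler_norml; lra.
apply: I1_eq => z Iz; rewrite !indicE -/(h z); case: (ltP 0 (h z)) => hz.
  rewrite mem_set//= memNset ?mulr0 ?subr0 ?mulr1 ?gtr0_norm//.
  by move=> [_]; apply.
rewrite memNset/=; last by move=> [_ /=]; rewrite ltNge hz.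
rewrite mem_set/= ?mulr0 ?sub0r ?mulr1 ?ler0_norm//.
by split => //=; apply/negP; rewrite -leNgt.
Qed.

(** The index of the approximating set depends on B. Summing over the entire net gives a bound that
    is one fixed function of z, whose integral [section_L1] controls. *)
Lemma section_approx u B n (F : 'I_n -> set RT) eta z : kern u ->
  measurable B -> (forall i, measurable (F i)) ->
  (exists i, I1 (fun x => `|\1_B x - \1_(F i) x|) <= eta) ->
  `|I1 (fun x => ext u (x, z) * \1_B x)| <=
  eta + \sum_(i < n) `|I1 (fun x => ext u (x, z) * \1_(F i) x)|.
Proof.
move=> ku mB mF [i Bi]; rewrite (bigD1 i)//= addrA -[leLHS]addr0.
apply: lerD; last exact: sumr_ge0.
have b1 := bmf_secS z ku mB; have b2 := bmf_secS z ku (mF i).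
rewrite -lerBlDr; apply: le_trans (lerB_dist _ _) _.
rewrite -I1B//; apply: le_trans (I1_normr _) _; first exact: bmfB.
apply: le_trans Bi; apply: I1_le; first by apply: bmf_norm; exact: bmfB.
  by apply: bmf_norm; apply: bmfB; exact: bmf_indic.
move=> x _; rewrite -mulrBr normrM -[leRHS]mul1r.
by apply: ler_wpM2r => //; exact: ext_le1.
Qed.

Lemma section_diff u r B y z : kern u -> kern r -> measurable B ->
  kern (fun x y => u x y - r x y) ->
  I01 y -> I01 z -> (forall x, I01 x -> B x -> r x z <= r x y) ->
  I1 (fun x => (ext u (x, z) - ext u (x, y)) * \1_B x) <=
  `|I1 (fun x => ext (fun x y => u x y - r x y) (x, z) * \1_B x)| +
  `|I1 (fun x => ext (fun x y => u x y - r x y) (x, y) * \1_B x)|.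
Proof.
move=> ku kr mB kd Iy Iz rB.
have bd t := bmf_secS t kd mB.
apply: (@le_trans _ _ (I1 (fun x => ext (fun x y => u x y - r x y) (x, z) * \1_B x) -
    I1 (fun x => ext (fun x y => u x y - r x y) (x, y) * \1_B x))); last first.
  by apply: lerD; [exact: ler_norm|rewrite -normrN; exact: ler_norm].
rewrite -I1B//; apply: I1_le; last 1 first.
- move=> x Ix; rewrite -mulrBl; rewrite !extE// indicE.
  have [/set_mem Bx|_] := boolP (x \in B); last by rewrite !mulr0.
  by rewrite !mulr1; have := rB x Ix Bx; lra.
- apply: bmfM; last exact: bmf_indic.
  by apply: bmfB; exact: (bmf_sec _ (bmf_swap (bmf_ext ku))).
- exact: bmfB.
Qed.

Lemma len_itv (a b : R) : 0 <= a -> b <= 1 ->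
  len (I01 `&` [set` `[a, b]]) = Num.max (b - a) 0.
Proof.
move=> a0 b1; rewrite /len (_ : I01 `&` [set` `[a, b]] = [set` `[a, b]]); last first.
  apply/setIidPr => x; rewrite /Defs.I01/= !in_itv/= => /andP[ax xb].
  by rewrite (le_trans a0 ax) (le_trans xb b1).
rewrite lebesgue_measure_itv/= lte_fin.
by case: (ltP a b) => ab; case: leP => //=; lra.
Qed.

Lemma grid_floor (N : nat) (y : R) : (0 < N)%N -> 0 <= y <= 1 ->
  exists i : 'I_N.+1, i%:R / N%:R <= y < i.+1%:R / N%:R.
Proof.
move=> N0 /andP[y0 y1]; have N0' : 0 < N%:R :> R by rewrite ltr0n.
have Ny0 : 0 <= N%:R * y by rewrite mulr_ge0// ltW.
have /andP[l1 l2] := truncn_itv Ny0.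
have iN : (Num.truncn (N%:R * y)%R < N.+1)%N.
  rewrite ltnS -(ler_nat R); apply: le_trans l1 _.
  by rewrite -[leRHS]mulr1 ler_pM2l.
exists (Ordinal iN) => /=.
by rewrite ler_pdivrMr// ltr_pdivlMr// [y * _]mulrC l1 l2.
Qed.

(** The inner domains of the two halves of Gamma are one-parameter families of rays cut with A; the
    boolean lets both halves share one argument. *)
Definition half (b : bool) (y : R) : set RT :=
  if b then [set` `]-oo, y]] else [set` `[y, +oo[].

Lemma measurable_half b y : measurable (half b y).
Proof. by case: b; exact: measurable_itv. Qed.

Lemma half_diff b A (e y x : R) : e <= y ->
  `|\1_(A `&` half b y) x - \1_(A `&` half b e) x| <= \1_[set` `[e, y]] x :> R.
Proof.
move=> ey; rewrite !indicI/= -mulrBr normrM -[leRHS]mul1r.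
apply: ler_pM => //; first exact: indic_norm_le1.
have E (P : bool) (S : set RT) : (S x <-> P) -> \1_S x = P%:R :> R.
  by move=> SP; rewrite indicE; congr (nat_of_bool _)%:R; apply/idP/idP => [/set_mem/SP|/SP/mem_set].
rewrite [leRHS](E ((e <= x) && (x <= y))); last by rewrite /= in_itv.
case: b; [rewrite (E (x <= y)) ?(E (x <= e))|rewrite (E (y <= x)) ?(E (e <= x))];
  rewrite /= ?in_itv/= ?andbT //.
- by case: (leP x e) => xe; case: (leP x y) => xy; case: (leP e x) => ex /=;
    rewrite ?subrr ?subr0 ?normr0 ?normr1//; lra.
- by case: (leP y x) => xe; case: (leP x y) => xy; case: (leP e x) => ex /=;
    rewrite ?subrr ?subr0 ?sub0r ?normrN ?normr0 ?normr1//; lra.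
Qed.

Lemma half_approx u A b (N : nat) y z : kern u -> measurable A -> (0 < N)%N -> I01 y ->
  `|I1 (fun x => ext u (x, z) * \1_(A `&` half b y) x)| <= N%:R^-1 +
  \sum_(i < N.+1) `|I1 (fun x => ext u (x, z) * \1_(A `&` half b (i%:R / N%:R)) x)|.
Proof.
move=> ku mA N0 Iy; have N0' : 0 < N%:R :> R by rewrite ltr0n.
have mh t : measurable (A `&` half b t).
  by apply: measurableI => //; exact: measurable_half.
apply: section_approx => //.
have [i /andP[iy yi]] := grid_floor N0 Iy; exists i.
have mc : measurable ([set` `[i%:R / N%:R, y]] : set RT) by exact: measurable_itv.
apply: (@le_trans _ _ (I1 (\1_(I01 `&` [set` `[i%:R / N%:R, y]])))).
  apply: I1_le.
  - by apply: bmf_norm; apply: bmfB; exact: bmf_indic.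
  - by apply: bmf_indic; apply: measurableI => //; exact: mI01.
  - move=> x Ix; rewrite (indicI _ I01)/= [\1_I01 x]indicE mem_set// mul1r.
    exact: half_diff.
rewrite I1_indic; first last.
- exact: subIsetl.
- by apply: measurableI => //; exact: mI01.
move: Iy; rewrite /Defs.I01/= in_itv/= => /andP[y0 y1].
rewrite len_itv ?divr_ge0 ?ler0n// ge_max invr_ge0 ler0n andbT.
by move: yi; rewrite -natr1 mulrDl mul1r => yi; lra.
Qed.

(** Each of the two sections, at z and at y, is replaced by 1/N plus the fixed function [H], the sum
    over the net of N + 1 thresholds. [section_L1] bounds the integral of [H] by 2 (N + 1) c. *)
Lemma gamint_half_le d b A (N : nat) c g : kern d -> measurable A -> A `<=` I01 ->
  (0 < N)%N ->
  (forall S T, measurable S -> measurable T -> S `<=` I01 -> T `<=` I01 ->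
    `|box d S T| <= c) -> bmf g ->
  (forall y z, triangle (y, z) -> exists2 t, I01 t & g (y, z) <=
    `|I1 (fun x => ext d (x, z) * \1_(A `&` half b t) x)| +
    `|I1 (fun x => ext d (x, y) * \1_(A `&` half b t) x)|) ->
  gamint g <= 2 / N%:R + 4 * N.+1%:R * c.
Proof.
move=> kd mA AI N0 dc bg gle.
pose F (i : 'I_N.+1) := A `&` half b (i%:R / N%:R).
have mF i : measurable (F i) by apply: measurableI => //; exact: measurable_half.
have FI i : F i `<=` I01 by move=> x [/AI].
pose H z := \sum_i `|I1 (fun x => ext d (x, z) * \1_(F i) x)|.
have bH : bmf H.
  by apply: bmf_sum => i; apply: bmf_norm; exact: bmf_section.
have IH : I1 H <= 2 * N.+1%:R * c.
  rewrite I1_sum; last by move=> i; apply: bmf_norm; exact: bmf_section.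
  apply: (@le_trans _ _ (\sum_(i < N.+1) (2 * c))).
    by apply: ler_sum => i _; exact: section_L1.
  by rewrite sumr_const card_ord -mulr_natr; lra.
have b0 : bmf (fun p : RT * RT => H p.2 + H p.1).
  by apply: bmfD; [exact: bmf_snd bH|exact: bmf_fst bH].
have bc : bmf (fun p : RT * RT => 2 / N%:R : R) by exact: bmf_cst.
apply: (@le_trans _ _ (I2 (fun p => 2 / N%:R + (H p.2 + H p.1)))).
  apply: gamint_le => //; first exact: bmfD.
    move=> p _; rewrite addr_ge0 ?divr_ge0 ?ler0n// addr_ge0//; exact: sumr_ge0.
  move=> [y z] yz; have [t It] := gle y z yz; move/le_trans; apply.
  rewrite (_ : 2 / N%:R + _ = (N%:R^-1 + H z) + (N%:R^-1 + H y)) /=; last by ring.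
  by apply: lerD; exact: half_approx.
rewrite I2D// I2D; [|exact: bmf_snd bH|exact: bmf_fst bH].
have b1 : bmf (cst 1 : RT -> R) by exact: bmf_cst.
rewrite (_ : I2 (fun p => H p.2) = I1 (cst 1) * I1 H); last first.
  by rewrite -(I2_prod b1 bH); apply: I2_eq => p _ /=; rewrite mul1r.
rewrite (_ : I2 (fun p => H p.1) = I1 H * I1 (cst 1)); last first.
  by rewrite -(I2_prod bH b1); apply: I2_eq => p _ /=; rewrite mulr1.
by rewrite I1_cst mul1r mulr1 (I2_cst (2 / N%:R)); lra.
Qed.

(** The monotonicity of r removes r from both inner integrals and leaves sections of u - r over
    rays, whose threshold is y in the first half and z in the second. Each half costs 2/N + 4 (N +
    1) c; N is free, so it can be fixed before c is made small. *)
Lemma Gamma_perturb u r (N : nat) c : graphon u -> graphon r -> Robinson r ->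
  (0 < N)%N ->
  (forall S T, measurable S -> measurable T -> S `<=` I01 -> T `<=` I01 ->
    `|box (fun x y => u x y - r x y) S T| <= c) ->
  Gamma u <= 4 / N%:R + 8 * N.+1%:R * c.
Proof.
move=> gu gr Rr N0 uc.
have ku := graphon_kern gu; have kr := graphon_kern gr.
have kd := graphonB_kern gu gr.
apply: Gamma_le => A mA AI; rewrite Gamma_atE//.
rewrite (_ : 4 / N%:R + _ = (2 / N%:R + 4 * N.+1%:R * c) +
  (2 / N%:R + 4 * N.+1%:R * c)); last by ring.
have mB b y : measurable (A `&` half b y).
  by apply: measurableI => //; exact: measurable_half.
have ru x y : I01 x -> I01 y -> r x y = r y x.
  by case: gr => _ h _; exact: h.
have I0 x : I01 x -> 0 <= x /\ x <= 1.
  by rewrite /Defs.I01/= in_itv/= => /andP.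
apply: lerD.
- apply: (@gamint_half_le _ true A _ _ _ kd mA AI N0 uc); first exact: bmf_gam1.
  move=> y z yz; have [/= Iy Iz] := triangle_sub yz; exists y => //.
  rewrite /gam1 (_ : I1 _ = I1 (fun x => (ext u (x, z) - ext u (x, y)) *
    \1_(A `&` half true y) x)).
    apply: section_diff => // x Ix [Ax]; rewrite /half/= in_itv/= => xy.
    case: yz => /= y0 yz z1.
    by have := Rr x y z (I0 x Ix).1 xy (ltW yz) z1; rewrite le_min => /andP[].
  apply: I1_eq => x Ix /=; rewrite indicI/=; congr (_ * (_ * _)).
- apply: (@gamint_half_le _ false A _ _ _ kd mA AI N0 uc); first exact: bmf_gam2.
  move=> y z yz; have [/= Iy Iz] := triangle_sub yz; exists z => //.
  rewrite addrC /gam2 (_ : I1 _ = I1 (fun x => (ext u (x, y) - ext u (x, z)) *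
    \1_(A `&` half false z) x)).
    apply: section_diff => // x Ix [Ax]; rewrite /half/= in_itv/= andbT => xy.
    case: yz => /= y0 yz z1; rewrite (ru x y)// (ru x z)//.
    by have := Rr y z x y0 (ltW yz) xy (I0 x Ix).2; rewrite le_min => /andP[].
  apply: I1_eq => x Ix /=; rewrite indicI/=; congr (_ * (_ * _)).
  rewrite !indicE; congr (nat_of_bool _)%:R.
  by apply/idP/idP => /set_mem xy; apply/mem_set; move: xy; rewrite /upper_set/= ?in_itv/= ?andbT.
Qed.

End GammaPerturbation.

(** * Grid functions *)

Section GridFunctions.
Variable R : realType.
Implicit Types g : nat -> nat -> R.

(** The value one cell nearer to the diagonal, which is the larger one for a Robinson array. The
    test [a.+2 < b] says that the shifted pair still lies strictly above the diagonal; closer pairs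
    get the trivial bound 1. *)
Definition up g (a b : nat) : R :=
  if (a.+2 < b)%N then g a.+1 b.-1 else if (b.+2 < a)%N then g b.+1 a.-1 else 1.

(** The value one cell farther from the diagonal. The default 0 covers the diagonal and the border,
    where no farther cell of the K-grid exists. *)
Definition lo (K : nat) g (a b : nat) : R :=
  if (0 < a < b)%N && (b.+1 < K)%N then g a.-1 b.+1
  else if (0 < b < a)%N && (a.+1 < K)%N then g b.-1 a.+1 else 0.

Lemma up_sym g a b : up g a b = up g b a.
Proof. by rewrite /up; case: ltnP => h; case: ltnP => h' //; lia. Qed.

Lemma lo_sym K g a b : lo K g a b = lo K g b a.
Proof.
rewrite /lo; case: ifPn => [/andP[/andP[h1 h2] h3]|h] //.
by rewrite ifF//; apply/negbTE; lia.
Qed.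

Lemma up_diag g a : up g a a = 1.
Proof. by rewrite /up ltnNge leqW// ltnW. Qed.

Lemma lo_diag K g a : lo K g a a = 0.
Proof. by rewrite /lo ltnn andbF. Qed.

Lemma up_le g a b : (a <= b)%N ->
  up g a b = if (a.+2 < b)%N then g a.+1 b.-1 else 1.
Proof.
by move=> ab; rewrite /up; case: ifP => // _; rewrite ifF//; apply/negbTE; lia.
Qed.

Lemma lo_le K g a b : (a <= b)%N ->
  lo K g a b = if (0 < a < b)%N && (b.+1 < K)%N then g a.-1 b.+1 else 0.
Proof.
move=> ab; rewrite /lo; case: ifP => // _.
by rewrite (_ : (0 < b < a)%N = false)//; apply/negbTE; lia.
Qed.

Definition unit_valued g := forall a b, 0 <= g a b <= 1.

Lemma up01 g a b : unit_valued g -> 0 <= up g a b <= 1.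
Proof. by move=> g01; rewrite /up; do 2!case: ifP => _ //; rewrite ler01 lexx. Qed.

Lemma lo01 K g a b : unit_valued g -> 0 <= lo K g a b <= 1.
Proof. by move=> g01; rewrite /lo; do 2!case: ifP => _ //; rewrite ler01 lexx. Qed.

(** The indices are strictly ordered because the shift inequalities compare three successive
    disjoint cells; diagonal entries are left free. *)
Definition rmono (K : nat) g := forall a b c, (a < b < c)%N -> (c < K)%N ->
  g a c <= g a b /\ g a c <= g b c.

Lemma up_Robinson K g a b c : unit_valued g -> rmono K g ->
  (a <= b <= c)%N -> (c <= K)%N -> up g a c <= Num.min (up g a b) (up g b c).
Proof.
move=> g01 gm /andP[ab bc] cK; rewrite le_min.
have u1 i j : up g i j <= 1 by have /andP[] := up01 i j g01.
have [ab2|ab2] := ltnP a.+2 b; last first.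
  rewrite [X in _ <= X]/up ltnNge ab2/= ifF ?u1/=; last by apply/negbTE; lia.
  have [bc2|bc2] := ltnP b.+2 c; last first.
    by rewrite [X in _ <= X]/up ltnNge bc2/= ifF ?u1//; apply/negbTE; lia.
  rewrite /up bc2 ifT; last lia.
  have [-> //|nab] := eqVneq a b.
  by have [] := gm a.+1 b.+1 c.-1 ltac:(lia) ltac:(lia).
have ac : (a.+2 < c)%N by lia.
apply/andP; split.
  rewrite /up ab2 ac; have [-> //|nbc] := eqVneq b c.
  by have [] := gm a.+1 b.-1 c.-1 ltac:(lia) ltac:(lia).
have [bc2|bc2] := ltnP b.+2 c; last first.
  by rewrite [X in _ <= X]/up ltnNge bc2/= ifF ?u1//; apply/negbTE; lia.
rewrite /up bc2 ac.
by have [] := gm a.+1 b.+1 c.-1 ltac:(lia) ltac:(lia).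
Qed.

Lemma sum_eq_le1 (n c : nat) : \sum_(0 <= b < n) (b == c)%:R <= 1 :> R.
Proof.
have [cn|nc] := ltnP c n; last first.
  rewrite big_nat big1 ?ler01// => i /andP[_ ic].
  by rewrite (_ : (i == c) = false)//; apply/negbTE; lia.
rewrite (bigD1_seq c) ?mem_index_iota ?iota_uniq//= eqxx.
by rewrite big1 ?addr0// => i /negbTE ->.
Qed.

(* Away from the diagonal and the border, [up] and [lo] are the same function
   translated by (1, -1) and (-1, 1), so their sums telescope. *)
Lemma sum_up_lo K g : (0 < K)%N -> unit_valued g ->
  \sum_(0 <= a < K.+1) \sum_(0 <= b < K.+1) (up g a b - lo K g a b) <= 14 * K%:R.
Proof.
move=> K0 g01.
(* These are the upper triangular parts of [up] and [lo] before translation; their supports are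
   chosen so that the translates are supported exactly where [up] and [lo] read [g]. *)
pose Phi a b : R := if (a < b < K)%N then g a b else 0.
pose Psi a b : R := if (a.+2 < b < K)%N then g a b else 0.
(* [T] dominates [up - lo] above the diagonal and vanishes on and below it. The two indicators pay
   for the cells where [up] is 1 by default. *)
pose T a b : R := (b == a.+1)%:R + (b == a.+2)%:R +
  (if b is b'.+1 then Phi a.+1 b' else 0) - (if a is a'.+1 then Psi a' b.+1 else 0).
have upT a b : (b < K.+1)%N -> (a < b)%N -> up g a b - lo K g a b <= T a b /\ T b a = 0.
  move=> bK ab; split.
    rewrite /T /up /lo; case: b bK ab => // b bK ab.
    rewrite (_ : (0 < b.+1 < a)%N = false)/=; last by apply/negbTE; lia.
    case: (ltnP a.+2 b.+1) => h.
      rewrite (_ : (b.+1 == a.+1) = false); last by apply/negbTE; lia.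
      rewrite (_ : (b.+1 == a.+2) = false); last by apply/negbTE; lia.
      have -> : Phi a.+1 b = g a.+1 b by rewrite /Phi ifT//; lia.
      rewrite !add0r lerD2l lerN2; case: a ab h => [|a] ab h //=.
    rewrite ifF; last by apply/negbTE; lia.
    rewrite (_ : _%:R + _%:R = 1 :> R); last first.
      case: eqVneq => e1; case: eqVneq => e2; rewrite ?addr0 ?add0r//; exfalso; lia.
    have P0 : 0 <= Phi a.+1 b.
      by rewrite /Phi; case: ifP => // _; have /andP[] := g01 a.+1 b.
    rewrite -addrA lerD2l -[X in X <= _]add0r; apply: lerD => //; rewrite lerN2.
    by case: a ab h P0 => [|a] ab h P0 //=; rewrite /Psi; case: ifP.
  rewrite /T; case: b bK ab => // b bK ab.
  rewrite (_ : (a == b.+2) = false); last by apply/negbTE; lia.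
  rewrite (_ : (a == b.+3) = false); last by apply/negbTE; lia.
  rewrite /Psi ifF; last by apply/negbTE; lia.
  case: a ab => [|a] ab; rewrite ?addr0 ?subr0//.
  by rewrite /Phi ifF ?addr0//; apply/negbTE; lia.
have T0 a : T a a = 0.
  rewrite /T.
  rewrite (_ : (a == a.+1) = false); last by apply/negbTE; lia.
  rewrite (_ : (a == a.+2) = false); last by apply/negbTE; lia.
  case: a => [|a]; rewrite ?addr0 ?subr0//.
  rewrite /Psi /Phi ifF; last by apply/negbTE; lia.
  by rewrite ifF ?addr0 ?subr0//; apply/negbTE; lia.
have pt a b : (a < K.+1)%N -> (b < K.+1)%N ->
    up g a b - lo K g a b <= (b == a)%:R + (T a b + T b a).
  move=> aK bK; case: (ltngtP a b) => ab.
  - by have [h ->] := upT a b bK ab; rewrite addr0 add0r.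
  - have [h ->] := upT b a aK ab; rewrite add0r add0r.
    by rewrite up_sym lo_sym.
  - rewrite ab T0 !addr0 lerBlDr.
    have /andP[_ ?] := up01 b b g01; have /andP[? _] := lo01 K b b g01.
    by apply: le_trans (_ : 1 <= _) => //; rewrite lerDl.
pose S := \sum_(0 <= a < K.+1) \sum_(0 <= b < K.+1) T a b.
have SE : S <= 4 * K%:R + 2.
  pose S1 := \sum_(0 <= a < K) \sum_(0 <= b < K) Phi a b.
  pose S2 := \sum_(0 <= a < K) \sum_(0 <= b < K) Psi a b.
  (* In each row [Phi] and [Psi] differ in at most the two entries b = a + 1 and b = a + 2. *)
  have S12 : S1 - S2 <= 2 * K%:R.
    rewrite /S1 /S2 -sumrB; apply: (@le_trans _ _ (\sum_(0 <= a < K) 2)); last first.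
      by rewrite sumr_const_nat subn0 mulr_natr.
    apply: ler_sum_nat => a _; rewrite -sumrB.
    apply: (@le_trans _ _ (\sum_(0 <= b < K) ((b == a.+1)%:R + (b == a.+2)%:R))).
      apply: ler_sum_nat => b /andP[_ bK]; rewrite /Phi /Psi.
      case: (ltnP a b) => ab; last first.
        by rewrite /= ifF ?subr0 ?addr_ge0//; apply/negbTE; lia.
      rewrite bK/= andbT; case: (ltnP a.+2 b) => ab2.
        by rewrite subrr addr_ge0.
      rewrite subr0 (_ : _%:R + _%:R = 1 :> R); first by have /andP[] := g01 a b.
      case: eqVneq => e1; case: eqVneq => e2; rewrite ?addr0 ?add0r//; exfalso; lia.
    rewrite big_split/=; have := sum_eq_le1 K a.+1; have := sum_eq_le1 K a.+2; lra.
  have Phi0 a b : 0 <= Phi a b.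
    by rewrite /Phi; case: ifP => // _; have /andP[] := g01 a b.
  have h1 : \sum_(0 <= a < K.+1) \sum_(0 <= b < K.+1)
      (if b is b'.+1 then Phi a.+1 b' else 0) <= S1.
    under eq_bigr do rewrite big_nat_recl// add0r.
    rewrite -(big_add1 _ _ 0 K.+2 xpredT (fun a => \sum_(0 <= b < K) Phi a b)).
    rewrite big_nat_recr//= big_nat_recr//=.
    rewrite [X in _ + X]big1 ?addr0; last first.
      by move=> b _; rewrite /Phi ifF//; apply/negbTE; lia.
    rewrite [X in _ + X]big1 ?addr0; last first.
      by move=> b _; rewrite /Phi ifF//; apply/negbTE; lia.
    rewrite /S1 (@big_ltn _ _ _ 0 K)//= lerDr; exact: sumr_ge0.
  have h2 : S2 <= \sum_(0 <= a < K.+1) \sum_(0 <= b < K.+1)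
      (if a is a'.+1 then Psi a' b.+1 else 0).
    rewrite big_nat_recl// big1 ?add0r//.
    apply: ler_sum_nat => a _.
    rewrite -(big_add1 _ _ 0 K.+2 xpredT (fun b => Psi a b)).
    rewrite big_nat_recr//= big_nat_recr//=.
    rewrite [Psi a K]/Psi ltnn andbF addr0 [Psi a K.+1]/Psi ifF ?addr0; last first.
      by apply/negbTE; lia.
    rewrite (@big_ltn _ _ _ 0 K)//= {1}/Psi ltn0/= add0r.
    by [].
  rewrite /S; under eq_bigr do rewrite /T sumrB big_split/= big_split/=.
  rewrite sumrB big_split/= big_split/=.
  have h3 c : \sum_(0 <= a < K.+1) \sum_(0 <= b < K.+1) (b == (c a))%:R <= K.+1%:R :> R.
    apply: (@le_trans _ _ (\sum_(0 <= a < K.+1) 1)).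
      by apply: ler_sum_nat => a _; exact: sum_eq_le1.
    by rewrite sumr_const_nat subn0.
  have := h3 (fun a => a.+1); have := h3 (fun a => a.+2); rewrite -natr1; lra.
(* The diagonal contributes at most K + 1 and each triangle at most 4 K + 2; the total 9 K + 5 is at
   most 14 K since K >= 1. *)
apply: (@le_trans _ _ (K.+1%:R + (S + S))); last first.
  by have : 1 <= K%:R :> R; [rewrite ler1n|rewrite -natr1; lra].
apply: (@le_trans _ _ (\sum_(0 <= a < K.+1) \sum_(0 <= b < K.+1)
    ((b == a)%:R + (T a b + T b a)))).
  by apply: ler_sum_nat => a /andP[_ aK]; apply: ler_sum_nat => b /andP[_ bK]; exact: pt.
under eq_bigr do rewrite big_split/= big_split/=.
rewrite big_split/= big_split/= lerD//; last by rewrite [X in _ + X]exchange_big_nat.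
apply: (@le_trans _ _ (\sum_(0 <= a < K.+1) 1)).
  by apply: ler_sum_nat => a _; exact: sum_eq_le1.
by rewrite sumr_const_nat subn0.
Qed.

End GridFunctions.

(** * Grid cells and shifts between them *)

Section Cells.
Variable R : realType.
Local Notation RT := (measurableTypeR R).
Local Notation mu := (@lebesgue_measure R).
Local Notation I01 := (@I01 R).
Implicit Types (k a b : nat) (S T : set RT).

(** Half-open, so that cells are disjoint for all indices. The cells a < k cover [0,1), and cell k
    meets [0,1] only in the point 1; partitions therefore run over [k.+1] indices. *)
Definition cell k a : set RT := [set` `[a%:R / k%:R, a.+1%:R / k%:R[].

Lemma measurable_cell k a : measurable (cell k a).
Proof. exact: measurable_itv. Qed.

Lemma I01P (x : R) : I01 x <-> 0 <= x <= 1.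
Proof. by rewrite /Defs.I01/= in_itv. Qed.

Lemma cell_sub k a : (a < k)%N -> cell k a `<=` I01.
Proof.
move=> ak x; have k0 : 0 < k%:R :> R by rewrite ltr0n; lia.
rewrite /cell/= in_itv/= => /andP[ax xa]; apply/I01P; apply/andP; split.
  by apply: le_trans ax; rewrite divr_ge0.
apply: le_trans (ltW xa) _; rewrite ler_pdivrMr// mul1r ler_nat; lia.
Qed.

Lemma len_cell k a : (0 < k)%N -> len (cell k a) = k%:R^-1.
Proof.
move=> k0; have k0' : 0 < k%:R :> R by rewrite ltr0n.
rewrite /len /cell lebesgue_measure_itv/= lte_fin.
rewrite ltr_pM2r ?invr_gt0// ltr_nat ltnSn /=.
by rewrite -mulrBl -natrB ?subSnn ?mul1r//; lia.
Qed.

Lemma cell_lt k a b x y : cell k a x -> cell k b y -> (a < b)%N -> x < y.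
Proof.
rewrite /cell/= !in_itv/= => /andP[_ xa] /andP[yb _] ab.
apply: lt_le_trans xa (le_trans _ yb).
by rewrite ler_wpM2r ?invr_ge0// ler_nat.
Qed.

Lemma cell_before k a b : (a < b)%N -> before (cell k a) (cell k b).
Proof. by move=> ab x y xa yb; exact: (cell_lt xa yb). Qed.

Lemma cell_inj k a b x : cell k a x -> cell k b x -> a = b.
Proof.
move=> xa xb; case: (ltngtP a b) => // ab; have := ltxx x.
  by rewrite (cell_lt xa xb ab).
by rewrite (cell_lt xb xa ab).
Qed.

Lemma cell_trunc k x : (0 < k)%N -> 0 <= x -> cell k (Num.truncn (k%:R * x)) x.
Proof.
move=> k0 x0; have k0' : 0 < k%:R :> R by rewrite ltr0n.
have /truncn_itv/andP[l1 l2] : 0 <= k%:R * x by rewrite mulr_ge0// ltW.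
by rewrite /cell/= in_itv/= ler_pdivrMr// ltr_pdivlMr// [x * _]mulrC l1.
Qed.

Lemma cell_le k a b x y : cell k a x -> cell k b y -> x <= y -> (a <= b)%N.
Proof.
move=> xa yb xy; case: (leqP a b) => // ba.
by have := cell_lt yb xa ba; rewrite ltNge xy.
Qed.

Lemma cell_bound k a x : (0 < k)%N -> cell k a x -> x <= 1 -> (a < k.+1)%N.
Proof.
move=> k0; have k0' : 0 < k%:R :> R by rewrite ltr0n.
rewrite /cell/= in_itv/= => /andP[+ _] x1; rewrite ler_pdivrMr// => h.
rewrite ltnS -(ler_nat R); apply: le_trans h _.
by rewrite -[leRHS]mul1r ler_wpM2r// ltW.
Qed.

Lemma sum_cell k x : (0 < k)%N -> I01 x ->
  \sum_(i < k.+1) \1_(cell k i) x = 1 :> R.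
Proof.
move=> k0 /I01P/andP[x0 x1]; have xc := cell_trunc k0 x0.
have ik := cell_bound k0 xc x1.
rewrite (bigD1 (Ordinal ik))//= indicE mem_set//= big1 ?addr0// => i ni.
rewrite indicE memNset// => xi; move/eqP: ni; apply; apply/val_inj.
exact: (cell_inj xi xc).
Qed.

Lemma len_cap_cell S k a : (0 < k)%N -> measurable S -> S `<=` I01 ->
  len (S `&` cell k a) <= k%:R^-1.
Proof.
move=> k0 mS SI; rewrite -(len_cell a k0).
have mc := measurable_cell k a.
have mSc : measurable (S `&` cell k a) by exact: measurableI.
apply: fine_le.
- by rewrite mu_fin_num// => x [/SI].
- have := lebesgue_measure_itv (`[a%:R / k%:R, a.+1%:R / k%:R[).
  by rewrite /cell => ->; case: ifP => //; rewrite -EFinD.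
- by apply: le_measure; rewrite ?inE//; exact: subIsetr.
Qed.

Lemma box_mono w S T S' T' : graphon w ->
  measurable S -> measurable T -> measurable S' -> measurable T' ->
  S `<=` S' -> T `<=` T' -> S' `<=` I01 -> T' `<=` I01 ->
  0 <= box w S T <= box w S' T'.
Proof.
move=> gw mS mT mS' mT' SS TT SI TI; have kw := graphon_kern gw.
have SI' : S `<=` I01 by exact: subset_trans SI.
have TI' : T `<=` I01 by exact: subset_trans TI.
apply/andP; split.
  have := @box_between R w S T 0 1 kw mS mT SI' TI'.
  rewrite mul0r => /(_ _)/andP[]// x y Sx Ty; case: gw => _ _; apply; auto.
rewrite !boxE//; apply: I2_le.
- by apply: bmfM; [exact: bmf_ext|exact: bmf_rect].
- by apply: bmfM; [exact: bmf_ext|exact: bmf_rect].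
- move=> [x y] [/= Ix Iy]; rewrite extE//.
  have /andP[w0 _] : 0 <= w x y <= 1 by case: gw => _ _; apply.
  apply: ler_wpM2l => //; apply: ler_pM => //.
    by rewrite !indicE; case: (boolP (x \in S)) => // /set_mem/SS Sx; rewrite mem_set.
  by rewrite !indicE; case: (boolP (y \in T)) => // /set_mem/TT Ty; rewrite mem_set.
Qed.

Definition density k w a b : R := k%:R ^+ 2 * box w (cell k a) (cell k b).

Lemma density01 k w a b : graphon w -> (0 < k)%N -> (a < k)%N -> (b < k)%N ->
  0 <= density k w a b <= 1.
Proof.
move=> gw k0 ak bk; have k0' : 0 < k%:R :> R by rewrite ltr0n.
have ma := measurable_cell k a; have mb := measurable_cell k b.
have Ia := cell_sub ak; have Ib := cell_sub bk.
have /andP[h0 _] := box_mono gw ma mb ma mb (@subset_refl _ _) (@subset_refl _ _) Ia Ib.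
have := box_norm (graphon_kern gw) ma mb Ia Ib.
rewrite ger0_norm// !len_cell// => h1; apply/andP; split.
  by rewrite mulr_ge0// exprn_ge0// ltW.
apply: le_trans (ler_wpM2l _ h1) _; first by rewrite exprn_ge0// ltW.
by rewrite expr2 -invfM mulfV// mulf_neq0// gt_eqF.
Qed.

Lemma box_cap_le0 w S T k a b g : graphon w -> (0 < k)%N ->
  measurable S -> measurable T -> S `<=` I01 -> T `<=` I01 -> 1 <= g ->
  box w (S `&` cell k a) (T `&` cell k b) <=
  g * (len (S `&` cell k a) * len (T `&` cell k b)).
Proof.
move=> gw k0 mS mT SI TI g1.
have mSa : measurable (S `&` cell k a).
  by apply: measurableI => //; exact: measurable_cell.
have mTb : measurable (T `&` cell k b).
  by apply: measurableI => //; exact: measurable_cell.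
apply: le_trans (ler_norm _) _; apply: le_trans (box_norm (graphon_kern gw) _ _ _ _) _ => //.
- by move=> x [/SI].
- by move=> x [/TI].
by rewrite -[leLHS]mul1r ler_wpM2r// mulr_ge0 ?len_ge0.
Qed.

(* Two shifts move [S] and [T] into the full cells next to them. *)
Lemma box_cap_ltP w S T k a b : graphon w -> (0 < k)%N -> (a < b)%N -> (b <= k)%N ->
  measurable S -> measurable T -> S `<=` I01 -> T `<=` I01 ->
  lo k (density k w) a b * (len (S `&` cell k a) * len (T `&` cell k b)) - 2 * k%:R * Gamma w <=
    box w (S `&` cell k a) (T `&` cell k b) <=
  up (density k w) a b * (len (S `&` cell k a) * len (T `&` cell k b)) +
    2 * k%:R * Gamma w.
Proof.
move=> gw k0 ab bk mS mT SI TI; have k0' : 0 < k%:R :> R by rewrite ltr0n.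
have kw := graphon_kern gw; have G0 := Gamma_ge0 kw.
have mSa : measurable (S `&` cell k a).
  by apply: measurableI => //; exact: measurable_cell.
have mTb : measurable (T `&` cell k b).
  by apply: measurableI => //; exact: measurable_cell.
have ISa : S `&` cell k a `<=` I01 by move=> x [/SI].
have ITb : T `&` cell k b `<=` I01 by move=> x [/TI].
have mc := measurable_cell k.
have /andP[box0 _] := box_mono gw mSa mTb mSa mTb (@subset_refl _ _) (@subset_refl _ _) ISa ITb.
have kG0 : 0 <= 2 * k%:R * Gamma w by rewrite !mulr_ge0// ltW.
have bef i j X Y : (i < j)%N -> before (X `&` cell k i) (Y `&` cell k j).
  by move=> ij x y [_ xi] [_ yj]; exact: (cell_lt xi yj).
have bl i j Y : (i < j)%N -> before (cell k i) (Y `&` cell k j).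
  by move=> ij x y xi [_ yj]; exact: (cell_lt xi yj).
have br i j X : (i < j)%N -> before (X `&` cell k i) (cell k j).
  by move=> ij x y [_ xi] yj; exact: (cell_lt xi yj).
set s := len (S `&` cell k a); set t := len (T `&` cell k b).
have s0 : 0 <= s by exact: len_ge0.
have t0 : 0 <= t by exact: len_ge0.
have sk : s <= k%:R^-1 by exact: len_cap_cell.
have tk : t <= k%:R^-1 by exact: len_cap_cell.
have kk : k%:R * k%:R^-1 = 1 :> R by rewrite mulfV// gt_eqF.
apply/andP; split.
  rewrite /lo; case: ifPn => [/andP[/andP[a0 _] bk1]|_]; last first.
    rewrite ifF; last by apply/negbTE; lia.
    by rewrite mul0r sub0r (le_trans _ box0)// oppr_le0.
  have := Gamma_shift_right kw mSa mTb (mc b.+1) ISa ITb (cell_sub bk1)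
    (bef _ _ _ _ ab) (br _ _ _ (ltnSn b)).
  have a1 : (a.-1 < a)%N by lia.
  have ak1 : (a.-1 < k)%N by lia.
  have := Gamma_shift_left gw (mc a.-1) mSa (mc b.+1) (cell_sub ak1) ISa (cell_sub bk1)
    (bl _ _ _ a1) (br _ _ _ (leqW ab)).
  rewrite !len_cell// -/s -/t /density.
  set X := box w _ _; set Y := box w _ _; set Z := box w _ _ => h1 h2.
  rewrite lerBlDr.
  (* The error of this shift gets multiplied by k t <= 1 when the second shift is applied, so the
     two errors together are at most 2 k [Gamma w]. *)
  have h3 : k%:R * (s * X) <= Y + k%:R * Gamma w.
    have := ler_wpM2l (ltW k0') h1; rewrite mulrDr [X in _ <= X + _]mulrA kk mul1r.
    by [].
  have h4 : k%:R * (t * Y) <= Z + k%:R * Gamma w.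
    have := ler_wpM2l (ltW k0') h2; rewrite mulrDr [X in _ <= X + _]mulrA kk mul1r.
    by [].
  have h5 : k%:R * t <= 1 by rewrite -[X in _ <= X]kk ler_wpM2l// ltW.
  have h6 : (k%:R * t) * (k%:R * (s * X)) <= (k%:R * t) * (Y + k%:R * Gamma w).
    by apply: ler_wpM2l => //; rewrite mulr_ge0// ltW.
  have h7 : (k%:R * t) * (k%:R * Gamma w) <= k%:R * Gamma w.
    by rewrite -[leRHS]mul1r ler_wpM2r// mulr_ge0// ltW.
  rewrite (_ : _ * X * (s * t) = (k%:R * t) * (k%:R * (s * X))); last by ring.
  apply: le_trans h6 _; rewrite mulrDr.
  rewrite (_ : k%:R * t * Y = k%:R * (t * Y)); last by ring.
  by lra.
rewrite /up; case: ifPn => [ab2|_]; last first.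
  rewrite ifF; last by apply/negbTE; lia.
  by apply: le_trans (box_cap_le0 a b gw k0 mS mT SI TI (lexx 1)) _; rewrite lerDl.
have b1 : (b.-1 < b)%N by lia.
have ab1 : (a < b.-1)%N by lia.
have aab : (a.+1 < b.-1)%N by lia.
have bk1 : (b.-1 < k)%N by lia.
have ak1 : (a.+1 < k)%N by lia.
have := Gamma_shift_right kw mSa (mc b.-1) mTb ISa (cell_sub bk1) ITb
  (br _ _ _ ab1) (bl _ _ _ b1).
have := Gamma_shift_left gw mSa (mc a.+1) (mc b.-1) ISa (cell_sub ak1) (cell_sub bk1)
    (br _ _ _ (ltnSn a)) (cell_before aab).
rewrite !len_cell// -/s -/t /density.
set X := box w _ (cell k b.-1); set Y := box w (cell k a.+1) _; set Z := box w _ _ => h1 h2.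
have h3 : X <= k%:R * (s * Y) + k%:R * Gamma w.
  have := ler_wpM2l (ltW k0') h1; rewrite mulrDr [X in X <= _]mulrA kk mul1r.
  by [].
have h4 : Z <= k%:R * (t * X) + k%:R * Gamma w.
  have := ler_wpM2l (ltW k0') h2; rewrite mulrDr [X in X <= _]mulrA kk mul1r.
  by [].
have h5 : k%:R * t <= 1 by rewrite -[X in _ <= X]kk ler_wpM2l// ltW.
have h6 : (k%:R * t) * X <= (k%:R * t) * (k%:R * (s * Y) + k%:R * Gamma w).
  by apply: ler_wpM2l => //; rewrite mulr_ge0// ltW.
have h7 : (k%:R * t) * (k%:R * Gamma w) <= k%:R * Gamma w.
  by rewrite -[leRHS]mul1r ler_wpM2r// mulr_ge0// ltW.
rewrite (_ : _ * Y * (s * t) = (k%:R * t) * (k%:R * (s * Y))); last by ring.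
move: h6; rewrite mulrDr -[k%:R * t * X]mulrA; lra.
Qed.

End Cells.

(** * Cut norm approximation on a grid and comparison of grids *)

Section BlockApproximation.
Variable R : realType.
Local Notation RT := (measurableTypeR R).
Local Notation I01 := (@I01 R).
Implicit Types (k a b : nat) (u w : R -> R -> R) (S T : set RT).

Lemma up_lip g h a b (k : nat) eta : 0 <= eta ->
  (forall i j, (i < k)%N -> (j < k)%N -> `|g i j - h i j| <= eta) ->
  (a <= k)%N -> (b <= k)%N -> up g a b <= up h a b + eta :> R.
Proof.
move=> eta0 gh ak bk; rewrite /up.
case: ltnP => h1; last case: ltnP => h2; last by rewrite lerDl.
  have := gh a.+1 b.-1 ltac:(lia) ltac:(lia); rewrite ler_norml; lra.
have := gh b.+1 a.-1 ltac:(lia) ltac:(lia); rewrite ler_norml; lra.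
Qed.

Lemma lo_lip g h a b (k : nat) eta : 0 <= eta ->
  (forall i j, (i < k)%N -> (j < k)%N -> `|g i j - h i j| <= eta) ->
  lo k h a b - eta <= lo k g a b :> R.
Proof.
move=> eta0 gh; rewrite /lo.
case: ifP => h1.
  have := gh a.-1 b.+1 ltac:(lia) ltac:(lia); rewrite ler_norml; lra.
case: ifP => h2; last by rewrite sub0r oppr_le0.
have := gh b.-1 a.+1 ltac:(lia) ltac:(lia); rewrite ler_norml; lra.
Qed.

Lemma block_close w u g k eta S T a b : graphon w -> graphon u -> unit_valued g ->
  (0 < k)%N -> 0 <= eta ->
  (forall i j, (i < k)%N -> (j < k)%N -> `|density k w i j - g i j| <= eta) ->
  (forall i j x y, I01 x -> I01 y -> cell k i x -> cell k j y ->
    lo k g i j <= u x y <= up g i j) ->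
  (a <= k)%N -> (b <= k)%N ->
  measurable S -> measurable T -> S `<=` I01 -> T `<=` I01 ->
  `|box w (S `&` cell k a) (T `&` cell k b) - box u (S `&` cell k a) (T `&` cell k b)| <=
  (up g a b - lo k g a b) / k%:R ^+ 2 + (eta + 2 * k%:R * Gamma w).
Proof.
move=> gw gu g01 k0 eta0 Dg ug.
have k0' : 0 < k%:R :> R by rewrite ltr0n.
have kw := graphon_kern gw; have ku := graphon_kern gu; have G0 := Gamma_ge0 kw.
wlog ab : a b S T / (a <= b)%N.
  move=> H ak bk mS mT SI TI; case: (leqP a b) => ab; first exact: H.
  have mSa : measurable (S `&` cell k a).
    by apply: measurableI => //; exact: measurable_cell.
  have mTb : measurable (T `&` cell k b).
    by apply: measurableI => //; exact: measurable_cell.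
  have ISa : S `&` cell k a `<=` I01 by move=> x [/SI].
  have ITb : T `&` cell k b `<=` I01 by move=> x [/TI].
  rewrite (box_sym gw mSa)// (box_sym gu mSa)// up_sym lo_sym.
  by apply: H => //; exact: ltnW.
move=> ak bk mS mT SI TI.
have mSa : measurable (S `&` cell k a).
  by apply: measurableI => //; exact: measurable_cell.
have mTb : measurable (T `&` cell k b).
  by apply: measurableI => //; exact: measurable_cell.
have ISa : S `&` cell k a `<=` I01 by move=> x [/SI].
have ITb : T `&` cell k b `<=` I01 by move=> x [/TI].
set s := len (S `&` cell k a); set t := len (T `&` cell k b).
have s0 : 0 <= s by exact: len_ge0.
have t0 : 0 <= t by exact: len_ge0.
have sk : s <= k%:R^-1 by exact: len_cap_cell.
have tk : t <= k%:R^-1 by exact: len_cap_cell.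
have stk : s * t <= (k%:R ^+ 2)^-1 by rewrite expr2 invfM; exact: ler_pM.
have st1 : s * t <= 1 by rewrite mulr_ile1// len_le1.
have st0 : 0 <= s * t by exact: mulr_ge0.
(* Enlarging the area s t to 1/k^2 requires a nonnegative gap; the sandwich [ug], read at the left
   endpoints of the two cells, provides it. *)
have lu : lo k g a b <= up g a b.
  have x : exists x, I01 x /\ cell k a x.
    exists (a%:R / k%:R); split.
      by apply/I01P; rewrite divr_ge0//= ler_pdivrMr// mul1r ler_nat.
    by rewrite /cell/= in_itv/= lexx/= ltr_pM2r ?invr_gt0// ltr_nat.
  have y : exists y, I01 y /\ cell k b y.
    exists (b%:R / k%:R); split.
      by apply/I01P; rewrite divr_ge0//= ler_pdivrMr// mul1r ler_nat.
    by rewrite /cell/= in_itv/= lexx/= ltr_pM2r ?invr_gt0// ltr_nat.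
  case: x => x [Ix xa]; case: y => y [Iy yb].
  by have /andP[] := ug a b x y Ix Iy xa yb; exact: le_trans.
have e0 : 0 <= eta + 2 * k%:R * Gamma w by rewrite addr_ge0// !mulr_ge0// ltW.
have gap c : c <= (up g a b - lo k g a b) * (s * t) + (eta + 2 * k%:R * Gamma w) ->
    c <= (up g a b - lo k g a b) / k%:R ^+ 2 + (eta + 2 * k%:R * Gamma w).
  by move/le_trans; apply; rewrite lerD2r ler_wpM2l// subr_ge0.
apply: gap; rewrite -/s -/t.
have /andP[u1 u2] : lo k g a b * (s * t) <= box u (S `&` cell k a) (T `&` cell k b) <=
    up g a b * (s * t).
  apply: box_between => // x y [Sx xa] [Ty yb].
  by apply: ug => //; [exact: SI|exact: TI].
move: ab; rewrite leq_eqVlt => /orP[/eqP ab|ab].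
  have upab : up g a b = 1 by rewrite ab up_diag.
  have loab : lo k g a b = 0 by rewrite ab lo_diag.
  move: u1 u2; rewrite upab loab subr0 mul0r mul1r => u1 u2.
  have /andP[w1 _] := box_mono gw mSa mTb mSa mTb (@subset_refl _ _) (@subset_refl _ _) ISa ITb.
  have := box_cap_le0 a b gw k0 mS mT SI TI (lexx 1); rewrite mul1r -/s -/t => w2.
  by rewrite ler_norml; lra.
have /andP[] := box_cap_ltP gw k0 ab bk mS mT SI TI; rewrite -/s -/t => w1 w2.
have := ler_wpM2r st0 (up_lip eta0 Dg ak bk); have := ler_wpM2r st0 (lo_lip a b eta0 Dg).
rewrite mulrDl mulrBl => h1 h2.
have h3 : eta * (s * t) <= eta by rewrite -[leRHS]mulr1 ler_wpM2l.
rewrite ler_norml; lra.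
Qed.

(** By [sum_up_lo] the gaps add up to at most 14 k / k^2; the remaining error is paid once for each
    of the (k + 1)^2 pairs of cells. *)
Lemma box_close w u g k eta S T : graphon w -> graphon u -> unit_valued g ->
  (0 < k)%N -> 0 <= eta ->
  (forall i j, (i < k)%N -> (j < k)%N -> `|density k w i j - g i j| <= eta) ->
  (forall i j x y, I01 x -> I01 y -> cell k i x -> cell k j y ->
    lo k g i j <= u x y <= up g i j) ->
  measurable S -> measurable T -> S `<=` I01 -> T `<=` I01 ->
  `|box (fun x y => w x y - u x y) S T| <=
  14 / k%:R + k.+1%:R ^+ 2 * (eta + 2 * k%:R * Gamma w).
Proof.
move=> gw gu g01 k0 eta0 Dg ug mS mT SI TI.
have k0' : 0 < k%:R :> R by rewrite ltr0n.
have kw := graphon_kern gw; have ku := graphon_kern gu.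
rewrite boxB//.
have BS v : kern v -> box v S T = \sum_(i < k.+1) \sum_(j < k.+1)
    box v (S `&` cell k i) (T `&` cell k j).
  move=> kv; apply: (@box_sum R 'I_k.+1 v S T (fun i => cell k i)) => //.
    by move=> i; exact: measurable_cell.
  by move=> x Ix; exact: sum_cell.
rewrite (BS w kw) (BS u ku) -sumrB.
under eq_bigr do rewrite -sumrB.
apply: (@le_trans _ _ (\sum_(i < k.+1) \sum_(j < k.+1)
    ((up g i j - lo k g i j) / k%:R ^+ 2 + (eta + 2 * k%:R * Gamma w)))).
  apply: le_trans (ler_norm_sum _ _ _) _; apply: ler_sum => i _.
  apply: le_trans (ler_norm_sum _ _ _) _; apply: ler_sum => j _.
  by apply: block_close => //; rewrite -ltnS.
under eq_bigr do rewrite big_split/= -mulr_suml sumr_const card_ord.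
rewrite big_split/= -mulr_suml sumr_const card_ord.
apply: lerD.
  rewrite ler_pdivrMr ?exprn_gt0// expr2 mulrA divfK ?gt_eqF//.
  have := sum_up_lo k0 g01; rewrite big_mkord => h.
  apply: le_trans h; rewrite le_eqVlt; apply/orP; left; apply/eqP.
  by apply: eq_bigr => i _; rewrite big_mkord.
by rewrite -mulrnA -[leLHS]mulr_natl natrM expr2.
Qed.

Lemma density_le_right w k a b c : graphon w -> (0 < k)%N ->
  (a < b < c)%N -> (c < k)%N ->
  density k w a c <= density k w a b + k%:R ^+ 3 * Gamma w.
Proof.
move=> gw k0 /andP[ab bc] ck; have k0' : 0 < k%:R :> R by rewrite ltr0n.
have mc := @measurable_cell R k; have kw := graphon_kern gw.
have bk := ltn_trans bc ck; have ak := ltn_trans ab bk.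
have := Gamma_shift_right kw (mc a) (mc b) (mc c) (@cell_sub R k a ak)
  (@cell_sub R k b bk) (@cell_sub R k c ck) (@cell_before R k a b ab)
  (@cell_before R k b c bc).
rewrite !len_cell// /density => h.
have kk : k%:R * k%:R^-1 = 1 :> R by rewrite mulfV// gt_eqF.
have := ler_wpM2l (exprn_ge0 3 (ltW k0')) h; rewrite mulrDr !mulrA.
by rewrite [X in X / k%:R]exprSr mulfK// gt_eqF.
Qed.

Lemma density_le_left w k a b c : graphon w -> (0 < k)%N ->
  (a < b < c)%N -> (c < k)%N ->
  density k w a c <= density k w b c + k%:R ^+ 3 * Gamma w.
Proof.
move=> gw k0 /andP[ab bc] ck; have k0' : 0 < k%:R :> R by rewrite ltr0n.
have mc := @measurable_cell R k.
have bk := ltn_trans bc ck; have ak := ltn_trans ab bk.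
have := Gamma_shift_left gw (mc a) (mc b) (mc c) (@cell_sub R k a ak)
  (@cell_sub R k b bk) (@cell_sub R k c ck) (@cell_before R k a b ab)
  (@cell_before R k b c bc).
rewrite !len_cell// /density => h.
have := ler_wpM2l (exprn_ge0 3 (ltW k0')) h; rewrite mulrDr !mulrA.
by rewrite [X in X / k%:R]exprSr mulfK// gt_eqF.
Qed.

(** Both cells of the k-grid are moved inwards to cells of the l-grid, with one shift for each side.
    The coefficient of [Gamma w] depends on k and l only, so the error vanishes along the
    sequence. *)
Lemma density_refine w k l a' b' a b : graphon w -> (0 < k)%N -> (0 < l)%N ->
  (a' < k)%N -> (b' < k)%N -> (a < l)%N -> (b < l)%N ->
  before (@cell R k a') (cell l a) -> before (@cell R l a) (cell l b) ->
  before (@cell R l b) (cell k b') ->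
  density k w a' b' <= density l w a b +
    (k%:R ^+ 2 * l%:R + k%:R * l%:R ^+ 2) * Gamma w.
Proof.
move=> gw k0 l0 a'k b'k al bl h1 h2 h3.
have k0' : 0 < k%:R :> R by rewrite ltr0n.
have l0' : 0 < l%:R :> R by rewrite ltr0n.
have mk := @measurable_cell R k; have ml := @measurable_cell R l.
have Iam : cell l b (b%:R / l%:R : R).
  by rewrite /cell/= in_itv/= lexx/= ltr_pM2r ?invr_gt0// ltr_nat.
have h4 : before (@cell R l a) (cell k b').
  by move=> x y xa yb; apply: lt_trans (h2 _ _ xa Iam) (h3 _ _ Iam yb).
have := Gamma_shift_left gw (mk a') (ml a) (mk b') (cell_sub a'k) (cell_sub al)
  (cell_sub b'k) h1 h4.
have := Gamma_shift_right (graphon_kern gw) (ml a) (ml b) (mk b') (cell_sub al)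
  (cell_sub bl) (cell_sub b'k) h2 h3.
rewrite !len_cell// /density.
set X := box w _ (cell k b'); set Y := box w _ (cell l b); set Z := box w _ _ => e1 e2.
have e1' := ler_wpM2l (mulr_ge0 (ltW k0') (exprn_ge0 2 (ltW l0'))) e1.
have e2' := ler_wpM2l (mulr_ge0 (exprn_ge0 2 (ltW k0')) (ltW l0')) e2.
have E1 : k%:R * l%:R ^+ 2 * (l%:R^-1 * X) = k%:R * l%:R * X.
  by field; rewrite gt_eqF.
have E2 : k%:R * l%:R ^+ 2 * (k%:R^-1 * Y + Gamma w) =
    l%:R ^+ 2 * Y + k%:R * l%:R ^+ 2 * Gamma w.
  by field; rewrite gt_eqF.
have E3 : k%:R ^+ 2 * l%:R * (l%:R^-1 * Z) = k%:R ^+ 2 * Z.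
  by field; rewrite gt_eqF.
have E4 : k%:R ^+ 2 * l%:R * (k%:R^-1 * X + Gamma w) =
    k%:R * l%:R * X + k%:R ^+ 2 * l%:R * Gamma w.
  by field; rewrite gt_eqF.
move: e1' e2'; rewrite E1 E2 E3 E4 mulrDl; lra.
Qed.

End BlockApproximation.

(** * Ultralimits *)

Section RobinsonLimit.
Variable R : realType.
Local Notation RT := (measurableTypeR R).
Local Notation I01 := (@I01 R).
Local Notation Q := (I01 `*` I01).

Lemma sum_delta2 n (f : 'I_n -> 'I_n -> R) i0 j0 :
  \sum_(i < n) \sum_(j < n) f i j * ((i == i0)%:R * (j == j0)%:R) = f i0 j0.
Proof.
rewrite (bigD1 i0)//= (bigD1 j0)//= !eqxx mulr1 mulr1.
rewrite big1 ?addr0; last by move=> j /negbTE ->; rewrite !mulr0.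
rewrite big1 ?addr0// => i /negbTE ->; rewrite big1// => j _.
by rewrite mul0r mulr0.
Qed.

(** Compactness of [0,1] yields a cluster point, and an ultrafilter converges to each of its cluster
    points. *)
Lemma ultra_cvg (F : set_system nat) (x : nat -> R) : UltraFilter F ->
  (forall n, 0 <= x n <= 1) -> exists2 l : R, 0 <= l <= 1 & x @ F --> l.
Proof.
move=> FU x01.
have [|l [/= l01 cl]] := @segment_compact R 0 1 (x @ F) _.
  by apply: (@filterS _ F _ setT) filterT => n _ /=; rewrite in_itv/= x01.
exists l; first by move: l01; rewrite in_itv.
move=> A Al; have [//|FA] := in_ultra_setVsetC (x @^-1` A) FU.
have [y [/= ny Ay]] := cl (~` A) A FA Al.
by [].
Qed.

Variables (W : nat -> R -> R -> R) (F : set_system nat).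
Hypotheses (gW : forall n, graphon (W n)) (FU : UltraFilter F).
Hypothesis GW : (fun n => Gamma (W n)) @ F --> (0 : R).

(* Only cells contained in [0,1] carry a density. *)
Definition seq_density (k a b n : nat) : R :=
  if (a < k)%N && (b < k)%N then density k (W n) a b else 0.

Definition lim_density (k a b : nat) : R := lim (seq_density k a b @ F).

Lemma seq_density01 k a b n : 0 <= seq_density k a b n <= 1.
Proof.
rewrite /seq_density; case: ifP => [/andP[ak bk]|_]; last by rewrite lexx ler01.
by apply: density01 => //; lia.
Qed.

Lemma lim_density_cvg k a b : seq_density k a b @ F --> lim_density k a b.
Proof.
have [l _ xl] := ultra_cvg FU (seq_density01 k a b).
by rewrite /lim_density (cvg_lim _ xl).
Qed.

Lemma lim_density01 k : unit_valued (lim_density k).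
Proof.
move=> a b; have [l l01 xl] := ultra_cvg FU (seq_density01 k a b).
by rewrite /lim_density (cvg_lim _ xl).
Qed.

Lemma lim_density_le k a b l c d (e : R) :
  (forall n, seq_density k a b n <= seq_density l c d n + e * Gamma (W n)) ->
  lim_density k a b <= lim_density l c d.
Proof.
move=> h.
have c2 : (fun n => seq_density l c d n + e * Gamma (W n)) @ F -->
    lim_density l c d + e * 0.
  by apply: cvgD; [exact: lim_density_cvg|exact: cvgMl_tmp].
have := ler_cvg_to (@lim_density_cvg k a b) c2; rewrite mulr0 addr0; apply.
by apply: (@filterS _ F _ setT) filterT => n _; exact: h.
Qed.

Lemma lim_density_rmono k : rmono k (lim_density k).
Proof.
move=> a b c abc ck; have k0 : (0 < k)%N by lia.
have [ak bk] : (a < k)%N /\ (b < k)%N by lia.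
split; apply: (@lim_density_le _ _ _ _ _ _ (k%:R ^+ 3)) => n.
  by rewrite /seq_density ak bk ck/=; exact: density_le_right.
by rewrite /seq_density ak bk ck/=; exact: density_le_left.
Qed.

(** Whatever the two grid sizes, x separates the k-cell i - 1 from the l-cell a + 1, and y separates
    the l-cell b - 1 from the k-cell j + 1. So the pair of l-cells lies strictly inside the pair of
    k-cells, and [density_refine] applies before passing to the limit. *)
Lemma lo_le_up k l i j a b (x y : R) : (0 < k)%N -> (0 < l)%N -> x <= 1 -> y <= 1 ->
  cell k i x -> cell k j y -> cell l a x -> cell l b y ->
  lo k (lim_density k) i j <= up (lim_density l) a b.
Proof.
move=> k0 l0; wlog ij : i j a b x y / (i <= j)%N.
  move=> H x1 y1 xi yj xa yb; case: (leqP i j) => ij; first exact: (H i j a b x y).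
  by rewrite lo_sym up_sym; apply: (H j i b a y x) => //; exact: ltnW.
move=> x1 y1 xi yj xa yb.
have /andP[_ lo1] := lo01 k i j (lim_density01 k).
have /andP[up0 _] := up01 a b (lim_density01 l).
have [ab|ab] := ltnP a.+2 b; last first.
  have [ba|ba] := ltnP b.+2 a; last by rewrite /up ltnNge ab /= ltnNge ba.
  (* With the l-cells in the opposite order y < x; together with i <= j this forces i = j, where
     [lo] is 0. *)
  have yx : y < x by apply: (cell_lt yb xa); lia.
  have ji := cell_le yj xi (ltW yx).
  rewrite {1}/lo (_ : (0 < i < j)%N = false); last by apply/negbTE; lia.
  by rewrite (_ : (0 < j < i)%N = false)//; apply/negbTE; lia.
rewrite {1}/lo; case: ifP => [/andP[/andP[i0 ij'] jk]|_]; last first.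
  by rewrite (_ : (0 < j < i)%N = false)//; apply/negbTE; lia.
have bl := cell_bound l0 yb y1.
rewrite /up ab.
apply: (@lim_density_le _ _ _ _ _ _ (k%:R ^+ 2 * l%:R + k%:R * l%:R ^+ 2)) => n.
have [ik jk'] : (i.-1 < k)%N /\ (j.+1 < k)%N by lia.
have [al bl'] : (a.+1 < l)%N /\ (b.-1 < l)%N by lia.
rewrite /seq_density ik jk' al bl'/=.
apply: density_refine => //; try lia.
- move=> p q pi qa; apply: lt_trans (cell_lt pi xi _) (cell_lt xa qa _); lia.
- by apply: cell_before; lia.
- move=> p q pi qa; apply: lt_trans (cell_lt pi yb _) (cell_lt yj qa _); lia.
Qed.

Definition up_fun (l : nat) (x y : R) : R :=
  up (lim_density l.+1) (Num.truncn (l.+1%:R * x)) (Num.truncn (l.+1%:R * y)).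

(** The infimum over all grids, taken as [infs] at index 0 because measurability of countable infima
    is stated in that form. Each [up_fun] obeys the Robinson inequality everywhere, and an infimum
    preserves it. *)
Definition limit_graphon (x y : R) : R := infs (fun l => up_fun l x y) 0.

Lemma up_fun01 l x y : 0 <= up_fun l x y <= 1.
Proof. exact: up01 (@lim_density01 l.+1). Qed.

Lemma has_lbound_up_fun x y : has_lbound (range (fun l => up_fun l x y)).
Proof. by exists 0 => _ [l _ <-]; have /andP[] := up_fun01 l x y. Qed.

Lemma limit_graphonE x y : limit_graphon x y = inf (range (fun l => up_fun l x y)).
Proof.
rewrite /limit_graphon /infs /sdrop; congr inf.
by apply/seteqP; split => _ [l _ <-]; exists l.
Qed.

Lemma limit_graphon_le l x y : limit_graphon x y <= up_fun l x y.
Proof.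
rewrite limit_graphonE; apply: ge_inf; last by exists l.
exact: has_lbound_up_fun.
Qed.

Lemma limit_graphon_ge c x y : (forall l, c <= up_fun l x y) -> c <= limit_graphon x y.
Proof.
move=> h; rewrite limit_graphonE; apply: lb_le_inf.
  by exists (up_fun 0 x y), 0%N.
by move=> _ [l _ <-]; exact: h.
Qed.

Lemma limit_graphon01 x y : 0 <= limit_graphon x y <= 1.
Proof.
apply/andP; split.
  by apply: limit_graphon_ge => l; have /andP[] := up_fun01 l x y.
by apply: le_trans (limit_graphon_le 0 x y) _; have /andP[] := up_fun01 0 x y.
Qed.

Lemma measurable_up_fun l :
  measurable_fun (Q : set (RT * RT)) (fun p => up_fun l p.1 p.2).
Proof.
pose h (p : RT * RT) := \sum_(i < l.+2) \sum_(j < l.+2)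
  up (lim_density l.+1) i j * (\1_(cell l.+1 i) p.1 * \1_(cell l.+1 j) p.2).
have bh : bmf h.
  apply: bmf_sum => i; apply: bmf_sum => j; apply: bmfM; first exact: bmf_cst.
  by apply: bmf_rect; exact: measurable_cell.
apply: (eq_measurable_fun h); last by apply: measurable_funTS; case: bh.
move=> [x y] /set_mem[/= /I01P/andP[x0 x1] /I01P/andP[y0 y1]].
have xc := cell_trunc (ltn0Sn l) x0; have yc := cell_trunc (ltn0Sn l) y0.
have ix := cell_bound (ltn0Sn l) xc x1; have iy := cell_bound (ltn0Sn l) yc y1.
have E (z : RT) i : cell l.+1 i z -> forall j, \1_(cell l.+1 j) z = (j == i)%:R :> R.
  move=> zi j; rewrite indicE; congr (nat_of_bool _)%:R; apply/idP/eqP => [|->].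
    by move/set_mem => zj; exact: (cell_inj zj zi).
  exact/mem_set.
have Ex := E x _ xc; have Ey := E y _ yc.
transitivity (\sum_(i < l.+2) \sum_(j < l.+2) up (lim_density l.+1) i j *
    ((i == Ordinal ix)%:R * (j == Ordinal iy)%:R)).
  by apply: eq_bigr => i _; apply: eq_bigr => j _; congr (_ * (_ * _));
    [exact: Ex|exact: Ey].
exact: (sum_delta2 (fun i j : 'I_l.+2 => up (lim_density l.+1) i j)).
Qed.

Lemma limit_graphon_graphon : graphon limit_graphon.
Proof.
split.
- apply: (@measurable_fun_infs _ (RT * RT)%type R Q (fun l p => up_fun l p.1 p.2) 0).
    by move=> p _; exact: has_lbound_up_fun.
  exact: measurable_up_fun.
- move=> x y _ _; rewrite !limit_graphonE.
  have E : (fun l => up_fun l x y) = (fun l => up_fun l y x).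
    by apply/funext => l; exact: up_sym.
  exact: (congr1 (fun f => inf (range f)) E).
- by move=> x y _ _; exact: limit_graphon01.
Qed.

Lemma limit_graphon_Robinson : Robinson limit_graphon.
Proof.
move=> x y z x0 xy yz z1.
suff H l : up_fun l x z <= Num.min (up_fun l x y) (up_fun l y z).
  have minP (a b c : R) : a <= Num.min b c <-> a <= b /\ a <= c.
    by rewrite le_min; split => [/andP//|[-> ->]].
  apply/minP; split.
    apply: (@limit_graphon_ge (limit_graphon x z) x y) => l.
    exact: (le_trans (limit_graphon_le l x z) ((minP _ _ _).1 (H l)).1).
  apply: (@limit_graphon_ge (limit_graphon x z) y z) => l.
  exact: (le_trans (limit_graphon_le l x z) ((minP _ _ _).1 (H l)).2).
have y0 := le_trans x0 xy; have z0 := le_trans y0 yz.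
have xc := cell_trunc (ltn0Sn l) x0; have yc := cell_trunc (ltn0Sn l) y0.
have zc := cell_trunc (ltn0Sn l) z0.
apply: (@up_Robinson _ l.+1).
- exact: lim_density01.
- exact: lim_density_rmono.
- by rewrite (cell_le xc yc xy) (cell_le yc zc yz).
- by rewrite -ltnS; exact: (cell_bound _ zc z1).
Qed.

Lemma limit_graphon_between k i j (x y : R) : (0 < k)%N -> I01 x -> I01 y ->
  cell k i x -> cell k j y ->
  lo k (lim_density k) i j <= limit_graphon x y <= up (lim_density k) i j.
Proof.
case: k => // k _ /I01P/andP[x0 x1] /I01P/andP[y0 y1] xi yj; apply/andP; split.
  apply: limit_graphon_ge => l.
  by apply: (lo_le_up (ltn0Sn k) (ltn0Sn l) x1 y1 xi yj); exact: cell_trunc.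
apply: le_trans (limit_graphon_le k x y) _; rewrite /up_fun.
by rewrite (cell_inj xi (cell_trunc (ltn0Sn k) x0)) (cell_inj yj (cell_trunc (ltn0Sn k) y0)).
Qed.

Lemma limit_graphon_close (eps : R) : 0 < eps -> F [set n | forall S T : set RT,
  measurable S -> measurable T -> S `<=` I01 -> T `<=` I01 ->
  `|box (fun x y => W n x y - limit_graphon x y) S T| <= eps].
Proof.
move=> e0.
have [k k0 ke] : exists2 k, (0 < k)%N & 14 / k%:R <= eps / 2.
  exists (Num.truncn (28 / eps)).+1 => //.
  have /andP[_ h] : (Num.truncn (28 / eps))%:R <= 28 / eps < (Num.truncn (28 / eps)).+1%:R.
    by apply: truncn_itv; rewrite divr_ge0// ltW.
  rewrite ler_pdivrMr// mulrAC ler_pdivlMr//.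
  by move: h; rewrite ltr_pdivrMr// => h; lra.
have k0' : 0 < k%:R :> R by rewrite ltr0n.
(* Once the densities are within [eta] of their limits and [Gamma (W n)] is at most [eta], the
   second error term of [box_close] is at most [eta * c]. Since k is already fixed, this concerns
   finitely many densities. *)
pose c : R := k.+1%:R ^+ 2 * (1 + 2 * k%:R).
have c0 : 0 < c by rewrite mulr_gt0 ?exprn_gt0// addr_gt0// mulr_gt0.
pose eta : R := eps / 2 / c.
have eta0 : 0 < eta by rewrite !divr_gt0.
have h1 : F [set n | Gamma (W n) <= eta].
  move: GW => /cvgrPdist_le/(_ eta eta0); apply: filterS => n /=.
  by rewrite sub0r normrN; apply: le_trans; exact: ler_norm.
have h2 : F [set n | forall i j : 'I_k, `|density k (W n) i j - lim_density k i j| <= eta].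
  apply: filter_forall => i; apply: filter_forall => j.
  have /cvgrPdist_le/(_ eta eta0) := @lim_density_cvg k i j; apply: filterS => n /=.
  by rewrite /seq_density !ltn_ord/= distrC.
apply: filterS (filterI h1 h2) => n [/= G D] S T mS mT SI TI.
have := @box_close R (W n) limit_graphon (lim_density k) k eta S T (gW n)
  limit_graphon_graphon (@lim_density01 k) k0 (ltW eta0) _ _ mS mT SI TI.
move=> /(_ _ _)/le_trans; apply.
- by move=> i j ik jk; exact: (D (Ordinal ik) (Ordinal jk)).
- by move=> i j x y Ix Iy xi yj; exact: limit_graphon_between.
rewrite [leRHS](splitr eps); apply: lerD => //.
rewrite (_ : eps / 2 = k.+1%:R ^+ 2 * (eta + 2 * k%:R * eta)).
  by rewrite ler_wpM2l ?exprn_ge0// lerD2l ler_wpM2l// mulr_ge0// ltW.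
rewrite (_ : k.+1%:R ^+ 2 * _ = eta * c); last by rewrite /c; ring.
by rewrite /eta divfK// gt_eqF.
Qed.

End RobinsonLimit.

(** * Cut distance *)

Section CutDistance.
Variable R : realType.
Local Notation RT := (measurableTypeR R).
Local Notation mu := (@lebesgue_measure R).
Local Notation I01 := (@I01 R).
Local Notation Q := (I01 `*` I01).
Local Notation I1 := (@Iunit R).
Local Notation I2 := (@Isquare R).
Implicit Types (u v w : R -> R -> R) (phi psi : R -> R) (S T : set RT).

Definition pull u phi : R -> R -> R := fun x y => u (phi x) (phi y).

(** A cut norm bound spelled out over all pairs of sets, so that no supremum is handled while bounds
    are transported. *)
Definition cut_close u v (c : R) := forall S T, measurable S -> measurable T ->
  S `<=` I01 -> T `<=` I01 -> `|box (fun x y => u x y - v x y) S T| <= c.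

Lemma cut_close_sym u v c : graphon u -> graphon v -> cut_close u v c -> cut_close v u c.
Proof.
move=> gu gv uv S T mS mT SI TI; have := uv S T mS mT SI TI.
have [ku kv] := (graphon_kern gu, graphon_kern gv).
by rewrite (boxB ku kv mS mT SI TI) (boxB kv ku mS mT SI TI) distrC.
Qed.

Lemma cut_close_trans u v w c d : graphon u -> graphon v -> graphon w ->
  cut_close u v c -> cut_close v w d -> cut_close u w (c + d).
Proof.
move=> gu gv gw uv vw S T mS mT SI TI.
have := uv S T mS mT SI TI; have := vw S T mS mT SI TI.
have [[ku kv] kw] := (graphon_kern gu, graphon_kern gv, graphon_kern gw).
rewrite (boxB ku kv mS mT SI TI) (boxB kv kw mS mT SI TI) (boxB ku kw mS mT SI TI).
move=> h1 h2; apply: le_trans (ler_distD (box v S T) _ _) _.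
exact: lerD.
Qed.

Lemma mp_maps phi x : mp_bijection phi -> I01 x -> I01 (phi x).
Proof. by move=> [[h _ _] _ _]; exact: h. Qed.

Lemma graphon_pull u phi : graphon u -> mp_bijection phi -> graphon (pull u phi).
Proof.
move=> gu mphi; have [mu1 su u01] := gu; split.
- have [mpf _] := mp_mpi mphi.
  have bu := bmf_ext (graphon_kern gu).
  have := @bmf_comp _ _ _ _ _ (ext u) (fun p : RT * RT => (pf phi p.1, pf phi p.2)).
  case=> //.
    by apply: measurable_fun_pair; apply: measurableT_comp.
  move=> m _; apply: eq_measurable_fun (measurable_funTS m) => -[x y].
  move=> /set_mem[/= Ix Iy]; rewrite !pfE// extE//; exact: mp_maps.
- by move=> x y Ix Iy; apply: su; exact: mp_maps.
- by move=> x y Ix Iy; apply: u01; exact: mp_maps.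
Qed.

(** A box of the pullback is an integral of u - v at (phi x, phi y) against indicators in x and y;
    [cut_trade] bounds it without images of S and T under phi. *)
Lemma cut_close_pull u v phi c : graphon u -> graphon v -> mp_bijection phi ->
  cut_close u v c -> cut_close (pull u phi) (pull v phi) c.
Proof.
move=> gu gv mphi uv S T mS mT SI TI.
have kd := graphonB_kern gu gv; have mp := mp_mpi mphi.
have i01 (A : set RT) x : 0 <= (\1_A x : R) <= 1.
  by rewrite indicE; case: (x \in A); rewrite ?lexx ?ler01.
have := @cut_trade R _ c (pf phi) (pf phi) \1_S \1_T kd mp mp
  (bmf_indic mS) (bmf_indic mT) (i01 S) (i01 T) uv.
rewrite boxE//; congr (`|_| <= _); apply: I2_eq => -[x y] [/= Ix Iy].
rewrite /= (pfE _ Ix) (pfE _ Iy).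
by rewrite (extE _ (mp_maps mphi Ix) (mp_maps mphi Iy)) (extE _ Ix Iy).
Qed.

Lemma mp_comp phi psi : mp_bijection phi -> mp_bijection psi ->
  mp_bijection (phi \o psi).
Proof.
move=> mphi mpsi; have [bphi mphi' phimu] := mphi; have [bpsi mpsi' psimu] := mpsi.
have mI := @mI01 R; split.
- exact: set_bij_comp bpsi bphi.
- by apply: (measurable_comp mI) => // _ [x Ix <-]; exact: mp_maps.
- move=> A mA AI; rewrite -(phimu A)// -(psimu (I01 `&` phi @^-1` A)).
  + congr (mu _); apply/seteqP; split => x /= [Ix Ax].
      by split => //; split => //; exact: mp_maps.
    by case: Ax.
  + exact: mphi'.
  + exact: subIsetl.
Qed.

Lemma cut_dist_lt u w c : graphon u -> graphon w -> cut_dist u w < c ->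
  exists2 phi, mp_bijection phi & cut_close (pull u phi) w c.
Proof.
move=> gu gw; rewrite /cut_dist => /inf_lt[].
  exists (cut_norm (fun x y => u x y - w x y)), id => //; split.
  - by split => // x Ix; exists x.
  - exact: measurable_id.
  - by move=> A mA AI; congr (mu _); apply/setIidPr.
move=> _ [phi mphi <-] lt_c; exists phi => // S T mS mT SI TI.
apply: le_trans (ltW lt_c); apply: cut_norm_ub => //.
exact: (graphonB_kern (graphon_pull gu mphi) gw).
Qed.

Lemma cut_dist_eq0 u w : graphon u -> graphon w ->
  (forall c, 0 < c -> exists2 phi, mp_bijection phi & cut_close (pull u phi) w c) ->
  cut_dist u w = 0.
Proof.
move=> gu gw h.
have lb : lbound [set cut_norm (fun x y => u (phi x) (phi y) - w x y)
    | phi in @mp_bijection R] 0.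
  move=> _ [phi mphi <-]; apply: cut_norm_ge0.
  exact: (graphonB_kern (graphon_pull gu mphi) gw).
apply/eqP; rewrite eq_le; apply/andP; split; last first.
  apply: lb_le_inf => //; have [phi mphi _] := h 1 ltr01.
  by exists (cut_norm (fun x y => u (phi x) (phi y) - w x y)), phi.
apply/ler_addgt0Pr => c c0; rewrite add0r; have [phi mphi cl] := h c c0.
apply: le_trans (cut_norm_le cl).
by apply: ge_inf; [exists 0|exists phi].
Qed.

Lemma I1_eq_off1 (f g : RT -> R) : bmf f -> bmf g ->
  (forall x, I01 x -> x < 1 -> f x = g x) -> I1 f = I1 g.
Proof.
move=> bf bg fg.
have E (h : RT -> R) : bmf h -> I1 h = \int[mu]_(x in [set` `[0%R, 1%R[]) h x.
  move=> bh; rewrite /Iunit /Defs.I01 Rintegral_itv_bndo_bndc//.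
  apply: (@integrableS _ RT R mu I01) => //; first exact: mI01.
    by move=> x; rewrite /Defs.I01/= !in_itv/= => /andP[-> /ltW].
  exact: (@bmf_integrable R _ RT mu I01 (@mI01 R) (@muI01_fin R)).
rewrite !E//; apply: eq_Rintegral => x /set_mem; rewrite /= in_itv/= => /andP[x0 x1].
by apply: fg => //; apply/I01P; rewrite x0 ltW.
Qed.

(** The lines x = 1 and y = 1 are null. This absorbs the mismatch at 1 between the half-open cells
    and the last block, which is closed. *)
Lemma cut_close0_off1 u v : graphon u -> graphon v ->
  (forall x y, I01 x -> I01 y -> x < 1 -> y < 1 -> u x y = v x y) -> cut_close u v 0.
Proof.
move=> gu gv uv S T mS mT SI TI.
have kd := graphonB_kern gu gv; have bd := bmf_ext kd.
have bST := bmf_rect mS mT.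
have b1 := bmfM bd bST.
rewrite boxE// I2_fubini1// (_ : I1 _ = I1 (cst 0)); first by rewrite I1_cst normr0.
apply: I1_eq_off1; [exact: (I1_param b1)|exact: bmf_cst|move=> x Ix x1].
rewrite (_ : I1 _ = I1 (cst 0)); first by rewrite I1_cst.
apply: I1_eq_off1; [exact: (bmf_sec x b1)|exact: bmf_cst|move=> y Iy y1].
by rewrite extE// uv// subrr mul0r.
Qed.

(** The translated measure agrees with Lebesgue measure on the intervals []a, b]], and these
    determine it. *)
Lemma lebesgue_translation (c : R) (A : set RT) : measurable A ->
  mu ((fun x => x + c) @^-1` A) = mu A.
Proof.
move=> mA; have mc : measurable_fun setT (fun x : RT => x + c : RT).
  by apply: measurable_funD => //; exact: measurable_cst.
apply/esym; pose m := isMeasurableFun.Build _ _ _ _ _ mc.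
pose f : {mfun RT >-> RT} := MeasurableFun.Pack (MeasurableFun.Class m).
apply: (@lebesgue_measure_unique R (pushforward mu f)) => // X hX.
change (mu X = mu ((fun x : RT => x + c) @^-1` X)).
move: hX => /ocitvP[->|[[a b] /= ab ->]]; first by rewrite preimage_set0.
rewrite (_ : _ @^-1` _ = [set` `]a - c, b - c]]); last first.
  by apply/seteqP; split => x /=; rewrite !in_itv/= ltrBlDr lerBrDr.
rewrite !lebesgue_measure_itv/= !lte_fin ltrD2r ab -!EFinD.
by congr (_%:E); ring.
Qed.

End CutDistance.

(** * Step graphons and permutations of their blocks *)

Section StepGraphons.
Variable R : realType.
Local Notation RT := (measurableTypeR R).
Local Notation mu := (@lebesgue_measure R).
Local Notation I01 := (@I01 R).
Local Notation Q := (I01 `*` I01).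
Local Notation I1 := (@Iunit R).
Local Notation I2 := (@Isquare R).
Variable n : nat.
Implicit Types (i j : 'I_n) (M : 'I_n -> 'I_n -> R).

Lemma ord_gt0 i : 0 < n%:R :> R.
Proof. by rewrite ltr0n; case: i => i; case: n. Qed.

Lemma measurable_block i : measurable (block i : set RT).
Proof. exact: measurable_itv. Qed.

Lemma block_itv i (x : R) : block i x <->
  (i%:R / n%:R <= x) && (if (i.+1 < n)%N then x < i.+1%:R / n%:R else x <= i.+1%:R / n%:R).
Proof. by rewrite /block/= itv_boundlr /= /Order.le /=; case: ifP. Qed.

Lemma block_sub i : block i `<=` I01.
Proof.
move=> x /block_itv/andP[ix xi]; apply/I01P; have n0 := ord_gt0 i.
rewrite (le_trans _ ix) ?divr_ge0//=.
have : i.+1%:R / n%:R <= 1 :> R by rewrite ler_pdivrMr// mul1r ler_nat.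
by move: xi; case: ifP => _; lra.
Qed.

Lemma block_lt i j (x y : R) : (i < j)%N -> block i x -> block j y -> x < y.
Proof.
move=> ij /block_itv/andP[_]; rewrite (leq_ltn_trans ij)// => xi /block_itv/andP[jy _].
apply: lt_le_trans xi (le_trans _ jy).
by rewrite ler_wpM2r ?invr_ge0// ler_nat.
Qed.

Lemma block_inj i j (x : R) : block i x -> block j x -> i = j.
Proof.
move=> xi xj; apply/val_inj; case: (ltngtP i j) => // ij; have := ltxx x.
  by rewrite (block_lt ij xi xj).
by rewrite (block_lt ij xj xi).
Qed.

Lemma block_le i j (x y : R) : block i x -> block j y -> x <= y -> (i <= j)%N.
Proof.
move=> xi yj xy; case: (leqP i j) => // ji.
by have := block_lt ji yj xi; rewrite ltNge xy.
Qed.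

Lemma block_cell i (x : R) : x < 1 -> block i x <-> cell n i x.
Proof.
move=> x1; have n0 := ord_gt0 i; rewrite block_itv /cell/= in_itv/=.
case: ifP => // ni; split => /andP[ix xi]; rewrite ix/= 1?ltW//.
have : i.+1%:R = n%:R :> R by congr (_%:R); have := ltn_ord i; lia.
by move=> ->; rewrite divff ?gt_eqF.
Qed.

Lemma block_exists (x : R) : (0 < n)%N -> I01 x -> exists i, block i x.
Proof.
move=> n0 /I01P/andP[x0 x1]; have n0' : 0 < n%:R :> R by rewrite ltr0n.
have [x1'|x1'] := ltP x 1; last first.
  have nn : (n.-1 < n)%N by lia.
  exists (Ordinal nn); apply/block_itv => /=; rewrite ifF; last by apply/negbTE; lia.
  have -> : x = 1 by apply/eqP; rewrite eq_le x1.
  by rewrite ler_pdivrMr// mul1r ler_nat leq_pred/= ler_pdivlMr// mul1r ler_nat prednK.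
have xc := cell_trunc n0 x0.
have ik : (Num.truncn (n%:R * x) < n)%N.
  have /truncn_itv/andP[h _] : 0 <= n%:R * x by rewrite mulr_ge0// ltW.
  rewrite -(ltr_nat R); apply: le_lt_trans h _.
  by rewrite -[ltRHS]mulr1 ltr_pM2l.
by exists (Ordinal ik); apply/block_cell.
Qed.

Lemma len_block i : len (block i : set RT) = n%:R^-1.
Proof.
have n0 := ord_gt0 i.
rewrite /len /block lebesgue_measure_itv/= lte_fin ltr_pM2r ?invr_gt0//.
rewrite ltr_nat ltnSn /=.
by rewrite -mulrBl -natrB ?subSnn ?mul1r.
Qed.

Lemma indic_block i j (x : R) : block i x -> \1_(block j) x = (j == i)%:R :> R.
Proof.
move=> xi; rewrite indicE; congr (nat_of_bool _)%:R; apply/idP/eqP => [|->].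
  by move/set_mem => xj; exact: (block_inj xj xi).
exact/mem_set.
Qed.

(** Real entries, so that the graphon of a graph and the Robinson model compared with it are step
    functions on the same blocks. *)
Definition stepf M (x y : R) : R :=
  \sum_(i < n) \sum_(j < n) M i j * (\1_(block i) x * \1_(block j) y).

Lemma stepfE M i j x y : block i x -> block j y -> stepf M x y = M i j.
Proof.
move=> xi yj; rewrite -(sum_delta2 M i j).
apply: eq_bigr => i' _; apply: eq_bigr => j' _; congr (_ * (_ * _)).
  exact: indic_block.
exact: indic_block.
Qed.

Lemma stepf_graphon M : (0 < n)%N -> (forall i j, M i j = M j i) ->
  (forall i j, 0 <= M i j <= 1) -> graphon (stepf M).
Proof.
move=> n0 Ms M01; split.
- have bm : bmf (fun p : RT * RT => stepf M p.1 p.2).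
    apply: bmf_sum => i; apply: bmf_sum => j; apply: bmfM; first exact: bmf_cst.
    by apply: bmf_rect; exact: measurable_block.
  by apply: measurable_funTS; case: bm.
- move=> x y Ix Iy; have [i xi] := block_exists n0 Ix.
  by have [j yj] := block_exists n0 Iy; rewrite (stepfE _ xi yj) (stepfE _ yj xi).
- move=> x y Ix Iy; have [i xi] := block_exists n0 Ix.
  by have [j yj] := block_exists n0 Iy; rewrite (stepfE _ xi yj).
Qed.

Lemma stepf_Robinson M : (0 < n)%N ->
  (forall i j k : 'I_n, (i <= j <= k)%N -> M i k <= Num.min (M i j) (M j k)) ->
  Robinson (stepf M).
Proof.
move=> n0 MR x y z x0 xy yz z1.
have y0 := le_trans x0 xy; have z0 := le_trans y0 yz.
have y1 := le_trans yz z1; have x1 := le_trans xy y1.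
have [i xi] := @block_exists x n0 ltac:(by apply/I01P/andP).
have [j yj] := @block_exists y n0 ltac:(by apply/I01P/andP).
have [k zk] := @block_exists z n0 ltac:(by apply/I01P/andP).
rewrite (stepfE _ xi zk) (stepfE _ xi yj) (stepfE _ yj zk); apply: MR.
by rewrite (block_le xi yj xy) (block_le yj zk yz).
Qed.

Lemma graphon_of_mx_stepf (H : 'M[bool]_n) :
  graphon_of_mx H = stepf (fun i j => (H i j)%:R) :> (R -> R -> R).
Proof.
apply/funext => x; apply/funext => y; apply: eq_bigr => i _.
by apply: eq_bigr => j _; rewrite mulrA.
Qed.

Lemma box_stepf M S T : measurable S -> measurable T -> S `<=` I01 -> T `<=` I01 ->
  (0 < n)%N -> (forall i j, M i j = M j i) -> (forall i j, 0 <= M i j <= 1) ->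
  box (stepf M) S T =
  \sum_(i < n) \sum_(j < n) M i j * (len (S `&` block i) * len (T `&` block j)).
Proof.
move=> mS mT SI TI n0 Ms M01; have gM := stepf_graphon n0 Ms M01.
have kM := graphon_kern gM.
rewrite (@box_sum R _ _ S T (fun i => block i) kM)//; last first.
- move=> x Ix; have [i xi] := block_exists n0 Ix.
  rewrite (bigD1 i)//= (indic_block _ xi) eqxx big1 ?addr0// => j /negbTE ji.
  by rewrite (indic_block _ xi) ji.
- by move=> i; exact: measurable_block.
apply: eq_bigr => i _; apply: eq_bigr => j _.
have mSi : measurable (S `&` block i) by apply: measurableI => //; exact: measurable_block.
have mTj : measurable (T `&` block j) by apply: measurableI => //; exact: measurable_block.
apply/eqP; rewrite eq_le; apply/andP.
have := @box_between R (stepf M) (S `&` block i) (T `&` block j) (M i j) (M i j) kM mSi mTj.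
move=> H; apply/andP; rewrite andbC; apply: H.
- by move=> x [/SI].
- by move=> x [/TI].
- by move=> x y [_ xi] [_ yj]; rewrite (stepfE _ xi yj) lexx.
Qed.

Section Permutation.
Variables (f g : 'I_n -> 'I_n).
Hypotheses (fK : cancel f g) (gK : cancel g f) (n0 : (0 < n)%N).
Let n0' : 0 < n%:R :> R. Proof. by rewrite ltr0n. Qed.

(* The cells are half-open, so that 1 is a fixed point. *)
Definition block_perm (x : R) : R :=
  x + \sum_(i < n) ((f i)%:R - i%:R) / n%:R * \1_(cell n i) x.

Lemma block_permE i x : cell n i x -> block_perm x = x + ((f i)%:R - i%:R) / n%:R.
Proof.
move=> xi; rewrite /block_perm; congr (_ + _).
have E (j : 'I_n) : \1_(cell n j) x = (j == i)%:R :> R.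
  rewrite indicE; congr (nat_of_bool _)%:R; apply/idP/eqP => [|->].
    by move/set_mem => xj; apply/val_inj; exact: (cell_inj xj xi).
  exact/mem_set.
rewrite (bigD1 i)//= E eqxx mulr1 big1 ?addr0// => j /negbTE ji.
by rewrite E ji mulr0.
Qed.

Lemma shift_cell (i j : 'I_n) (x : R) :
  cell n i x <-> cell n j (x + (j%:R - i%:R) / n%:R).
Proof.
rewrite /cell/= !in_itv/= mulrBl -!natr1 !mulrDl mul1r.
by split => /andP[h1 h2]; apply/andP; split; lra.
Qed.

Lemma block_perm_cell i x : cell n i x -> cell n (f i) (block_perm x).
Proof. by move=> xi; rewrite (block_permE xi); exact: (shift_cell i (f i) x).1. Qed.

Lemma cell_cases (x : R) : I01 x -> (exists i : 'I_n, cell n i x) \/ x = 1.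
Proof.
move=> Ix; have [i xi] := block_exists n0 Ix.
move/I01P: Ix => /andP[x0]; rewrite le_eqVlt => /orP[/eqP->|x1]; first by right.
by left; exists i; apply/block_cell.
Qed.

Lemma cell_not1 i : ~ cell n i (1 : R).
Proof.
rewrite /cell/= in_itv/= => /andP[_]; rewrite ltr_pdivlMr// mul1r ltr_nat.
by rewrite ltnNge ltn_ord.
Qed.

Lemma block_perm1 : block_perm 1 = 1.
Proof.
rewrite /block_perm big1 ?addr0// => i _; rewrite indicE memNset ?mulr0//.
exact: cell_not1.
Qed.

Lemma cell_I01 i : @cell R n i `<=` I01.
Proof. by apply: cell_sub; exact: ltn_ord. Qed.

Lemma measurable_block_perm : measurable_fun setT (block_perm : RT -> RT).
Proof.
apply: measurable_funD => //.
have bs : bmf (fun x : RT => \sum_(i < n) ((f i)%:R - i%:R) / n%:R * \1_(cell n i) x : R).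
  apply: bmf_sum => i; apply: bmfM; first exact: bmf_cst.
  by apply: bmf_indic; exact: measurable_cell.
by case: bs.
Qed.

Lemma block_perm_bij : set_bij I01 I01 block_perm.
Proof.
split.
- move=> x /cell_cases[[i xi]|->]; last by rewrite block_perm1; apply/I01P; rewrite ler01 lexx.
  exact: cell_I01 (block_perm_cell xi).
- move=> x y /set_mem/cell_cases[[i xi]|->] /set_mem/cell_cases[[j yj]|->] //.
  + move=> E; have ci := block_perm_cell xi; have cj := block_perm_cell yj.
    rewrite E in ci; have fij : f i = f j by apply/val_inj; exact: (cell_inj ci cj).
    have ij : i = j by rewrite -(fK i) fij fK.
    by move: E; rewrite (block_permE xi) (block_permE yj) ij => /addIr.
  + by rewrite block_perm1 => E; have := block_perm_cell xi; rewrite E => /cell_not1.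
  + by rewrite block_perm1 => E; have := block_perm_cell yj; rewrite -E => /cell_not1.
- move=> y Iy; have [[j yj]|->] := cell_cases Iy; last first.
    by exists 1; [apply/I01P; rewrite ler01 lexx|exact: block_perm1].
  have xc : cell n (g j) (y + ((g j)%:R - j%:R) / n%:R) by exact: (shift_cell j (g j) y).1.
  exists (y + ((g j)%:R - j%:R) / n%:R); first exact: cell_I01 xc.
  by rewrite (block_permE xc) gK -addrA -mulrDl addrC [X in X / _]addrC subrKA subrr mul0r add0r.
Qed.

Lemma len_cells (B : set RT) : measurable B -> B `<=` I01 ->
  len B = \sum_(i < n) len (B `&` cell n i).
Proof.
move=> mB BI; have mBi (i : nat) : measurable (B `&` cell n i).
  by apply: measurableI => //; exact: measurable_cell.
have bi (i : nat) : bmf (\1_(B `&` cell n i) : RT -> R) by exact: bmf_indic.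
rewrite -I1_indic// (_ : I1 _ = I1 (fun x => \sum_(i < n) \1_(B `&` cell n i) x)).
  rewrite I1_sum; last by move=> i; exact: bi.
  by apply: eq_bigr => i _; rewrite I1_indic// => x [/BI].
apply: I1_eq_off1; [exact: bmf_indic|by apply: bmf_sum => i; exact: bi|move=> x Ix x1].
have [[i xi]|xE] := cell_cases Ix; last by move: x1; rewrite xE ltxx.
under eq_bigr do rewrite indicI/=.
rewrite -mulr_sumr (bigD1 i)//= [X in _ * (X + _)]indicE mem_set//= big1 ?addr0 ?mulr1// => j ji.
rewrite indicE memNset// => xj; move/eqP: ji; apply; apply/val_inj.
exact: (cell_inj xj xi).
Qed.

(** On each cell the map is a translation, so the preimage is measured cell by cell and the pieces
    are summed again after reindexing by [f]. *)
Lemma block_perm_mp : mp_bijection block_perm.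
Proof.
split; first exact: block_perm_bij.
  exact: measurable_funTS measurable_block_perm.
move=> A mA AI.
have mP : measurable (I01 `&` block_perm @^-1` A).
  have := measurable_block_perm measurableT mA; rewrite setTI => m.
  by apply: measurableI => //; exact: mI01.
rewrite -(fineK (mu_fin_num mP (@subIsetl _ _ _))) -(fineK (mu_fin_num mA AI)).
congr (_%:E); rewrite -/(len _) -/(len A) (len_cells mP)//.
rewrite (len_cells mA AI) [RHS](reindex f) /=; last first.
  by exists g => i _; rewrite ?fK ?gK.
apply: eq_bigr => i _; rewrite /len.
have mAi : measurable (A `&` cell n (f i)).
  by apply: measurableI => //; exact: measurable_cell.
rewrite -(lebesgue_translation (((f i)%:R - i%:R) / n%:R) mAi).
congr (fine (mu _)); apply/seteqP; split => x /=.
  by move=> [[Ix Ax] xi]; rewrite -(block_permE xi); split => //; exact: block_perm_cell.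
move=> [Ax xi]; have xi' : cell n i x by exact: (shift_cell i (f i) x).2.
by rewrite -(block_permE xi') in Ax; split => //; split => //; exact: cell_I01 xi'.
Qed.

End Permutation.

End StepGraphons.

(** * Random rounding *)

Section Rounding.
Variables (R : realType) (n K : nat).
Implicit Types (q lam : 'I_n -> 'I_K -> R) (E : 'I_K -> 'I_K -> R).
Implicit Types c : {ffun 'I_n -> 'I_K}.

(** The probability of [c] when the values c i are drawn independently with laws [q i]. *)
Definition weight q c : R := \prod_i q i (c i).

(** Independence: the expectation of a product of functions of separate coordinates factors, which
    is distributivity of products over sums. *)
Lemma sum_weight q (r : 'I_n -> 'I_K -> R) :
  \sum_c weight q c * \prod_i r i (c i) = \prod_i \sum_a q i a * r i a.
Proof.
rewrite bigA_distr_bigA; apply: eq_bigr => c _.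
by rewrite /weight -big_split.
Qed.

Lemma weight_total q : (forall i, \sum_a q i a = 1) -> \sum_c weight q c = 1.
Proof.
move=> q1; transitivity (\sum_c weight q c * \prod_(i < n) 1).
  by apply: eq_bigr => c _; rewrite big1 ?mulr1.
rewrite (sum_weight q (fun _ _ => 1)) big1// => i _.
by under eq_bigr do rewrite mulr1.
Qed.

Lemma weight_pair q E i j : (forall i, \sum_a q i a = 1) -> i != j ->
  \sum_c weight q c * E (c i) (c j) = \sum_a \sum_b E a b * (q i a * q j b).
Proof.
move=> q1 ij; have ji : (j == i) = false by rewrite eq_sym (negbTE ij).
(* The indicator of the event c i = a and c j = b, written as a product over all coordinates so that
   [sum_weight] computes its probability. *)
pose r (a b : 'I_K) (l : 'I_n) (x : 'I_K) : R := if l == i then (x == a)%:R else if l == j then (x == b)%:R else 1.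
have rE a b c : \prod_l r a b l (c l) = (c i == a)%:R * (c j == b)%:R.
  rewrite (bigD1 i)//= (bigD1 j) ?ji//= /r eqxx ji eqxx.
  rewrite big1 ?mulr1// => l /andP[/negbTE -> /negbTE ->] //.
have rq a b : \prod_l (\sum_x q l x * r a b l x) = q i a * q j b.
  have D (l : 'I_n) (x : 'I_K) : \sum_y q l y * (y == x)%:R = q l x.
    rewrite (bigD1 x)//= eqxx mulr1 big1 ?addr0// => y /negbTE ->.
    by rewrite mulr0.
  rewrite (bigD1 i)//= (bigD1 j) ?ji//= /r eqxx ji eqxx !D.
  rewrite big1 ?mulr1// => l /andP[/negbTE -> /negbTE ->].
  by under eq_bigr do rewrite mulr1.
transitivity (\sum_c \sum_a \sum_b E a b * (weight q c * \prod_l r a b l (c l))).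
  apply: eq_bigr => c _; rewrite (bigD1 (c i))//= (bigD1 (c j))//= rE !eqxx !mulr1.
  rewrite big1 ?addr0; last by move=> b; rewrite eq_sym rE => /negbTE ->; rewrite !mulr0.
  rewrite big1 ?addr0 1?mulrC// => a; rewrite eq_sym => /negbTE ca.
  by rewrite big1// => b _; rewrite rE ca mul0r !mulr0.
rewrite exchange_big; apply: eq_bigr => a _; rewrite exchange_big; apply: eq_bigr => b _.
by rewrite -mulr_sumr (sum_weight q (r a b)) rq.
Qed.

(** Some outcome does not exceed the mean. Its positive weight is recorded because it certifies that
    every c i lies in the support of [q i]. *)
Lemma weight_average q (F : {ffun 'I_n -> 'I_K} -> R) (B : R) :
  (forall i a, 0 <= q i a) -> (forall i, \sum_a q i a = 1) ->
  \sum_c weight q c * F c <= B -> exists2 c, 0 < weight q c & F c <= B.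
Proof.
move=> q0 q1 FB; apply: contrapT => nc.
have w0 c : 0 <= weight q c by apply: prodr_ge0.
have F_gt c : 0 < weight q c -> B < F c.
  by move=> wc; rewrite ltNge; apply/negP => Fc; apply: nc; exists c.
have [c wc] : exists c, 0 < weight q c.
  apply: contrapT => nw; have := weight_total q1; rewrite big1.
    by move/eqP; rewrite eq_sym oner_eq0.
  move=> c _; apply/eqP; rewrite eq_le w0 andbT leNgt; apply/negP => wc.
  by apply: nw; exists c.
suff : B < \sum_c weight q c * F c by rewrite ltNge FB.
rewrite -[ltLHS]mul1r -(weight_total q1) mulr_suml.
rewrite (bigD1 c)//= [ltRHS](bigD1 c)//=; apply: ltr_leD.
  by rewrite ltr_pM2l// F_gt.
apply: ler_sum => c' _; have := w0 c'; rewrite le_eqVlt => /orP[/eqP <-|wc'].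
  by rewrite !mul0r.
by rewrite ler_pM2l// ltW// F_gt.
Qed.

(* Independent rounding: [i] is sent to [a] with probability proportional to
   [lam i a], small values of [lam] being discarded. *)
Lemma rounding lam E : (0 < n)%N -> (forall i a, 0 <= lam i a) ->
  (forall i, \sum_a lam i a = n%:R^-1) -> (forall a b, 0 <= E a b <= 1) ->
  exists c : {ffun 'I_n -> 'I_K},
    (forall i, (2 * K%:R * n%:R)^-1 <= lam i (c i)) /\
    (\sum_i \sum_j E (c i) (c j)) / n%:R ^+ 2 <=
    n%:R^-1 + 4 * \sum_a \sum_b E a b * ((\sum_i lam i a) * (\sum_j lam j b)).
Proof.
move=> n0 lam0 lam1 E01; have n0' : 0 < n%:R :> R by rewrite ltr0n.
have K0 : (0 < K)%N.
  rewrite lt0n; apply/eqP => K0; have := lam1 (Ordinal n0).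
  rewrite big1 => [/esym/eqP|a _]; first by rewrite invr_eq0 gt_eqF.
  by exfalso; case: a => a; rewrite K0.
have K0' : 0 < K%:R :> R by rewrite ltr0n.
(* At most K values are discarded, so a vertex loses at most K [th] = 1/(2n), half of its mass 1/n.
   Renormalising what is left therefore at most doubles it, which is [q_le]. *)
set th : R := (2 * K%:R * n%:R)^-1.
have th0 : 0 < th by rewrite invr_gt0 !mulr_gt0.
pose t i a := if th <= lam i a then lam i a else 0.
have t0 i a : 0 <= t i a by rewrite /t; case: ifP.
pose Z i := \sum_a t i a.
have Z_ge i : (2 * n%:R)^-1 <= Z i.
  have : \sum_a lam i a <= \sum_a (t i a + th).
    by apply: ler_sum => a _; rewrite /t; case: ifP => [_|/negbT];
      [rewrite lerDl ltW|rewrite -ltNge add0r => /ltW].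
  rewrite big_split/= sumr_const card_ord lam1 -/(Z i) -[th *+ K]mulr_natr => h.
  have e : th * K%:R = (2 * n%:R)^-1.
    by rewrite /th; field; rewrite !gt_eqF.
  have e2 : n%:R^-1 = (2 * n%:R)^-1 + (2 * n%:R)^-1 :> R by field; rewrite gt_eqF.
  by move: h; rewrite e e2; lra.
have i2n : 0 < (2 * n%:R)^-1 :> R by rewrite invr_gt0 mulr_gt0.
have Z0 i : 0 < Z i by exact: lt_le_trans (Z_ge i).
pose q i a := t i a / Z i.
have q0 i a : 0 <= q i a by rewrite /q divr_ge0// ltW// Z0.
have q1 i : \sum_a q i a = 1 by rewrite /q -mulr_suml -/(Z i) divff// gt_eqF// Z0.
have q_le i a : q i a <= 2 * n%:R * lam i a.
  rewrite /q mulrC; apply: ler_pM => //; first by rewrite invr_ge0 ltW// Z0.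
    by rewrite -[leRHS]invrK lef_pV2// posrE// Z0.
  by rewrite /t; case: ifP.
have E0 a b : 0 <= E a b by have /andP[] := E01 a b.
(* Each of the n terms with j = i is bounded by 1. For the others the joint law is a product and
   [q_le], used twice, gives 4 n^2; the absent diagonal terms are then added back to complete the
   double sum. *)
pose B : R := n%:R + 4 * n%:R ^+ 2 *
  \sum_a \sum_b E a b * ((\sum_i lam i a) * (\sum_j lam j b)).
have [|c wc FB] := @weight_average q (fun c => \sum_i \sum_j E (c i) (c j)) B q0 q1.
  under eq_bigr do rewrite mulr_sumr.
  rewrite exchange_big /=.
  have bnd i : \sum_c weight q c * (\sum_j E (c i) (c j)) <=
      1 + 4 * n%:R ^+ 2 * \sum_j \sum_a \sum_b E a b * (lam i a * lam j b).
    under eq_bigr do rewrite mulr_sumr.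
    rewrite exchange_big /= (bigD1 i)//=; apply: lerD.
      rewrite -(weight_total q1); apply: ler_sum => c _.
      rewrite -[leRHS]mulr1 ler_wpM2l ?prodr_ge0//.
      by have /andP[] := E01 (c i) (c i).
    rewrite mulr_sumr [leRHS](bigD1 i)//= -[leLHS]add0r; apply: lerD.
      rewrite !mulr_ge0 ?exprn_ge0//; apply: sumr_ge0 => a _; apply: sumr_ge0 => b _.
      by rewrite !mulr_ge0.
    apply: ler_sum => j ji; rewrite weight_pair// 1?eq_sym//.
    rewrite mulr_sumr; apply: ler_sum => a _; rewrite mulr_sumr; apply: ler_sum => b _.
    rewrite [X in _ <= X]mulrCA ler_wpM2l//.
    rewrite (_ : 4 * n%:R ^+ 2 * _ = (2 * n%:R * lam i a) * (2 * n%:R * lam j b)); last by ring.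
    by apply: ler_pM.
  apply: le_trans (ler_sum _ (fun i _ => bnd i)) _.
  rewrite big_split/= sumr_const card_ord /B lerD2l -mulr_sumr ler_wpM2l ?mulr_ge0 ?exprn_ge0//.
  rewrite le_eqVlt; apply/orP; left; apply/eqP.
  under eq_bigr do rewrite exchange_big /=.
  rewrite exchange_big /=; apply: eq_bigr => a _.
  under eq_bigr do rewrite exchange_big /=.
  rewrite exchange_big /=; apply: eq_bigr => b _.
  under eq_bigr do rewrite -mulr_sumr -mulr_sumr.
  by rewrite -mulr_sumr -mulr_suml.
exists c; split.
  (* An outcome of positive weight takes only values that were not discarded. *)
  move=> i; have : q i (c i) != 0.
    apply/eqP => qi; move: wc; rewrite /weight (bigD1 i)//= qi mul0r ltxx.
    by [].
  by rewrite /q /t; case: ifP => //; rewrite mul0r eqxx.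
rewrite ler_pdivrMr ?exprn_gt0//; apply: le_trans FB _.
rewrite le_eqVlt; apply/orP; left; apply/eqP; rewrite /B.
by set s := \sum_(a < K) _; field; rewrite gt_eqF.
Qed.

End Rounding.

(** * From an overlay with a Robinson graphon to a labeling *)

Section Labeling.
Variable R : realType.
Local Notation RT := (measurableTypeR R).
Local Notation mu := (@lebesgue_measure R).
Local Notation I01 := (@I01 R).
Local Notation I1 := (@Iunit R).
Local Notation I2 := (@Isquare R).
Implicit Types (u v w : R -> R -> R) (phi psi : R -> R) (S T : set RT).

(** Point values at the nodes a/k, with a = k included: the Robinson inequalities hold at every
    point, so averages can be avoided. The default 0 keeps the array unit valued on all of nat. *)
Definition grid_val (k : nat) u (a b : nat) : R :=
  if (a <= k)%N && (b <= k)%N then u (a%:R / k%:R) (b%:R / k%:R) else 0.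

Lemma grid_I01 k a : (0 < k)%N -> (a <= k)%N -> I01 (a%:R / k%:R).
Proof.
move=> k0 ak; apply/I01P; rewrite divr_ge0//= ler_pdivrMr ?ltr0n//.
by rewrite mul1r ler_nat.
Qed.

Lemma grid_val01 k u : (0 < k)%N -> graphon u -> unit_valued (grid_val k u).
Proof.
move=> k0 [_ _ u01] a b; rewrite /grid_val; case: ifP => [/andP[ak bk]|_].
  by apply: u01; exact: grid_I01.
by rewrite lexx ler01.
Qed.

Lemma minP (a b c : R) : a <= Num.min b c -> a <= b /\ a <= c.
Proof. by rewrite le_min => /andP. Qed.

Lemma Robinson_shrink u x x' y' y : Robinson u ->
  0 <= x -> x <= x' -> x' <= y' -> y' <= y -> y <= 1 -> u x y <= u x' y'.
Proof.
move=> Ru x0 xx xy yy y1.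
have [h1 _] := minP (Ru x y' y x0 (le_trans xx xy) yy y1).
have [_ h2] := minP (Ru x x' y' x0 xx xy (le_trans yy y1)).
exact: le_trans h1 h2.
Qed.

Lemma grid_rmono k u : (0 < k)%N -> Robinson u -> rmono k (grid_val k u).
Proof.
move=> k0 Ru a b c /andP[ab bc] ck.
have k0' : 0 < k%:R :> R by rewrite ltr0n.
have ck' := ltnW ck; have bk := leq_trans (ltnW bc) ck'; have ak := leq_trans (ltnW ab) bk.
rewrite /grid_val ak bk ck'/=.
have /I01P/andP[a0 _] := grid_I01 k0 ak; have /I01P/andP[_ c1] := grid_I01 k0 ck'.
have m (i j : nat) : (i <= j)%N -> i%:R / k%:R <= j%:R / k%:R :> R.
  by move=> ij; rewrite ler_wpM2r ?invr_ge0 ?ler_nat// ltW.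
by split; apply: (Robinson_shrink Ru) => //; apply: m; exact: ltnW.
Qed.

(** For a Robinson graphon the value at x <= y decreases as the interval [x, y] grows, and for
    separated cells this interval lies between [(i+1)/k, (j-1)/k] and [(i-1)/k, (j+1)/k]. *)
Lemma grid_between k u i j x y : (0 < k)%N -> graphon u -> Robinson u ->
  I01 x -> I01 y -> cell k i x -> cell k j y ->
  lo k (grid_val k u) i j <= u x y <= up (grid_val k u) i j.
Proof.
move=> k0 gu Ru; have k0' : 0 < k%:R :> R by rewrite ltr0n.
wlog ij : i j x y / (i <= j)%N.
  move=> H Ix Iy xi yj; case: (leqP i j) => ij; first exact: H.
  have [_ su _] := gu; rewrite su// lo_sym up_sym.
  by apply: H => //; exact: ltnW.
move=> Ix Iy xi yj; have [_ _ u01] := gu; have /andP[u0 u1] := u01 x y Ix Iy.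
have /I01P/andP[x0 x1] := Ix; have /I01P/andP[y0 y1] := Iy.
have jk := cell_bound k0 yj y1; rewrite ltnS in jk.
have m (a b : nat) : (a <= b)%N -> a%:R / k%:R <= b%:R / k%:R :> R.
  by move=> ab; rewrite ler_wpM2r ?invr_ge0 ?ler_nat// ltW.
have /andP[ix xi'] : i%:R / k%:R <= x < i.+1%:R / k%:R by move: xi; rewrite /cell/= in_itv.
have /andP[jy yj'] : j%:R / k%:R <= y < j.+1%:R / k%:R by move: yj; rewrite /cell/= in_itv.
apply/andP; split.
  rewrite lo_le//; case: ifP => // /andP[/andP[i0 ij'] jk'].
  have i1k : (i.-1 <= k)%N by apply: leq_trans (leq_pred i) (leq_trans ij _).
  rewrite /grid_val i1k (ltnW jk')/=.
  apply: (Robinson_shrink Ru).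
  - by have /I01P/andP[] := grid_I01 k0 i1k.
  - by apply: le_trans ix; apply: m; exact: leq_pred.
  - exact: ltW (cell_lt xi yj ij').
  - exact: ltW.
  - by have /I01P/andP[] := grid_I01 k0 (ltnW jk').
rewrite up_le//; case: ltnP => // ij'.
have j1 : (j.-1 <= j)%N by exact: leq_pred.
have ij1 : (i.+1 <= j.-1)%N by rewrite -ltnS prednK ?(ltn_trans _ ij')// ltnW.
have i1k : (i.+1 <= k)%N by apply: leq_trans ij1 (leq_trans j1 _).
rewrite /grid_val i1k (leq_trans j1)//=.
apply: (Robinson_shrink Ru) => //.
- exact: ltW.
- exact: m.
- by apply: le_trans jy; exact: m.
Qed.

Lemma mp_pre phi S : mp_bijection phi -> measurable S -> S `<=` I01 ->
  measurable (I01 `&` pf phi @^-1` S) /\ len (I01 `&` pf phi @^-1` S) = len S.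
Proof.
move=> [bphi mphi phimu] mS SI; split.
  have := measurable_pf mphi measurableT mS; rewrite setTI => m.
  by apply: measurableI => //; exact: mI01.
rewrite /len -(phimu S)//; congr (fine (mu _)).
by apply/seteqP; split => x /= [Ix]; rewrite pfE.
Qed.

Lemma len_partition (I : finType) (Y : set RT) (B : I -> set RT) :
  measurable Y -> Y `<=` I01 -> (forall i, measurable (Y `&` B i)) ->
  (forall x, I01 x -> \sum_i \1_(B i) x = 1 :> R) ->
  \sum_i len (Y `&` B i) = len Y.
Proof.
move=> mY YI mB B1; have bi i : bmf (\1_(Y `&` B i) : RT -> R) by exact: bmf_indic.
transitivity (I1 (fun x => \sum_i \1_(Y `&` B i) x)).
  rewrite I1_sum//; apply: eq_bigr => i _; rewrite I1_indic// => x [/YI].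
  by [].
rewrite -I1_indic//; apply: I1_eq => x Ix; under eq_bigr do rewrite indicI/=.
by rewrite -mulr_sumr B1// mulr1.
Qed.

Lemma disjoint_sum01 n (X : 'I_n -> set RT) (al : 'I_n -> R) x :
  (forall i, 0 <= al i <= 1) -> (forall i j x, X i x -> X j x -> i = j) ->
  0 <= \sum_i al i * \1_(X i) x <= 1.
Proof.
move=> al01 Xd; case: (pselect (exists i, X i x)) => [[i Xi]|nX].
  rewrite (bigD1 i)//= indicE mem_set//= mulr1 big1 ?addr0// => j ji.
  rewrite indicE memNset ?mulr0// => Xj; move/eqP: ji; apply.
  exact: (Xd _ _ _ Xj Xi).
rewrite big1 ?lexx ?ler01// => i _; rewrite indicE memNset ?mulr0// => Xi.
by apply: nX; exists i.
Qed.

(** Vertex i is represented by the piece [X i] of its mass. A test function equal to [wt s i] on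
    [X i] has integral th s i there, and its value is at most 1 because [X i] has length at least
    th/n. So [cut_trade] bounds th^2 times the bilinear form, up to the one-sided errors [E]. *)
Lemma test_bilinear n d (X : 'I_n -> set RT) (P E : 'I_n -> 'I_n -> R) th eps
  (sg ta : 'I_n -> R) : (0 < n)%N -> kern d ->
  (forall i, measurable (X i)) -> (forall i, X i `<=` I01) ->
  (forall i j x, X i x -> X j x -> i = j) ->
  0 < th -> (forall i, th / n%:R <= len (X i)) ->
  (forall i j, 0 <= E i j) ->
  (forall i j, P i j * (len (X i) * len (X j)) <= box d (X i) (X j) <=
    (P i j + E i j) * (len (X i) * len (X j))) ->
  (forall S T, measurable S -> measurable T -> S `<=` I01 -> T `<=` I01 ->
    `|box d S T| <= eps) ->
  (forall i, 0 <= sg i <= n%:R^-1) -> (forall i, 0 <= ta i <= n%:R^-1) ->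
  `|\sum_i \sum_j P i j * (sg i * ta j)| <=
    eps / th ^+ 2 + (\sum_i \sum_j E i j) / n%:R ^+ 2.
Proof.
move=> n0 kd mX XI Xd th0 thX E0 Pbox deps sg01 ta01.
have n0' : 0 < n%:R :> R by rewrite ltr0n.
have l0 i : 0 < len (X i) by apply: lt_le_trans (thX i); exact: divr_gt0.
pose wt (s : 'I_n -> R) i := th * s i / len (X i).
have wt01 s : (forall i, 0 <= s i <= n%:R^-1) -> forall i, 0 <= wt s i <= 1.
  move=> s01 i; have /andP[s0 s1] := s01 i.
  rewrite /wt; apply/andP; split.
    by apply: divr_ge0; [apply: mulr_ge0 => //; exact: ltW|exact: ltW].
  rewrite ler_pdivrMr// mul1r.
  by apply: le_trans (thX i); rewrite ler_wpM2l// ltW.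
pose fn s x := \sum_i wt s i * \1_(X i) x.
have bX i : bmf (\1_(X i) : RT -> R) by exact: bmf_indic.
have bfn s : bmf (fn s).
  by apply: bmf_sum => i; apply: bmfM => //; exact: bmf_cst.
have fn01 s : (forall i, 0 <= s i <= n%:R^-1) -> forall x, 0 <= fn s x <= 1.
  by move=> s01 x; apply: disjoint_sum01 => //; exact: wt01.
have := @cut_trade R d eps id id (fn sg) (fn ta) kd (@mpi_id R) (@mpi_id R)
  (bfn sg) (bfn ta) (fn01 sg sg01) (fn01 ta ta01) deps.
have bd := bmf_ext kd.
have brect i j : bmf (fun p : RT * RT => wt sg i * wt ta j *
    (ext d p * (\1_(X i) p.1 * \1_(X j) p.2))).
  by apply: bmfM; [exact: bmf_cst|apply: bmfM => //; exact: bmf_rect].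
rewrite (_ : I2 _ = \sum_i \sum_j wt sg i * wt ta j * box d (X i) (X j)); last first.
  transitivity (I2 (fun p => \sum_i \sum_j wt sg i * wt ta j *
      (ext d p * (\1_(X i) p.1 * \1_(X j) p.2)))).
    apply: I2_eq => -[x y] _ /=; rewrite /fn big_distrlr/= mulr_sumr.
    apply: eq_bigr => i _; rewrite mulr_sumr; apply: eq_bigr => j _; ring.
  rewrite I2_sum; last by move=> i; apply: bmf_sum => j; exact: brect.
  apply: eq_bigr => i _; rewrite I2_sum; last by move=> j; exact: brect.
  apply: eq_bigr => j _; rewrite I2Zl ?boxE//.
  by apply: bmfM => //; exact: bmf_rect.
have wtl s i : wt s i * len (X i) = th * s i by rewrite /wt divfK// gt_eqF.
set V := \sum_i \sum_j _; set U := \sum_i \sum_j _; move=> V_le.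
pose W := \sum_i \sum_j E i j * (sg i * ta j).
have W_le : W <= (\sum_i \sum_j E i j) / n%:R ^+ 2.
  rewrite mulr_suml; apply: ler_sum => i _; rewrite mulr_suml; apply: ler_sum => j _.
  have /andP[s0 s1] := sg01 i; have /andP[t0 t1] := ta01 j.
  by rewrite ler_wpM2l// expr2 invfM ler_pM.
have wpos i j : 0 <= wt sg i * wt ta j.
  by have /andP[? _] := wt01 sg sg01 i; have /andP[? _] := wt01 ta ta01 j; exact: mulr_ge0.
have h1 : th ^+ 2 * U <= V.
  rewrite mulr_sumr; apply: ler_sum => i _; rewrite mulr_sumr; apply: ler_sum => j _.
  have /andP[h _] := Pbox i j; apply: le_trans (ler_wpM2l (wpos i j) h).
  rewrite (_ : wt sg i * wt ta j * _ = P i j * ((wt sg i * len (X i)) * (wt ta j * len (X j)))); last by ring.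
  by rewrite !wtl le_eqVlt; apply/orP; left; apply/eqP; ring.
have h2 : V <= th ^+ 2 * U + th ^+ 2 * W.
  rewrite -mulrDr -big_split/= mulr_sumr; apply: ler_sum => i _.
  rewrite -big_split/= mulr_sumr; apply: ler_sum => j _.
  have /andP[_ h] := Pbox i j; apply: le_trans (ler_wpM2l (wpos i j) h) _.
  rewrite (_ : wt sg i * wt ta j * _ = (P i j + E i j) * ((wt sg i * len (X i)) * (wt ta j * len (X j)))); last by ring.
  by rewrite !wtl le_eqVlt; apply/orP; left; apply/eqP; ring.
have th2 : 0 < th ^+ 2 by rewrite exprn_gt0.
have W0 : 0 <= W.
  apply: sumr_ge0 => i _; apply: sumr_ge0 => j _.
  have /andP[s0 s1] := sg01 i; have /andP[t0 t1] := ta01 j.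
  by rewrite !mulr_ge0.
apply: le_trans (lerD (lexx _) W_le).
have e0 : 0 <= eps by exact: le_trans (normr_ge0 _) V_le.
move: V_le; rewrite !ler_norml => /andP[V1 V2]; apply/andP; split.
  rewrite -(ler_pM2l th2) mulrN mulrDr [th ^+ 2 * (eps / _)]mulrC divfK ?gt_eqF//.
  by lra.
apply: ler_wpDr => //; rewrite ler_pdivlMr// mulrC; exact: le_trans h1 V2.
Qed.

Lemma sorting_perm n (c : 'I_n -> nat) : exists s : 'I_n -> 'I_n, injective s /\
  forall i j : 'I_n, (i <= j)%N -> (c (s i) <= c (s j))%N.
Proof.
case: n c => [|n] c; first by exists id; split => // -[].
pose r := sort (fun i j => (c i <= c j)%N) (enum 'I_n.+1).
have sz : size r = n.+1 by rewrite size_sort size_enum_ord.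
have ur : uniq r by rewrite sort_uniq enum_uniq.
exists (fun i => nth ord0 r i); split.
  move=> i j /eqP; rewrite nth_uniq ?sz// => /eqP ij; exact: val_inj.
move=> i j ij; have tr : transitive (fun i j => (c i <= c j)%N).
  by move=> a b d; exact: leq_trans.
apply: (sorted_leq_nth tr) => //; rewrite ?inE ?sz//.
by apply: sort_sorted => a b; exact: leq_total.
Qed.

(** The overlaps [X i a] of vertices with cells form a fractional assignment [lam], which [rounding]
    turns into a map [c]. The model takes the value [up g] at the cells of two vertices; it is thus
    a step function on the n blocks, and sorting by [c] makes it Robinson. The coefficient 4 (k +
    1)^2 is [th ^- 2], 1/n comes from the diagonal terms of [rounding], and 56 is 4 times the 14 of
    [sum_up_lo]. *)
Lemma labeling_close n (A : 'I_n -> 'I_n -> R) u phi psi k eps :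
  (0 < n)%N -> (0 < k)%N ->
  (forall i j, A i j = A j i) -> (forall i j, 0 <= A i j <= 1) ->
  graphon u -> Robinson u -> mp_bijection phi -> mp_bijection psi ->
  cut_close (pull (stepf A) psi) (pull u phi) eps ->
  exists s : 'I_n -> 'I_n, injective s /\ exists r, [/\ graphon r, Robinson r &
    cut_close (stepf (fun i j => A (s i) (s j))) r
      (4 * k.+1%:R ^+ 2 * eps + (n%:R^-1 + 56 / k%:R))].
Proof.
move=> n0 k0 As A01 gu Ru mphi mpsi cl.
have n0' : 0 < n%:R :> R by rewrite ltr0n.
have k0' : 0 < k%:R :> R by rewrite ltr0n.
have gA := stepf_graphon n0 As A01.
pose g := grid_val k u.
have g01 : unit_valued g by exact: grid_val01.
pose Y (i : 'I_n) := I01 `&` pf psi @^-1` (block i).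
pose X (i : 'I_n) (a : 'I_k.+1) := Y i `&` pf phi @^-1` (cell k a).
have [mpsi' mphi'] : measurable_fun setT (pf psi) /\ measurable_fun setT (pf phi).
  by split; [case: (mp_mpi mpsi)|case: (mp_mpi mphi)].
have mY i : measurable (Y i).
  by have [] := mp_pre mpsi (measurable_block i) (@block_sub R n i).
have lY i : len (Y i) = n%:R^-1.
  by rewrite -(len_block R i); have [] := mp_pre mpsi (measurable_block i) (@block_sub R n i).
have YI i : Y i `<=` I01 by move=> x [].
have mZ (a : nat) : measurable (pf phi @^-1` (cell k a)).
  by have := mphi' measurableT _ (@measurable_cell R k a); rewrite setTI.
have mX i a : measurable (X i a) by apply: measurableI; [exact: mY|exact: mZ].
have XI i a : X i a `<=` I01 by move=> x [/YI].
pose lam i a := len (X i a).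
have lam1 i : \sum_a lam i a = n%:R^-1.
  rewrite -(lY i); apply: (@len_partition _ (Y i) (fun a : 'I_k.+1 => pf phi @^-1` (cell k a)) (mY i) (@YI i)).
    by move=> a; exact: mX.
  move=> x Ix; rewrite -(@sum_cell R k (phi x) k0 (mp_maps mphi Ix)).
  apply: eq_bigr => a _; rewrite !indicE; congr (nat_of_bool _)%:R.
  by apply/idP/idP => /set_mem h; apply/mem_set; move: h; rewrite /= pfE.
(* The pieces [X i a], for all i together, make up the preimage under phi of the part of cell a in
   [0,1]. *)
have lam2 a : \sum_i lam i a <= k%:R^-1.
  have mC : measurable (I01 `&` @cell R k a).
    by apply: measurableI; [exact: mI01|exact: measurable_cell].
  apply: le_trans (len_cap_cell a k0 (@mI01 R) (@subset_refl _ _)).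
  have [mP <-] := mp_pre mphi mC (@subIsetl _ _ _).
  rewrite -(@len_partition _ _ (fun i : 'I_n => pf psi @^-1` (block i)) mP (@subIsetl _ _ _)).
  - rewrite le_eqVlt; apply/orP; left; apply/eqP; apply: eq_bigr => i _.
    congr len; apply/seteqP; split => x /=.
      move=> [[Ix xi] xa]; split => //; split => //; split => //.
      by rewrite pfE//; exact: mp_maps.
    by move=> [[Ix [_ xa]] xi].
  - move=> i; apply: measurableI => //.
    by have := mpsi' measurableT _ (@measurable_block R n i); rewrite setTI.
  - move=> x Ix; have [i xi] := block_exists n0 (mp_maps mpsi Ix).
    transitivity (\sum_(j < n) (j == i)%:R : R).
      apply: eq_bigr => j _; rewrite -(indic_block j xi) !indicE.
      congr (nat_of_bool _)%:R; apply/idP/idP => /set_mem h; apply/mem_set;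
      by move: h; rewrite /= pfE.
    by rewrite (bigD1 i)//= eqxx big1 ?addr0// => j /negbTE ->.
pose E (a b : 'I_k.+1) := up g a b - lo k g a b.
have E01 a b : 0 <= E a b <= 1.
  have /andP[u0 u1] := up01 a b g01; have /andP[l0 l1] := lo01 k a b g01.
  rewrite /E subr_ge0 lerBlDr (le_trans u1) ?lerDl// andbT.
  have ak : (a <= k)%N by rewrite -ltnS.
  have bk : (b <= k)%N by rewrite -ltnS.
  have xa : cell k a (a%:R / k%:R : R).
    by rewrite /cell/= in_itv/= lexx/= ltr_pM2r ?invr_gt0// ltr_nat.
  have yb : cell k b (b%:R / k%:R : R).
    by rewrite /cell/= in_itv/= lexx/= ltr_pM2r ?invr_gt0// ltr_nat.
  have /andP[] := grid_between k0 gu Ru (grid_I01 k0 ak) (grid_I01 k0 bk) xa yb.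
  exact: le_trans.
have lam0 i a : 0 <= lam i a by exact: len_ge0.
have [c [c1 c2]] := rounding n0 lam0 lam1 E01.
have sumE : (\sum_i \sum_j E (c i) (c j)) / n%:R ^+ 2 <= n%:R^-1 + 56 / k%:R.
  apply: le_trans c2 _; rewrite lerD2l.
  rewrite (_ : 56 / k%:R = 4 * (14 / k%:R)); last by ring.
  rewrite ler_wpM2l//.
  apply: (@le_trans _ _ (\sum_a \sum_b E a b * (k%:R^-1 * k%:R^-1))).
    apply: ler_sum => a _; apply: ler_sum => b _; have /andP[Eab _] := E01 a b.
    by rewrite ler_wpM2l// ler_pM// sumr_ge0.
  under eq_bigr do rewrite -mulr_suml.
  rewrite -mulr_suml mulrA; apply: ler_wpM2r; first by rewrite invr_ge0 ltW.
  rewrite ler_pdivrMr//.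
  have := sum_up_lo k0 g01; rewrite big_mkord; apply: le_trans.
  rewrite le_eqVlt; apply/orP; left; apply/eqP.
  by apply: eq_bigr => i _; rewrite big_mkord.
have [s [sinj smono]] := sorting_perm (fun i => c i : nat).
exists s; split => //.
pose r0 i j := up g (c (s i)) (c (s j)).
have r0s i j : r0 i j = r0 j i by exact: up_sym.
have r001 i j : 0 <= r0 i j <= 1 by exact: up01.
exists (stepf r0); split.
- exact: stepf_graphon.
- apply: stepf_Robinson => // i j l /andP[ij jl].
  apply: (@up_Robinson _ k) => //; first exact: grid_rmono.
    by rewrite !smono.
  by rewrite -ltnS.
have sb : bijective s by exact: injF_bij.
have [si sK siK] := sb.
move=> S T mS mT SI TI.
have gAs : graphon (stepf (fun i j => A (s i) (s j))) by apply: stepf_graphon.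
have gr : graphon (stepf r0) by apply: stepf_graphon.
rewrite (boxB (graphon_kern gAs) (graphon_kern gr) mS mT SI TI).
rewrite !box_stepf// -sumrB.
pose P i j := A i j - up g (c i) (c j).
(* Vertex i sits in block [si i] of the sorted labeling; the test sets are read there, so that the
   estimate is made in the original order of the vertices. *)
pose sg i := len (S `&` block (si i)); pose ta i := len (T `&` block (si i)).
rewrite (_ : \sum_(i < n) _ = \sum_i \sum_j P i j * (sg i * ta j)); last first.
  rewrite [RHS](reindex s) /=; last by exists si => i _.
  apply: eq_bigr => i _; rewrite [RHS](reindex s) /=; last by exists si => j _.
  by rewrite -sumrB; apply: eq_bigr => j _; rewrite /sg /ta !sK /P /r0 mulrBl.
pose th : R := (2 * k.+1%:R)^-1.
have th0 : 0 < th by rewrite invr_gt0 mulr_gt0.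
have len01 (B : set RT) (i : 'I_n) : measurable B -> B `<=` I01 -> 0 <= len (B `&` block i) <= n%:R^-1.
  move=> mB BI; rewrite len_ge0 -(len_block R i) len_le//.
  - by apply: measurableI => //; exact: measurable_block.
  - exact: measurable_block.
  - exact: block_sub.
rewrite (_ : 4 * k.+1%:R ^+ 2 * eps = eps / th ^+ 2); last first.
  by rewrite /th exprVn invrK; ring.
have kd := graphonB_kern (graphon_pull gA mpsi) (graphon_pull gu mphi).
apply: le_trans (lerD (lexx _) sumE).
apply: (@test_bilinear n _ (fun i => X i (c i)) P (fun i j => E (c i) (c j)) th eps sg ta n0 kd
  (fun i => mX i (c i)) (fun i => @XI i (c i))) => //.
- move=> i j x [[Ix xi] _] [[_ xj] _]; move: xi xj; rewrite /= pfE//.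
  exact: block_inj.
- move=> i; apply: le_trans (c1 i); rewrite /th -invfM.
  by rewrite le_eqVlt; apply/orP; left; apply/eqP; congr (_^-1); ring.
- by move=> i j; have /andP[] := E01 (c i) (c j).
- move=> i j; apply: (box_between kd (mX i (c i)) (mX j (c j)) (@XI i (c i)) (@XI j (c j))).
  move=> x y [[Ix xi] xa] [[Iy yj] yb].
  move: xi xa yj yb; rewrite /= !pfE// => xi xa yj yb.
  rewrite /pull (stepfE _ xi yj) /P /E.
  have := grid_between k0 gu Ru (mp_maps mphi Ix) (mp_maps mphi Iy) xa yb.
  by rewrite -/g; lra.
- by move=> i; exact: len01.
- by move=> i; exact: len01.
Qed.

End Labeling.

(** * Graphs *)

Section GraphGraphonTheory.
Variable R : realType.
Local Notation RT := (measurableTypeR R).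
Local Notation I01 := (@I01 R).

Lemma graphon_of_mx_graphon n (H : 'M[bool]_n) : (forall i j, H i j = H j i) ->
  graphon (graphon_of_mx H : R -> R -> R).
Proof.
move=> Hs; case: n H Hs => [|n] H Hs.
  have -> : graphon_of_mx H = (fun _ _ => 0) :> (R -> R -> R).
    by apply/funext => x; apply/funext => y; rewrite /graphon_of_mx big_ord0.
  by split => // x y _ _; rewrite lexx ler01.
rewrite graphon_of_mx_stepf; apply: stepf_graphon => // [i j|i j]; first by rewrite Hs.
by case: (H i j); rewrite ?ler01 ?lexx.
Qed.

Lemma std_adj_sym (G : sgraph) i j : std_adj G i j = std_adj G j i.
Proof. by rewrite !mxE adj_sym. Qed.

Lemma labelingP (G : sgraph) (H : 'M[bool]_#|G|) : labeling H ->
  exists2 f : 'I_#|G| -> 'I_#|G|, bijective f &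
    forall i j, H (f i) (f j) = std_adj G i j.
Proof.
move=> /existsP[s /andP[/injectiveP sinj /forallP sH]].
pose g j := enum_rank (s j).
have ginj : injective g by move=> i j /enum_rank_inj/sinj.
exists (invF ginj); first by exists g; [exact: f_invF|exact: invF_f].
move=> i j; rewrite -[in RHS](f_invF ginj i) -[in RHS](f_invF ginj j) mxE !enum_rankK.
by have /forallP/(_ (invF ginj j))/eqP := sH (invF ginj i).
Qed.

Lemma labeling_sym (G : sgraph) (H : 'M[bool]_#|G|) : labeling H ->
  forall i j, H i j = H j i.
Proof.
move=> /existsP[s /andP[_ /forallP sH]] i j.
have /forallP/(_ j)/eqP -> := sH i; have /forallP/(_ i)/eqP -> := sH j.
exact: adj_sym.
Qed.

Lemma labeling_perm (G : sgraph) (s : 'I_#|G| -> 'I_#|G|) : injective s ->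
  labeling (\matrix_(i, j) std_adj G (s i) (s j)).
Proof.
move=> sinj; apply/existsP; exists [ffun i => enum_val (s i)]; apply/andP; split.
  by apply/injectiveP => i j; rewrite !ffunE => /enum_val_inj/sinj.
by apply/forallP => i; apply/forallP => j; rewrite !mxE !ffunE.
Qed.

Lemma Gamma_tilde_ge0 (G : sgraph) : 0 <= Gamma_tilde R G.
Proof.
have [H lH ->] := Gamma_tilde_attained R G.
apply/Gamma_ge0/graphon_kern/graphon_of_mx_graphon; exact: labeling_sym.
Qed.

Lemma graphon_of_graphon (G : sgraph) : graphon (graphon_of R G).
Proof. exact: graphon_of_mx_graphon (@std_adj_sym G). Qed.

(** [block_perm f] carries block i to block f i up to the endpoint 1. It links the labeling that
    minimises [Gamma] with the standard one, in which convergence is stated. *)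
Lemma relabel_close (G : sgraph) (H : 'M[bool]_#|G|) : (0 < #|G|)%N -> labeling H ->
  exists2 sg : R -> R, mp_bijection sg &
    cut_close (pull (graphon_of_mx H) sg) (graphon_of R G) 0.
Proof.
move=> G0 lH; have [f [g fK gK] fH] := labelingP lH.
have sgmp := @block_perm_mp R _ f g fK gK G0.
have gH : graphon (graphon_of_mx H : R -> R -> R).
  by apply: graphon_of_mx_graphon; exact: labeling_sym.
exists (block_perm f) => //; apply: cut_close0_off1.
- exact: graphon_pull.
- exact: graphon_of_graphon.
move=> x y Ix Iy x1 y1.
have [i xi] := block_exists G0 Ix; have [j yj] := block_exists G0 Iy.
have B (z : R) k : I01 z -> z < 1 -> block k z -> block (f k) (block_perm f z).
  move=> Iz z1 zk; have zc : cell #|G| k z by apply/block_cell.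
  have zc' := block_perm_cell f zc; apply/block_cell => //.
  have [|//] := leP 1 (block_perm f z) => h.
  have /I01P/andP[_ h'] := cell_I01 zc'.
  have E : block_perm f z = 1 by apply/eqP; rewrite eq_le h'.
  by move: zc'; rewrite E => /(cell_not1 G0).
rewrite /pull /graphon_of !graphon_of_mx_stepf.
rewrite (stepfE _ (B x i Ix x1 xi) (B y j Iy y1 yj)) (stepfE _ xi yj).
by rewrite fH.
Qed.

Lemma archi_div (a e : R) : 0 <= a -> 0 < e -> exists2 k : nat, (0 < k)%N & a / k%:R <= e.
Proof.
move=> a0 e0; exists (Num.truncn (a / e)).+1 => //.
have /truncn_itv/andP[_ h] : 0 <= a / e by rewrite divr_ge0// ltW.
by rewrite ler_pdivrMr// mulrC -ler_pdivrMr// ltW.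
Qed.

(** The order of choices matters: N fixes the amplification [c] in [Gamma_perturb], then k makes 56
    c/k small, then m makes c/n small, and the closeness comes last since it has to beat b = 4 (k +
    1)^2 c. *)
Lemma Robinsonian_Gamma_tilde (w : R -> R -> R) (eps : R) : graphon w ->
  Robinsonian w -> 0 < eps -> exists m : nat, exists2 d : R, 0 < d &
    forall G : sgraph, (m <= #|G|)%N -> cut_dist (graphon_of R G) w < d ->
      Gamma_tilde R G <= eps.
Proof.
move=> gw [u [gu Ru uw]] e0.
have split8 (x y z : R) : x <= eps / 2 -> y <= eps / 8 -> z <= eps / 8 ->
  x + (eps / 8 + (y + z)) <= eps by lra.
have e2 : 0 < eps / 2 by rewrite divr_gt0.
have e8 : 0 < eps / 8 by rewrite divr_gt0.
have [N N0 hN] := archi_div (ler0n R 4) e2.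
pose c : R := 8 * N.+1%:R.
have c0 : 0 < c by rewrite mulr_gt0.
have [k k0 hk] := archi_div (mulr_ge0 (ltW c0) (ler0n R 56)) e8.
have [m m0 hm] := archi_div (ltW c0) e8.
pose b : R := c * (4 * k.+1%:R ^+ 2).
have b0 : 0 < b by rewrite !mulr_gt0// exprn_gt0.
pose e : R := eps / 8 / b.
have ee0 : 0 < e by rewrite divr_gt0.
have d0 : 0 < e / 2 by rewrite divr_gt0.
exists m, (e / 2) => // G mG wG.
have G0 : (0 < #|G|)%N by apply: leq_trans mG.
have gG := graphon_of_graphon G.
have [psi mpsi cpsi] := cut_dist_lt gG gw wG.
have uw' : cut_dist u w < e / 2 by rewrite uw.
have [phi mphi cphi] := cut_dist_lt gu gw uw'.
(* w serves as the common frame: the graph is pulled back by psi and u by phi, each within [e / 2]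
   of w. *)
have cl := cut_close_trans (graphon_pull gG mpsi) gw (graphon_pull gu mphi) cpsi
  (cut_close_sym (graphon_pull gu mphi) gw cphi).
rewrite -splitr /graphon_of graphon_of_mx_stepf in cl.
have As (i j : 'I_#|G|) : (std_adj G i j)%:R = (std_adj G j i)%:R :> R.
  by rewrite std_adj_sym.
have A01 (i j : 'I_#|G|) : 0 <= ((std_adj G i j)%:R : R) <= 1.
  by case: (std_adj G i j); rewrite ?ler01 ?lexx.
have [s [sinj [r [gr Rr sr]]]] := labeling_close G0 k0 As A01 gu Ru mphi mpsi cl.
apply: le_trans (Gamma_tilde_le R (labeling_perm sinj)) _.
have gs : graphon (stepf (fun i j => (std_adj G (s i) (s j))%:R : R)).
  by apply: stepf_graphon.
rewrite graphon_of_mx_stepf.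
have -> : stepf (fun i j => ((\matrix_(i, j) std_adj G (s i) (s j)) i j)%:R) =
    stepf (fun i j => (std_adj G (s i) (s j))%:R) :> (R -> R -> R).
  congr stepf; apply/funext => i; apply/funext => j; by rewrite mxE.
apply: le_trans (Gamma_perturb gs gr Rr N0 sr) _.
rewrite -/c mulrDr mulrA -/b mulrDr.
have -> : b * e = eps / 8 by rewrite /e mulrC divfK// gt_eqF.
have h1 : c * (#|G|%:R)^-1 <= eps / 8.
  apply: le_trans hm; rewrite ler_wpM2l ?(ltW c0)//.
  by rewrite lef_pV2 ?posrE ?ltr0n// ler_nat.
by rewrite mulrA; exact: split8.
Qed.

(** The limit u is fixed before the error c. For each c, the indices n where W_n is close to u,
    where w_{G_n} is close to w, and where the graph is nonempty form sets of the ultrafilter; these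
    meet, and one common index suffices. *)
Lemma Gamma_tilde_Robinsonian (G : nat -> sgraph) (w : R -> R -> R) : graphon w ->
  (fun n => #|G n|) @ \oo --> \oo ->
  (fun n => cut_dist (graphon_of R (G n)) w) @ \oo --> (0 : R) ->
  (fun n => Gamma_tilde R (G n)) @ \oo --> (0 : R) -> Robinsonian w.
Proof.
move=> gw Gsize Gw Gt.
(* An ultrafilter finer than the eventual filter inherits every limit at infinity. *)
have [F [FU ooF]] := ultraFilterLemma (eventually_filter).
have ex n : exists H : 'M[bool]_#|G n|, labeling H /\
    Gamma_tilde R (G n) = Gamma (graphon_of_mx H : R -> R -> R).
  by have [H lH GH] := Gamma_tilde_attained R (G n); exists H; exact: conj lH GH.
pose H n := projT1 (cid (ex n)).
have lH n : labeling (H n) by case: (projT2 (cid (ex n))).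
have GH n : Gamma_tilde R (G n) = Gamma (graphon_of_mx (H n) : R -> R -> R).
  by case: (projT2 (cid (ex n))).
pose W n : R -> R -> R := graphon_of_mx (H n).
have gW n : graphon (W n) by apply: graphon_of_mx_graphon; exact: labeling_sym.
have GW : (fun n => Gamma (W n)) @ F --> (0 : R).
  have <- : (fun n => Gamma_tilde R (G n)) = (fun n => Gamma (W n)) by apply/funext.
  by move=> A A0; apply: ooF; exact: Gt A A0.
pose u := limit_graphon W F.
have gu : graphon u by exact: limit_graphon_graphon.
exists u; split => //; first exact: limit_graphon_Robinson.
apply: cut_dist_eq0 => // c c0.
have c2 : 0 < c / 2 by rewrite divr_gt0.
have h1 := limit_graphon_close gW FU GW c2.
have h2 : F [set n | cut_dist (graphon_of R (G n)) w < c / 2].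
  apply: ooF; move: Gw => /cvgrPdist_lt/(_ _ c2); apply: filterS => n /=.
  by rewrite sub0r normrN; apply: le_lt_trans; exact: ler_norm.
have h3 : F [set n | (0 < #|G n|)%N].
  by apply: ooF; exact: (Gsize _ (nbhs_infty_gt 0)).
have [n [[h1n h2n] h3n]] := filter_ex (filterI (filterI h1 h2) h3).
have gG := graphon_of_graphon (G n).
have [phi mphi cphi] := cut_dist_lt gG gw h2n.
have [sg msg csg] := relabel_close h3n (lH n).
(* [sg] passes from the minimising labeling to the standard one, and [phi] overlays the standard one
   with w. *)
exists (sg \o phi); first exact: mp_comp.
have l1 : cut_close u (W n) (c / 2) by exact: (cut_close_sym (gW n) gu h1n).
have l2 := cut_close_pull gu (gW n) msg l1.
have l3 := cut_close_trans (graphon_pull gu msg) (graphon_pull (gW n) msg) gG l2 csg.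
have l4 := cut_close_pull (graphon_pull gu msg) gG mphi l3.
have := cut_close_trans (graphon_pull (graphon_pull gu msg) mphi)
  (graphon_pull gG mphi) gw l4 cphi.
by rewrite addr0 -splitr.
Qed.

End GraphGraphonTheory.

Unset Implicit Arguments.
Set Strict Implicit.

Theorem theorem5p3 (R : realType) (G : nat -> sgraph) (w : R -> R -> R)
  (hw : graphon w)
  (hsize : (fun n => #|G n|) @ \oo --> \oo)
  (hconv : (fun n => cut_dist (graphon_of R (G n)) w) @ \oo --> (0 : R)) :
  Robinsonian w <-> (fun n => Gamma_tilde R (G n)) @ \oo --> (0 : R).
Proof.
split; last exact: Gamma_tilde_Robinsonian.
move=> Rw; apply/cvgrPdist_le => eps e0.
have [m [d d0 hd]] := Robinsonian_Gamma_tilde hw Rw e0.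
have h1 : \forall n \near \oo, (m <= #|G n|)%N.
  exact: (hsize _ (nbhs_infty_ge m)).
move: hconv => /cvgrPdist_lt/(_ _ d0); move: h1; apply: filterS2 => n mG.
rewrite sub0r normrN => /(le_lt_trans (ler_norm _)) wG.
by rewrite sub0r normrN (ger0_norm (Gamma_tilde_ge0 _ _)); exact: hd.
Qed.
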